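(* Let $\mu,\lambda,\lambda'\in\mathbb{R}$. On the Bargmann space $\mathbb{B}$ let $S_2=A^{*2}A^2$, $H_{\mu,\lambda}=\mu A^*A+i\lambda A^*(A+A^* )A$ and $H_{\lambda'}=\lambda'S_2+H_{\mu,\lambda}$. Then: (i) for every $\epsilon>0$ there exists $C_\epsilon>0$ such that $|\langle H_{\mu,\lambda}\phi,\phi\rangle|\le\epsilon\langle S_2\phi,\phi\rangle+C_\epsilon\|\phi\|^2$ for all $\phi\in D(S_2)$. (ii) If $\lambda'>0$, there exists $C>0$ such that $\mathrm{Re}\,\langle H_{\lambda'}\phi,\phi\rangle\ge-C\|\phi\|^2$ for all $\phi\in D_{min}(H_{\lambda'})$. (iii) If $\lambda'<0$, there exists $C>0$ such that $\mathrm{Re}\,\langle H_{\lambda'}\phi,\phi\rangle\le C\|\phi\|^2$ for all $\phi\in D_{min}(H_{\lambda'})$. (iv) If $\lambda'\neq0$, there exists $\beta_0\in\mathbb{R}$ such that $H_{\lambda'}^{min}+\beta_0I$ is invertible from $D_{min}(H_{\lambda'})$ to $\mathbb{B}$.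
   Context: The Bargmann space $\mathbb{B}$ is the Hilbert space of entire functions with $\|\varphi\|^2=\frac1\pi\int_{\mathbb{C}}|\varphi(z)|^2e^{-|z|^2}dx\,dy<\infty$. $A\varphi=\varphi'$ with domain $\{\varphi\in\mathbb{B}:\varphi'\in\mathbb{B}\}$ and $A^*\varphi=z\varphi$ with domain $\{\varphi\in\mathbb{B}:z\varphi\in\mathbb{B}\}$ are adjoint to each other. $S_2$ is taken on its natural domain $D(S_2)$ (where it is self-adjoint). For a polynomial expression $P$ in $A,A^*$, $D_{min}(P)$ is the set of $\varphi\in\mathbb{B}$ for which there are complex polynomials $p_n$ in $z$ and $\psi\in\mathbb{B}$ with $p_n\to\varphi$ and $Pp_n\to\psi$ in $\mathbb{B}$; $P^{min}$ is the operator $\varphi\mapsto\psi$ with domain $D_{min}(P)$, i.e. the closure of $P$ restricted to polynomials (on $D_{min}(H_{\lambda'})$, $H_{\lambda'}$ means $H_{\lambda'}^{min}$). Invertible means bijective with bounded inverse. *)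

(* Defs.v *)
From mathcomp Require Import all_boot all_order all_algebra.
From mathcomp Require Import all_classical all_reals all_analysis.
From mathcomp Require Import complex.
Import Order.TTheory GRing.Theory Num.Theory numFieldNormedType.Exports.

Set Implicit Arguments.
Unset Strict Implicit.
Unset Printing Implicit Defensive.

Local Open Scope classical_set_scope.
Local Open Scope ring_scope.
Local Open Scope complex_scope.

Section Bargmann.
Context {R : realType}.
Local Notation C := R[i].
Implicit Types phi psi : C -> C.

(* [C^o] carries the normed-module structure over [C] itself, so [derivable]
   in the direction 1 is complex differentiability. *)
Definition entire phi : Prop := forall z : C^o, derivable (phi : C^o -> C^o) z 1.

(* Lebesgue measure dx dy on the plane, with z = x + iy. *)
Definition plane_measure := (@lebesgue_measure R \x @lebesgue_measure R)%E.

Definition point (w : R * R) : C := w.1 +i* w.2.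

Definition gauss_weight (w : R * R) : R := expR (- (w.1 ^+ 2 + w.2 ^+ 2)).

Definition bargmann_norm2 phi : \bar R :=
  ((pi^-1)%:E * \int[plane_measure]_(w in setT)
     (Normc.normc (phi (point w)) ^+ 2 * gauss_weight w)%:E)%E.

Definition bargmann : set (C -> C) :=
  [set phi | entire phi /\ (bargmann_norm2 phi < +oo)%E].

Definition bnorm phi : R := Num.sqrt (fine (bargmann_norm2 phi)).

(* Linear in the first argument; on [bargmann] the integrand is absolutely
   integrable by the Cauchy-Schwarz inequality. *)
Definition bdot phi psi : C :=
  let F w := phi (point w) * conjc (psi (point w)) * (gauss_weight w)%:C in
  (pi^-1)%:C *
  (Rintegral plane_measure setT (fun w => complex.Re (F w)) +i*
   Rintegral plane_measure setT (fun w => complex.Im (F w))).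

(* Operators are formal expressions acting on all functions C -> C; domains
   are kept apart as sets. *)
Definition opA phi : C -> C := derive1 (phi : C -> C^o).
Definition opAstar phi : C -> C := fun z => z * phi z.

Definition S2 phi : C -> C := opAstar (opAstar (opA (opA phi))).

(* The maximal domain of the differential expression z^2 d^2/dz^2. *)
Definition D_S2 : set (C -> C) :=
  [set phi | bargmann phi /\ bargmann (S2 phi)].

Definition H_ml (mu lambda : R) phi : C -> C := fun z =>
  mu%:C * opAstar (opA phi) z +
  (0 +i* lambda) * opAstar (fun y => opA (opA phi) y + opAstar (opA phi) y) z.

Definition H_full (lambda' mu lambda : R) phi : C -> C := fun z =>
  lambda'%:C * S2 phi z + H_ml mu lambda phi z.

Definition bcvg (f : (C -> C)^nat) phi : Prop :=
  bnorm (fun z => f n z - phi z) @[n --> \oo] --> (0 : R).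

Definition min_graph (P : (C -> C) -> (C -> C)) phi psi : Prop :=
  [/\ bargmann phi, bargmann psi &
      exists p : nat -> {poly C},
        bcvg (fun n => horner (p n)) phi /\
        bcvg (fun n => P (horner (p n))) psi].

Definition D_min (P : (C -> C) -> (C -> C)) : set (C -> C) :=
  [set phi | exists psi, min_graph P phi psi].

(* For [P] a polynomial expression in [opA] and [opAstar], [psi] is unique, as
   convergence in the Bargmann norm implies locally uniform convergence of
   the functions and all their derivatives; so the choice made by [xget] is
   immaterial. *)
Definition op_min (P : (C -> C) -> (C -> C)) phi : C -> C :=
  xget (fun=> 0) [set psi | min_graph P phi psi].

(* Bijective from the domain [D] onto the Bargmann space, the inverse
   [T phi |-> phi] being bounded. *)
Definition invertible (D : set (C -> C)) (T : (C -> C) -> (C -> C)) : Prop :=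
  set_bij D bargmann T /\
  exists M : R, forall phi, D phi -> bnorm phi <= M * bnorm (T phi).

End Bargmann.

(* Main.v *)
(* An entire function is the sum of its Taylor series (Cauchy's formula comes
   from Goursat's argument applied to a homotopy contracting a circle to a
   point), and the rotation invariance of the Gaussian measure yields Parseval's
   identity [||phi||^2 = \sum_n n! |a_n|^2].  On the coefficient sequences,
   [lambda' S_2 + mu A^* A] is the diagonal operator with entries
   [lambda' n (n - 1) + mu n], while [i lambda A^* (A + A^* ) A] couples [n] to
   [n - 1] and [n + 1] with weights that grow more slowly than [n^2] in the
   normalized basis.  The form bound is Cauchy-Schwarz.  Adding a real
   constant [be] of the sign of [lambda'], large in absolute value, to the
   diagonal makes its square dominate, and the off-diagonal part becomes bounded
   relatively to the diagonal part [D] with relative bound at most 1/2.  A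
   Neumann series then inverts the sum, and the a priori estimate
   [||D a|| <= 2 ||T a||] for [T = H + be] identifies the domain of the closure
   of [H] on polynomials with the domain of [D]. *)
Require Import Defs.
From mathcomp Require Import all_boot all_order all_algebra.
From mathcomp Require Import all_classical all_reals all_analysis.
From mathcomp Require Import cyclic separable cyclotomic measurable_realfun complex ring lra.
Import Order.TTheory GRing.Theory Num.Theory numFieldNormedType.Exports.
Local Open Scope classical_set_scope.
Local Open Scope ring_scope.
Local Open Scope complex_scope.
Set Implicit Arguments.
Unset Strict Implicit.
Unset Printing Implicit Defensive.

(** * Complex numbers and power series *)

(** Parseval's identity is proved in the extended reals, for every entire function, so that
    membership in the space or in a domain is the same thing as finiteness of a weighted sum of
    squared coefficients. It is obtained in Cartesian coordinates: a rotation is a product of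
    shears, which Tonelli reduces to translations; averaging over the [N]-th roots of unity replaces
    the integral over the angle; and Fatou's lemma gives each of the two inequalities, once on the
    averages and once on the partial sums. Goursat's argument is run on the form
    [phi(z) dz / (z - a)] in the coordinates [z = a + exp(s) W(t)]. In the factorial weights the
    squared off-diagonal entries have size [(m + 1) m^2], against [m^2 (m - 1)^2] for the square of
    the diagonal of [S2]. When [lam'] is nonzero, domination can thus only fail at finitely many
    indices, and the constant [be] repairs those. *)

Section ComplexNorm.
Context {R : realType}.
Local Notation C := R[i].
Implicit Types x y z : C.

Lemma normcE' z : `|z| = (Normc.normc z)%:C. Proof. by []. Qed.

Lemma normc_ge0 z : 0 <= Normc.normc z.
Proof. by case: z => a b /=; exact: sqrtr_ge0. Qed.

Lemma normc_sqr z : Normc.normc z ^+ 2 = complex.Re z ^+ 2 + complex.Im z ^+ 2.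
Proof. by case: z => a b /=; rewrite sqr_sqrtr// addr_ge0 ?sqr_ge0. Qed.

Lemma normc_ge_absRe z : `|complex.Re z| <= Normc.normc z.
Proof.
rewrite -(@ler_pXn2r _ 2) ?nnegrE ?normc_ge0//.
by rewrite normc_sqr real_normK ?num_real// lerDl sqr_ge0.
Qed.

Lemma normc_ge_absIm z : `|complex.Im z| <= Normc.normc z.
Proof.
rewrite -(@ler_pXn2r _ 2) ?nnegrE ?normc_ge0//.
by rewrite normc_sqr real_normK ?num_real// lerDr sqr_ge0.
Qed.

Lemma normc_le_ReIm z : Normc.normc z <= `|complex.Re z| + `|complex.Im z|.
Proof.
rewrite -(@ler_pXn2r _ 2) ?nnegrE ?normc_ge0 ?addr_ge0//.
rewrite normc_sqr sqrrD !real_normK ?num_real//.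
have : 0 <= `|complex.Re z| * `|complex.Im z| by rewrite mulr_ge0.
lra.
Qed.

Lemma normcX z n : Normc.normc (z ^+ n) = Normc.normc z ^+ n.
Proof.
elim: n => [|n IH]; first by rewrite !expr0 Normc.normc1.
by rewrite !exprS Normc.normcM IH.
Qed.

Lemma normc_real (r : R) : Normc.normc r%:C = `|r|.
Proof. by rewrite /= expr0n/= addr0 sqrtr_sqr. Qed.

Lemma normc_sum I (s : seq I) (P : pred I) (F : I -> C) :
  Normc.normc (\sum_(i <- s | P i) F i) <= \sum_(i <- s | P i) Normc.normc (F i).
Proof.
elim/big_ind2 : _ => [|x1 x2 y1 y2 H1 H2|//]; first by rewrite Normc.normc0.
by rewrite (le_trans (le_normcD _ _))// lerD.
Qed.

Lemma cReD x y : complex.Re (x + y) = complex.Re x + complex.Re y.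
Proof. by case: x y => ? ? []. Qed.
Lemma cImD x y : complex.Im (x + y) = complex.Im x + complex.Im y.
Proof. by case: x y => ? ? []. Qed.
Lemma cReN x : complex.Re (- x) = - complex.Re x.
Proof. by case: x. Qed.
Lemma cImN x : complex.Im (- x) = - complex.Im x.
Proof. by case: x. Qed.
Lemma cReM x y : complex.Re (x * y) =
  complex.Re x * complex.Re y - complex.Im x * complex.Im y.
Proof. by case: x y => ? ? []. Qed.
Lemma cImM x y : complex.Im (x * y) =
  complex.Re x * complex.Im y + complex.Im x * complex.Re y.
Proof. by case: x y => ? ? []. Qed.
Lemma cReJ x : complex.Re (conjc x) = complex.Re x.
Proof. by case: x. Qed.
Lemma cImJ x : complex.Im (conjc x) = - complex.Im x.
Proof. by case: x. Qed.

Lemma complex_eq x y :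
  complex.Re x = complex.Re y -> complex.Im x = complex.Im y -> x = y.
Proof. by case: x y => ? ? [] ? ? /= -> ->. Qed.

Definition ReImE := (cReM, cImM, cReD, cImD, cReN, cImN, cReJ, cImJ).

Lemma ltc0E (e : C) : 0 < e -> e = (complex.Re e)%:C /\ 0 < complex.Re e.
Proof. by case: e => a b; rewrite ltcE/= => /andP[/eqP -> ?]. Qed.

Section cvg.
Context {T : Type} {F : set_system T} {FF : Filter F}.
Implicit Types (f : T -> C) (l : C).

Lemma cvgc_normP f l :
  (f : T -> C^o) @ F --> (l : C^o) <->
  Normc.normc (f t - l) @[t --> F] --> (0 : R).
Proof.
split=> [/cvgrPdist_lt H|/cvgrPdist_lt H].
  apply/cvgrPdist_lt => e e0.
  have /H : 0 < e%:C :> C by rewrite ltcR.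
  apply: filterS => t; rewrite distrC normcE' ltcR => h.
  by rewrite sub0r normrN ger0_norm ?normc_ge0.
apply/cvgrPdist_lt => e /ltc0E[-> /H].
apply: filterS => t.
by rewrite sub0r normrN ger0_norm ?normc_ge0// distrC normcE' ltcR.
Qed.

Lemma cvgc_ReImP f l :
  (f : T -> C^o) @ F --> (l : C^o) <->
  (complex.Re (f t) @[t --> F] --> complex.Re l /\
   complex.Im (f t) @[t --> F] --> complex.Im l).
Proof.
split=> [/cvgc_normP/cvgrPdist_lt H|[/cvgrPdist_lt H1 /cvgrPdist_lt H2]].
  split; apply/cvgrPdist_lt => e /H; apply: filterS => t;
    rewrite sub0r normrN ger0_norm ?normc_ge0// => h; rewrite distrC;
    apply: le_lt_trans h.
  - by rewrite -cReN -cReD; exact: normc_ge_absRe.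
  - by rewrite -cImN -cImD; exact: normc_ge_absIm.
apply/cvgc_normP/cvgrPdist_lt => e e0.
have e2 : 0 < e / 2 by rewrite divr_gt0.
move: (H1 _ e2) (H2 _ e2); apply: filterS2 => t h1 h2.
rewrite sub0r normrN ger0_norm ?normc_ge0//.
rewrite (le_lt_trans (normc_le_ReIm _))// [ltRHS](splitr e) ltrD//.
- by rewrite cReD cReN distrC.
- by rewrite cImD cImN distrC.
Qed.

Lemma cvgcD f g l m : (f : T -> C^o) @ F --> (l : C^o) -> (g : T -> C^o) @ F --> (m : C^o) ->
  ((fun t => f t + g t) : T -> C^o) @ F --> (l + m : C^o).
Proof. exact: (@cvgD C C^o T F FF f g l m). Qed.

Lemma cvgcB f g l m : (f : T -> C^o) @ F --> (l : C^o) -> (g : T -> C^o) @ F --> (m : C^o) ->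
  ((fun t => f t - g t) : T -> C^o) @ F --> (l - m : C^o).
Proof. exact: (@cvgB C C^o T F FF f g l m). Qed.

Lemma cvgcZ (c : C) f l : (f : T -> C^o) @ F --> (l : C^o) ->
  ((fun t => c * f t) : T -> C^o) @ F --> (c * l : C^o).
Proof. exact: (@cvgZl_tmp C C^o T F FF c f l). Qed.

End cvg.
End ComplexNorm.

(** * Power series with infinite radius of convergence *)

Section PowerSeries.
Context {R : realType}.
Local Notation C := R[i].
Local Notation nm := Normc.normc.
Implicit Types (a b : nat -> C) (z h : C) (r : R).

Definition psum a (N : nat) z : C := \sum_(0 <= n < N) a n * z ^+ n.

(** Infinite radius of convergence, phrased without a limsup: a bound at radius [2 r] gives a
    geometric tail of ratio 1/2 on the disc of radius [r]. *)
Definition rapid a := forall r, 0 < r -> exists K, forall n, nm (a n) * r ^+ n <= K.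

(** Taking limits of real and imaginary parts makes this a total function of [a]; it is the sum of
    the series under [rapid a]. *)
Definition psv a z : C :=
  limn (fun N => complex.Re (psum a N z)) +i*
  limn (fun N => complex.Im (psum a N z)).

Lemma geometric_half_le (N M : nat) : (N <= M)%N ->
  \sum_(N <= n < M) (2^-1 : R) ^+ n <= 2 * 2^-1 ^+ N.
Proof.
move=> /subnK <-; set k := (M - N)%N.
suff -> : \sum_(N <= n < k + N) (2^-1 : R) ^+ n = 2 * 2^-1 ^+ N - 2 * 2^-1 ^+ (k + N).
  by rewrite lerBlDr lerDl mulr_ge0// exprn_ge0// invr_ge0.
elim: k => [|k IH]; first by rewrite big_geq// subrr.
rewrite addSn big_nat_recr ?leq_addl//= IH exprS.
by field.
Qed.

Lemma geometric_half_cvg0 (B : R) : B * 2^-1 ^+ n @[n --> \oo] --> (0 : R).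
Proof. by apply: cvg_geometric; rewrite ger0_norm ?invr_ge0// invf_lt1// ltr1n. Qed.

Lemma geometric_cauchy_cvg (u : nat -> R) (B : R) :
  (forall N M, (N <= M)%N -> `|u M - u N| <= B * 2^-1 ^+ N) -> cvgn u.
Proof.
move=> uB; apply/cauchy_cvgP/cauchy_exP => e e0.
have /cvgrPdist_lt /(_ _ e0)[N _ HN] := geometric_half_cvg0 B.
exists (u N); exists N => // M /= NM.
rewrite -ball_normE /ball_ /= distrC; apply: le_lt_trans (uB _ _ NM) _.
by apply: le_lt_trans (HN N (leqnn N)); rewrite sub0r normrN ler_norm.
Qed.

Lemma psum_tail_le a r K (N M : nat) z : 0 < r ->
  (forall n, nm (a n) * (2 * r) ^+ n <= K) -> nm z <= r -> (N <= M)%N ->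
  nm (psum a M z - psum a N z) <= 2 * K * 2^-1 ^+ N.
Proof.
move=> r0 HK zr NM.
have K0 : 0 <= K.
  by apply: le_trans (HK 0%N); rewrite expr0 mulr1 normc_ge0.
rewrite /psum (big_cat_nat _ NM)//= addrAC subrr add0r.
rewrite (le_trans (normc_sum _ _ _))//.
apply: (@le_trans _ _ (\sum_(N <= n < M) K * 2^-1 ^+ n)).
  apply: ler_sum => n _; rewrite Normc.normcM normcX.
  rewrite exprVn ler_pdivlMr ?exprn_gt0//; apply: le_trans (HK n).
  rewrite exprMn [2 ^+ n * _]mulrC mulrA ler_wpM2r ?exprn_ge0//.
  by rewrite ler_wpM2l ?normc_ge0// lerXn2r ?nnegrE ?normc_ge0// ltW.
rewrite -mulr_sumr [2 * K]mulrC -mulrA ler_wpM2l//.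
by rewrite geometric_half_le.
Qed.

Lemma cvgc_le (u : nat -> C) (l c : C) (B : R) (N : nat) :
  (u : nat -> C^o) @ \oo --> (l : C^o) ->
  (forall M, (N <= M)%N -> nm (u M - c) <= B) -> nm (l - c) <= B.
Proof.
move=> /cvgc_normP ul uB.
rewrite -[leRHS]add0r.
apply: (ler_cvg_to (cvg_cst (nm (l - c))) (cvgD ul (cvg_cst B))).
near=> M => /=.
have -> : l - c = - (u M - l) + (u M - c) by ring.
rewrite (le_trans (le_normcD _ _))// normcN lerD2l uB//.
by near: M; exists N.
Unshelve. all: by end_near. Qed.

Lemma psum_cvg a z : rapid a ->
  (fun N => psum a N z : C^o) @ \oo --> (psv a z : C^o).
Proof.
move=> ra; set r := nm z + 1.
have r0 : 0 < r by rewrite ltr_wpDl ?normc_ge0.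
have [K HK] := ra _ (mulr_gt0 (ltr0Sn R 1) r0).
have zr : nm z <= r by rewrite lerDl.
apply/cvgc_ReImP; split => /=; apply: (@geometric_cauchy_cvg _ (2 * K)) => N M NM;
  apply: le_trans (psum_tail_le r0 HK zr NM).
- by rewrite -cReN -cReD normc_ge_absRe.
- by rewrite -cImN -cImD normc_ge_absIm.
Qed.

Lemma psv_eq a z l : (fun N => psum a N z : C^o) @ \oo --> (l : C^o) -> psv a z = l.
Proof.
by move=> /cvgc_ReImP[/cvg_lim lRe /cvg_lim lIm]; rewrite /psv lRe// lIm//; case: l {lRe lIm}.
Qed.

Lemma psv_tail a r : rapid a -> 0 < r -> exists2 K, 0 <= K &
  forall z N, nm z <= r -> nm (psv a z - psum a N z) <= K * 2^-1 ^+ N.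
Proof.
move=> ra r0; have [K HK] := ra _ (mulr_gt0 (ltr0Sn R 1) r0).
exists (2 * K).
  by rewrite mulr_ge0//; apply: le_trans (HK 0%N); rewrite expr0 mulr1 normc_ge0.
move=> z N zr; apply: (cvgc_le (N := N) (psum_cvg (z := z) ra)) => M.
exact: (psum_tail_le r0 HK zr).
Qed.

Definition dcoef a (n : nat) : C := n.+1%:R * a n.+1.

Lemma natr_le_exp2 (n : nat) : n%:R <= 2 ^+ n :> R.
Proof. by rewrite -natrX ler_nat ltnW// ltn_expl. Qed.

Lemma normc_nat (n : nat) : nm (n%:R : C) = n%:R :> R.
Proof. by rewrite -(rmorph_nat (real_complex R)) normc_real ger0_norm. Qed.

Lemma rapid_dcoef a : rapid a -> rapid (dcoef a).
Proof.
move=> ra r r0; have r20 : 0 < 2 * r by rewrite mulr_gt0.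
have [K HK] := ra _ r20.
exists (K / r) => n; rewrite ler_pdivlMr// -mulrA -exprSr Normc.normcM normc_nat.
apply: le_trans (HK n.+1); rewrite exprMn -mulrA mulrCA ler_wpM2l ?normc_ge0//.
by rewrite ler_wpM2r ?natr_le_exp2// exprn_ge0// ltW.
Qed.

(** Passing from one exponent to the next multiplies the remainder by [z + h] and adds
    [n.+1%:R * h ^+ 2 * z ^+ n]; the crude factor [n.+1%:R ^+ 2] survives the induction because
    [k^2 + k <= (k + 1)^2]. *)
Lemma exprD_taylor1 z h r (n : nat) : 1 <= r -> nm z <= r -> nm (z + h) <= r ->
  nm ((z + h) ^+ n.+1 - z ^+ n.+1 - n.+1%:R * h * z ^+ n) <=
    nm h ^+ 2 * (n.+1%:R ^+ 2 * r ^+ n.+1).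
Proof.
move=> r1 zr zhr; have r0 : 0 <= r by exact: le_trans r1.
elim: n => [|n IH].
  rewrite !expr1 expr0 mulr1 mul1r [_ - z - h](_ : _ = 0); last by ring.
  by rewrite Normc.normc0; apply: mulr_ge0; [exact: sqr_ge0|apply: mulr_ge0 => //; exact: sqr_ge0].
have -> : (z + h) ^+ n.+2 - z ^+ n.+2 - n.+2%:R * h * z ^+ n.+1 =
   (z + h) * ((z + h) ^+ n.+1 - z ^+ n.+1 - n.+1%:R * h * z ^+ n) +
   n.+1%:R * h ^+ 2 * z ^+ n.
  have -> : n.+2%:R = n.+1%:R + 1 :> C by rewrite -[n.+2]addn1 natrD.
  by rewrite !exprS; ring.
rewrite (le_trans (le_normcD _ _))// !Normc.normcM !normcX normc_nat -[nm h * nm h]/(nm h ^+ 2).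
apply: (@le_trans _ _ (r * (nm h ^+ 2 * (n.+1%:R ^+ 2 * r ^+ n.+1)) +
   n.+1%:R * nm h ^+ 2 * r ^+ n.+2)).
  rewrite lerD// ?ler_pM ?normc_ge0//.
    by rewrite mulr_ge0 ?sqr_ge0.
    by rewrite exprn_ge0 ?normc_ge0.
    by rewrite sqr_ge0.
  apply: (@le_trans _ _ (r ^+ n)); first by rewrite lerXn2r ?nnegrE ?normc_ge0.
  by rewrite ler_weXn2l// ltnW.
have -> : r * (nm h ^+ 2 * (n.+1%:R ^+ 2 * r ^+ n.+1)) + n.+1%:R * nm h ^+ 2 * r ^+ n.+2
  = nm h ^+ 2 * ((n.+1%:R ^+ 2 + n.+1%:R) * r ^+ n.+2).
  by rewrite [r ^+ n.+2]exprS; ring.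
rewrite ler_wpM2l ?sqr_ge0// ler_wpM2r ?exprn_ge0//.
have : 0 <= n%:R :> R by [].
by rewrite -[n.+2]addn1 -[n.+1]addn1 !natrD; nra.
Qed.

Lemma psv_taylor1 a r : rapid a -> 1 <= r -> exists K, forall z h,
  nm z <= r -> nm (z + h) <= r ->
  nm (psv a (z + h) - psv a z - h * psv (dcoef a) z) <= K * nm h ^+ 2.
Proof.
move=> ra r1; have r0 : 0 < r by apply: lt_le_trans r1.
(* Radius [8 r], as [8 = 2 * 2^2]: one factor 2 leaves a geometric series, the other two absorb the
   [n.+1%:R ^+ 2] of [exprD_taylor1]. *)
have [K HK] := ra _ (mulr_gt0 (ltr0Sn R 7) r0).
exists (2 * K) => z h zr zhr.
rewrite -[psv a (z + h) - _ - _]subr0.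
(* Partial sums of [a] up to [N.+1] match those of [dcoef a] up to [N], so the difference can be
   estimated term by term. *)
apply: (cvgc_le (N := 0) (u := fun N => psum a N.+1 (z + h) - psum a N.+1 z - h * psum (dcoef a) N z)).
  have h1 w : (fun N => psum a N.+1 w : C^o) @ \oo --> (psv a w : C^o).
    by rewrite (cvg_shiftS (fun N => psum a N w : C^o)); exact: psum_cvg.
  have h2 := psum_cvg (z := z) (rapid_dcoef ra).
  exact: (cvgcB (cvgcB (h1 _) (h1 _)) (cvgcZ h2)).
move=> N _; rewrite subr0 /psum !big_nat_recl// !expr0 opprD addrACA subrr add0r.
rewrite mulr_sumr -sumrB -sumrB (le_trans (normc_sum _ _ _))//.
apply: (@le_trans _ _ (\sum_(0 <= n < N) nm h ^+ 2 * (K * 2^-1 ^+ n))).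
  apply: ler_sum => n _.
  have -> : a n.+1 * (z + h) ^+ n.+1 - a n.+1 * z ^+ n.+1 - h * (dcoef a n * z ^+ n) =
    a n.+1 * ((z + h) ^+ n.+1 - z ^+ n.+1 - n.+1%:R * h * z ^+ n).
    by rewrite /dcoef; ring.
  rewrite Normc.normcM.
  apply: (le_trans (ler_wpM2l (normc_ge0 _) (exprD_taylor1 _ r1 zr zhr))).
  rewrite mulrCA ler_wpM2l ?sqr_ge0//.
  rewrite exprVn ler_pdivlMr ?exprn_gt0//; apply: le_trans (HK n.+1).
  rewrite -!mulrA ler_wpM2l ?normc_ge0// exprMn [r ^+ _ * _]mulrC !mulrA.
  rewrite ler_wpM2r ?exprn_ge0 ?(ltW r0)// mulrC -expr2.
  have -> : 8 ^+ n.+1 = 2 ^+ n.+1 * (2 ^+ n.+1) ^+ 2 :> R.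
    by rewrite -exprM muln2 -addnn exprD -!exprMn; congr (_ ^+ _); ring.
  apply: ler_pM; rewrite ?exprn_ge0//.
    by rewrite ler_weXn2l ?ler1n.
  by rewrite lerXn2r ?nnegrE// natr_le_exp2.
have := geometric_half_le (leq0n N); rewrite expr0 mulr1 => G.
have -> : 2 * K * nm h ^+ 2 = nm h ^+ 2 * (K * 2) by ring.
rewrite -!mulr_sumr ler_wpM2l ?sqr_ge0// ler_wpM2l//.
by apply: le_trans (HK 0%N); rewrite expr0 mulr1 normc_ge0.
Qed.

Lemma psv_is_derive a z : rapid a ->
  is_derive (z : C^o) 1 (psv a : C^o -> C^o) (psv (dcoef a) z).
Proof.
move=> ra.
have [K HK] := @psv_taylor1 a (nm z + 1) ra (ltac:(by rewrite lerDr normc_ge0)).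
suff H : h^-1 *: ((psv a : C^o -> C^o) (h *: (1 : C^o) + z) - psv a z) @[h --> (0 : C^o)^'] -->
    (psv (dcoef a) z : C^o).
  apply: DeriveDef; first by apply/cvg_ex; eexists; exact: H.
  exact: cvg_lim.
apply/cvgrPdist_lt => e0 /ltc0E[-> e_gt0]; set e := complex.Re e0.
have d0 : 0 < Num.min 1 (e / (`|K| + 1)).
  by rewrite lt_min ltr01 divr_gt0// ltr_pwDr.
near=> h.
have hd : nm h < Num.min 1 (e / (`|K| + 1)).
  rewrite -ltcR -normcE'; near: h; apply: (@dnbhs0_lt C C^o).
  by rewrite ltcR.
have h0 : h != 0 by near: h; exact: (@nbhs_dnbhs_neq C^o).
have nh0 : 0 < nm h.
  by rewrite lt_def normc_ge0 andbT; apply: contra h0 => /eqP/Normc.eq0_normc ->.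
move: hd; rewrite lt_min => /andP[h1 he].
rewrite normcE' ltcR -normcN opprB.
have -> : h^-1 *: ((psv a : C^o -> C^o) (h *: (1 : C^o) + z) - psv a z) - psv (dcoef a) z =
   h^-1 * (psv a (z + h) - psv a z - h * psv (dcoef a) z).
  rewrite [h *: 1]mulr1 [_ *: _]/(_ * _) [h + z]addrC.
  by rewrite [in RHS]mulrBr mulKf.
rewrite Normc.normcM Normc.normcV mulrC ltr_pdivrMr//.
apply: (@le_lt_trans _ _ (`|K| * nm h ^+ 2)).
  apply: le_trans (HK z h _ _) _.
  - by rewrite lerDl.
  - by rewrite (le_trans (le_normcD _ _))// lerD2l ltW.
  - by rewrite ler_wpM2r ?sqr_ge0// ler_norm.
rewrite expr2 mulrA ltr_pM2r//.
apply: le_lt_trans (_ : (`|K| + 1) * nm h < _); first by rewrite ler_wpM2r ?lerDl ?normc_ge0.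
by rewrite mulrC -ltr_pdivlMr// ltr_pwDr.
Unshelve. all: by end_near. Qed.

Lemma psv_entire a : rapid a -> entire (psv a).
Proof. by move=> ra z; have [] := psv_is_derive z ra. Qed.

Lemma opA_psv a : rapid a -> opA (psv a) = psv (dcoef a).
Proof.
by move=> ra; apply/funext => z; rewrite /opA derive1E; have [_] := psv_is_derive z ra.
Qed.

Definition mulz a (n : nat) : C := if n is m.+1 then a m else 0.

Lemma rapid_mulz a : rapid a -> rapid (mulz a).
Proof.
move=> ra r r0; have [K HK] := ra _ r0.
have K0 : 0 <= K by apply: le_trans (HK 0%N); rewrite expr0 mulr1 normc_ge0.
exists (K * r) => -[|n]; first by rewrite Normc.normc0 mul0r mulr_ge0// ltW.
by rewrite exprSr mulrA ler_wpM2r ?HK// ltW.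
Qed.

Lemma opAstar_psv a : rapid a -> opAstar (psv a) = psv (mulz a).
Proof.
move=> ra; apply/funext => z; rewrite /opAstar; apply/esym/psv_eq.
rewrite -(cvg_shiftS (fun N => psum (mulz a) N z : C^o)).
under eq_fun do rewrite /psum big_nat_recl// mul0r add0r.
have -> : (fun N => \sum_(0 <= i < N) mulz a i.+1 * z ^+ i.+1) = (fun N => z * psum a N z).
  apply/funext => N; rewrite /psum mulr_sumr; apply: eq_bigr => i _.
  by rewrite /= exprS mulrCA.
exact: cvgcZ (psum_cvg (z := z) ra).
Qed.

Lemma rapidD a b : rapid a -> rapid b -> rapid (fun n => a n + b n).
Proof.
move=> ra rb r r0; have [K HK] := ra _ r0; have [L HL] := rb _ r0.
exists (K + L) => n; rewrite (le_trans _ (lerD (HK n) (HL n)))//.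
by rewrite -mulrDl ler_wpM2r ?le_normcD// exprn_ge0// ltW.
Qed.

Lemma rapidZ a (c : C) : rapid a -> rapid (fun n => c * a n).
Proof.
move=> ra r r0; have [K HK] := ra _ r0; exists (nm c * K) => n.
by rewrite Normc.normcM -mulrA ler_wpM2l ?normc_ge0.
Qed.

Lemma psvD a b z : rapid a -> rapid b -> psv (fun n => a n + b n) z = psv a z + psv b z.
Proof.
move=> ra rb; apply: psv_eq.
have -> : (fun N => psum (fun n => a n + b n) N z) = (fun N => psum a N z + psum b N z).
  by apply/funext => N; rewrite /psum -big_split/=; apply: eq_bigr => i _; rewrite mulrDl.
exact: (cvgcD (psum_cvg (z := z) ra) (psum_cvg (z := z) rb)).
Qed.

Lemma psvZ a (c : C) z : rapid a -> psv (fun n => c * a n) z = c * psv a z.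
Proof.
move=> ra; apply: psv_eq.
have -> : (fun N => psum (fun n => c * a n) N z) = (fun N => c * psum a N z).
  by apply/funext => N; rewrite /psum mulr_sumr; apply: eq_bigr => i _; rewrite mulrA.
exact: (cvgcZ (psum_cvg (z := z) ra)).
Qed.

Lemma psv_poly (p : {poly C}) z : psv (fun n => p`_n) z = p.[z].
Proof.
apply: psv_eq; rewrite -(cvg_shiftn (size p)).
under eq_fun => N.
  rewrite /psum (big_cat_nat (leq0n (size p)))//= ?leq_addl//.
  rewrite [X in _ + X]big1_seq ?addr0; last first.
    by move=> i; rewrite mem_index_iota => /andP[_ /andP[pi _]]; rewrite nth_default// mul0r.
  rewrite big_mkord -horner_coef.
  over.
exact: cvg_cst.
Qed.

(** The value at 0 is the constant coefficient, and differentiation moves the next coefficient into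
    its place; the induction therefore ranges over all pairs of sequences. *)
Lemma psv_inj a b : rapid a -> rapid b -> psv a =1 psv b -> a = b.
Proof.
move=> ra rb ab.
have D0 c : rapid c -> psv c 0 = c 0%N.
  move=> rc; apply: psv_eq; rewrite -cvg_shiftS.
  under eq_fun => N.
    rewrite /psum big_nat_recl// expr0 mulr1 big1 ?addr0; last first.
      by move=> i _; rewrite exprS mul0r mulr0.
    over.
  exact: cvg_cst.
apply/funext => n.
suff H : forall m c d, rapid c -> rapid d -> psv c =1 psv d -> c m = d m by exact: H.
elim=> [c d rc rd /(_ 0)|m IH c d rc rd /funext cd]; first by rewrite !D0.
have := IH (dcoef c) (dcoef d) (rapid_dcoef rc) (rapid_dcoef rd).
rewrite -!opA_psv// cd => /(_ (fun=> erefl)) /mulfI; apply.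
by rewrite pnatr_eq0.
Qed.

End PowerSeries.

(** * The Bargmann norm of a power series *)

Section PlaneRotation.
Context {R : realType}.
Local Open Scope ereal_scope.
Local Notation mu := (@lebesgue_measure R).
Local Notation mu2 := (@plane_measure R).

(** The image measure gives each half-open interval its length, which characterises Lebesgue
    measure. *)
Lemma lebesgue_measure_translation (a : R) (A : set (measurableTypeR R)) :
  measurable A ->
  pushforward mu ((fun x => x + a)%R : measurableTypeR R -> measurableTypeR R) A = mu A.
Proof.
move=> mA.
have mt : measurable_fun setT ((fun x => x + a)%R : measurableTypeR R -> measurableTypeR R).
  exact: measurable_funD.
apply/esym/lebesgue_measure_unique => //= _ [[u v]] _ <-.
rewrite /pushforward/= (_ : _ @^-1` _ = `](u - a)%R, (v - a)%R]%classic); last first.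
  by apply/seteqP; split => x /=; rewrite !in_itv/= ltrBlDr lerBrDr.
rewrite !lebesgue_measure_itv/= !lte_fin ltrD2r.
by case: ifPn => // _; rewrite -!EFinB; congr EFin; ring.
Qed.

Lemma ge0_integral_translation (f : measurableTypeR R -> \bar R) (a : R) :
  measurable_fun setT f -> (forall x, 0 <= f x) ->
  \int[mu]_x f (x + a)%R = \int[mu]_x f x.
Proof.
move=> mf f0.
have mt : measurable_fun setT ((fun x => x + a)%R : measurableTypeR R -> measurableTypeR R).
  exact: measurable_funD.
have := @ge0_integral_pushforward _ _ _ _ R _ mt mu setT f measurableT mf (fun x _ => f0 x).
rewrite preimage_setT => <-.
by apply: eq_measure_integral => //= A mA _; exact: lebesgue_measure_translation.
Qed.

Lemma plane_tonelli1 (f : R * R -> \bar R) :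
  measurable_fun setT f -> (forall w, 0 <= f w) ->
  \int[mu2]_w f w = \int[mu]_x \int[mu]_y f (x, y).
Proof. by move=> mf f0; rewrite fubini_tonelli1. Qed.

Lemma plane_tonelli2 (f : R * R -> \bar R) :
  measurable_fun setT f -> (forall w, 0 <= f w) ->
  \int[mu2]_w f w = \int[mu]_y \int[mu]_x f (x, y).
Proof. by move=> mf f0; rewrite fubini_tonelli1// fubini_tonelli. Qed.

Lemma measurable_plane_linear (a b c d : R) :
  measurable_fun setT
    ((fun w => (a * w.1 + b * w.2, c * w.1 + d * w.2))%R : R * R -> R * R).
Proof.
apply/measurable_fun_pair => /=.
- by apply: measurable_funD; apply: measurable_funM => //.
- by apply: measurable_funD; apply: measurable_funM => //.
Qed.

(** For fixed [y] the shear is a translation in [x], so it is enough to integrate in [x] first. *)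
Lemma ge0_integral_shear1 (f : R * R -> \bar R) (t : R) :
  measurable_fun setT f -> (forall w, 0 <= f w) ->
  \int[mu2]_w f (w.1 + t * w.2, w.2)%R = \int[mu2]_w f w.
Proof.
move=> mf f0.
have ms : measurable_fun setT ((fun w => (w.1 + t * w.2, w.2))%R : R * R -> R * R).
  apply: (eq_measurable_fun _ _ (measurable_plane_linear 1 t 0 1)) => w _ /=.
  by rewrite !mul1r mul0r add0r.
rewrite plane_tonelli2//; last exact: (measurableT_comp mf ms).
rewrite plane_tonelli2//; apply: eq_integral => y _ /=.
rewrite (@ge0_integral_translation (fun x => f (x, y)) (t * y)%R)//.
exact: measurable_fun_pair1.
Qed.

Lemma ge0_integral_shear2 (f : R * R -> \bar R) (t : R) :
  measurable_fun setT f -> (forall w, 0 <= f w) ->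
  \int[mu2]_w f (w.1, w.2 + t * w.1)%R = \int[mu2]_w f w.
Proof.
move=> mf f0.
have ms : measurable_fun setT ((fun w => (w.1, w.2 + t * w.1))%R : R * R -> R * R).
  apply: (eq_measurable_fun _ _ (measurable_plane_linear 1 0 t 1)) => w _ /=.
  by rewrite !mul1r mul0r addr0 addrC.
rewrite plane_tonelli1//; last exact: (measurableT_comp mf ms).
rewrite plane_tonelli1//; apply: eq_integral => x _ /=.
rewrite (@ge0_integral_translation (fun y => f (x, y)) (t * x)%R)//.
exact: measurable_fun_pair2.
Qed.

(* A rotation is a product of three shears. *)
Lemma ge0_integral_rotation (f : R * R -> \bar R) (c s : R) :
  (c ^+ 2 + s ^+ 2 = 1)%R -> c != (-1)%R ->
  measurable_fun setT f -> (forall w, 0 <= f w) ->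
  \int[mu2]_w f (c * w.1 - s * w.2, s * w.1 + c * w.2)%R = \int[mu2]_w f w.
Proof.
move=> cs c1 mf f0.
have c10 : (1 + c)%R != 0%R by rewrite addrC -subr_eq0 opprK in c1 *.
(* With [c = cos theta] and [s = sin theta] this is [- tan (theta / 2)], defined away from the half
   turn. *)
pose t := (- s / (1 + c))%R.
rewrite -(ge0_integral_shear1 t mf f0).
pose f1 := fun w : R * R => f (w.1 + t * w.2, w.2)%R.
have mf1 : measurable_fun setT f1.
  apply: (measurableT_comp mf).
  apply: (eq_measurable_fun _ _ (measurable_plane_linear 1 t 0 1)) => w _ /=.
  by rewrite !mul1r mul0r add0r.
rewrite -[RHS](@ge0_integral_shear2 f1 s mf1); last by move=> w; exact: f0.
pose f2 := fun w : R * R => f1 (w.1, w.2 + s * w.1)%R.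
have mf2 : measurable_fun setT f2.
  apply: (measurableT_comp mf1).
  apply: (eq_measurable_fun _ _ (measurable_plane_linear 1 0 s 1)) => w _ /=.
  by rewrite !mul1r mul0r addr0 addrC.
rewrite -[RHS](@ge0_integral_shear1 f2 t mf2); last by move=> w; exact: f0.
have ss : (s * s = (1 - c) * (1 + c))%R.
  rewrite -[LHS]/(s ^+ 2)%R; move: cs => /eqP.
  by rewrite addrC eq_sym -subr_eq => /eqP <-; ring.
have ts : (t * s = c - 1)%R.
  rewrite /t -mulrA mulrC -mulrA mulrC [RHS](_ : _ = - (1 - c))%R; last by ring.
  by rewrite -(mulfK c10 (1 - c)%R) -ss; ring.
apply: eq_integral => -[x y] _; rewrite /f2 /f1 /=; congr (f (_, _)).
- have -> : (c * x - s * y = x * (1 + t * s) + y * (t + t + t * s * t))%R; last by ring.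
  rewrite ts; congr (_ + _)%R; first by ring.
  by rewrite /t; field.
- by rewrite [RHS](_ : _ = s * x + (1 + t * s) * y)%R; [rewrite ts; ring|ring].
Qed.

End PlaneRotation.

(** * Roots of unity and a discrete Parseval identity *)

Section RootsOfUnity.
Context {R : realType}.
Local Notation C := R[i].
Local Notation nm := Normc.normc.

(** ['X^n - 1] splits over [R[i]] and is separable in characteristic 0, so it has [n] distinct
    roots, which forces a primitive one. *)
Lemma prim_root_complex (n : nat) : (0 < n)%N -> exists w : C, n.-primitive_root w.
Proof.
move=> n0; pose p : {poly C} := 'X^n - 1.
have [r Dp] := closed_field_poly_normal p.
rewrite (monicP _) ?monicXnsubC// scale1r in Dp.
have rn1 : all n.-unity_root r by apply/allP => z; rewrite -root_prod_XsubC -Dp.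
have sz : (n < (size r).+1)%N by rewrite -(size_prod_XsubC r id) -Dp size_XnsubC.
have [|z] := hasP (has_prim_root n0 rn1 _ sz); last by exists z.
by rewrite -separable_prod_XsubC -Dp separable_Xn_sub_1// pnatr_eq0 -lt0n.
Qed.

Lemma normc_unity_root (n : nat) (w : C) : (0 < n)%N -> w ^+ n = 1 -> nm w = 1.
Proof.
move=> n0 w1; apply/eqP; rewrite -(@pexpr_eq1 _ _ n) ?normc_ge0//.
by rewrite -normcX w1 /= expr0n expr1n addr0 sqrtr1.
Qed.

Lemma sum_unity_root (n : nat) (x : C) : x ^+ n = 1 -> x != 1 -> \sum_(k < n) x ^+ k = 0.
Proof.
move=> xn x1; have x10 : x - 1 != 0 by rewrite subr_eq0.
by apply: (mulfI x10); rewrite mulr0 -subrX1 xn subrr.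
Qed.

Lemma normc_sqrE (z : C) : (nm z ^+ 2)%:C = z * conjc z.
Proof.
by apply: complex_eq; rewrite ReImE normc_sqr ?ReImE /=; ring.
Qed.

(** The cross term of [m] and [n] contains the sum over [k] of the powers of
    [w ^+ m * conjc w ^+ n]. Both indices are below the order [N], so this number differs from 1
    when [m] and [n] differ, and the sum vanishes. *)
Lemma parseval_roots (a : nat -> C) (N : nat) (w z : C) : N.-primitive_root w ->
  \sum_(k < N) nm (psum a N (w ^+ k * z)) ^+ 2 =
  N%:R * \sum_(n < N) nm (a n) ^+ 2 * nm z ^+ (2 * n).
Proof.
move=> pw; have N0 := prim_order_gt0 pw.
have w1 := prim_expr_order pw.
have nw : w * conjc w = 1 by rewrite -normc_sqrE (normc_unity_root N0 w1) expr1n.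
apply: (@complexI R).
rewrite rmorphM rmorph_sum rmorph_sum/= rmorph_nat.
under eq_bigr => k _.
  rewrite normc_sqrE /psum big_mkord rmorph_sum mulr_suml.
  under eq_bigr => m _ do rewrite mulr_sumr.
  over.
rewrite exchange_big/= mulr_sumr; apply: eq_bigr => m _.
rewrite exchange_big/=.
rewrite (bigD1 m)//= [X in _ + X]big1 ?addr0; last first.
  move=> n nm'.
  pose x := w ^+ m * conjc w ^+ n.
  under eq_bigr => k _.
    have -> : a m * (w ^+ k * z) ^+ m * conjc (a n * (w ^+ k * z) ^+ n) =
      a m * z ^+ m * conjc (a n * z ^+ n) * x ^+ k.
      rewrite /x !rmorphM !rmorphXn/= !rmorphM rmorphXn/= !exprMn -!exprM.
      by rewrite [(k * m)%N]mulnC [(k * n)%N]mulnC; ring.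
    over.
  rewrite -mulr_sumr sum_unity_root ?mulr0//.
    rewrite /x exprMn -!exprM [(m * N)%N]mulnC [(n * N)%N]mulnC exprM w1 expr1n mul1r.
    by rewrite exprM -rmorphXn w1 rmorph1 expr1n.
  apply: contra nm' => /eqP x1.
  have : w ^+ m == w ^+ n.
    rewrite -[w ^+ n]mul1r -x1 /x -mulrA -exprMn [conjc w * w]mulrC nw expr1n.
    by rewrite mulr1.
  by rewrite (eq_prim_root_expr pw) !modn_small// eq_sym.
rewrite (eq_bigr (fun=> (nm (a m) ^+ 2 * nm z ^+ (2 * m))%:C)).
  by rewrite sumr_const card_ord mulr_natl.
move=> k _.
rewrite -normc_sqrE; congr (_%:C); rewrite Normc.normcM normcX Normc.normcM normcX.
rewrite (normc_unity_root N0 w1) expr1n mul1r.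
by rewrite exprMn -exprM mulnC.
Qed.

Lemma mul_point (w : C) (u : R * R) :
  w * Defs.point u = Defs.point (complex.Re w * u.1 - complex.Im w * u.2,
                       complex.Im w * u.1 + complex.Re w * u.2).
Proof. by apply: complex_eq; rewrite ReImE /=; ring. Qed.

End RootsOfUnity.

(** * Parseval's identity for the Gaussian measure *)

Section NormOfPowerSeries.
Context {R : realType}.
Local Notation C := R[i].
Local Notation nm := Normc.normc.
Local Notation mu2 := (@plane_measure R).
Implicit Types (phi : C -> C) (a : nat -> C).

Definition dens phi (w : R * R) : R := nm (phi (Defs.point w)) ^+ 2 * gauss_weight w.

Lemma dens_ge0 phi w : 0 <= dens phi w.
Proof. by rewrite mulr_ge0 ?sqr_ge0 ?expR_ge0. Qed.

Lemma measurable_gauss_weight : measurable_fun setT (@gauss_weight R).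
Proof.
apply: measurableT_comp => //; apply: measurable_funN.
by apply: measurable_funD; apply: measurable_funX.
Qed.

Definition cmeas (g : R * R -> C) :=
  measurable_fun setT (fun w => complex.Re (g w)) /\
  measurable_fun setT (fun w => complex.Im (g w)).

Lemma cmeasM f g : cmeas f -> cmeas g -> cmeas (fun w => f w * g w).
Proof.
move=> [f1 f2] [g1 g2]; split.
- under eq_fun do rewrite cReM; apply: measurable_funB; exact: measurable_funM.
- under eq_fun do rewrite cImM; apply: measurable_funD; exact: measurable_funM.
Qed.

Lemma cmeasD f g : cmeas f -> cmeas g -> cmeas (fun w => f w + g w).
Proof.
move=> [f1 f2] [g1 g2]; split.
- under eq_fun do rewrite cReD; exact: measurable_funD.
- under eq_fun do rewrite cImD; exact: measurable_funD.
Qed.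

Lemma cmeas_cst c : cmeas (fun=> c).
Proof. by split. Qed.

Lemma cmeas_point : cmeas (@Defs.point R).
Proof. by split; [exact: measurable_fst|exact: measurable_snd]. Qed.

Lemma cmeasX f n : cmeas f -> cmeas (fun w => f w ^+ n).
Proof.
move=> mf; elim: n => [|n IH]; first exact: cmeas_cst.
by under [X in cmeas X]eq_fun do rewrite exprS; exact: cmeasM.
Qed.

Lemma cmeas_psum a N : cmeas (fun w => psum a N (Defs.point w)).
Proof.
elim: N => [|N IH].
  by under [X in cmeas X]eq_fun do rewrite /psum big_geq//; exact: cmeas_cst.
under [X in cmeas X]eq_fun do rewrite /psum big_nat_recr//=.
apply: cmeasD => //; apply: cmeasM; first exact: cmeas_cst.
exact/cmeasX/cmeas_point.
Qed.

Lemma cmeas_psv a : rapid a -> cmeas (fun w => psv a (Defs.point w)).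
Proof.
move=> ra; split.
- apply: (@measurable_fun_cvg _ _ _ _ (fun N w => complex.Re (psum a N (Defs.point w)))) => //.
  + by move=> N; have [] := cmeas_psum a N.
  + by move=> w _; have /cvgc_ReImP[] := psum_cvg (z := Defs.point w) ra.
- apply: (@measurable_fun_cvg _ _ _ _ (fun N w => complex.Im (psum a N (Defs.point w)))) => //.
  + by move=> N; have [] := cmeas_psum a N.
  + by move=> w _; have /cvgc_ReImP[] := psum_cvg (z := Defs.point w) ra.
Qed.

Lemma measurable_dens phi : cmeas (phi \o @Defs.point R) -> measurable_fun setT (dens phi).
Proof.
move=> [m1 m2]; apply: measurable_funM; last exact: measurable_gauss_weight.
under eq_fun do rewrite normc_sqr.
by apply: measurable_funD; exact: measurable_funX.
Qed.

Lemma measurable_Edens phi : cmeas (phi \o @Defs.point R) ->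
  measurable_fun setT (fun w => (dens phi w)%:E).
Proof. by move=> m; apply/measurable_EFinP; exact: measurable_dens. Qed.

Lemma bargmann_norm2E phi :
  bargmann_norm2 phi = ((pi^-1)%:E * \int[mu2]_w (dens phi w)%:E)%E.
Proof. by []. Qed.

Lemma gauss_weight_rot (c s : R) (u : R * R) : c ^+ 2 + s ^+ 2 = 1 ->
  gauss_weight (c * u.1 - s * u.2, s * u.1 + c * u.2) = gauss_weight u.
Proof.
move=> cs; rewrite /gauss_weight/=; congr (expR (- _)).
by rewrite -[RHS]mul1r -cs; ring.
Qed.

Lemma integral_dens_rot phi (w : C) : nm w = 1 -> w != -1 ->
  cmeas (phi \o @Defs.point R) ->
  (\int[mu2]_u (dens (fun z => phi (w * z)) u)%:E = \int[mu2]_u (dens phi u)%:E)%E.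
Proof.
move=> w1 wN1 mphi.
have cs : complex.Re w ^+ 2 + complex.Im w ^+ 2 = 1 by rewrite -normc_sqr w1 expr1n.
have c1 : complex.Re w != -1.
  apply: contra wN1 => /eqP c1.
  move: cs; rewrite c1 sqrrN expr1n => /eqP; rewrite addrC -subr_eq0 addrK sqrf_eq0 => /eqP s0.
  by apply/eqP/complex_eq; rewrite ?c1 ?s0//= oppr0.
rewrite -[RHS](ge0_integral_rotation cs c1).
- apply: eq_integral => u _; congr EFin.
  by rewrite /dens mul_point gauss_weight_rot.
- exact: measurable_Edens.
- by move=> u; rewrite lee_fin dens_ge0.
Qed.

Lemma cmeas_rot phi (w : C) : cmeas (phi \o @Defs.point R) ->
  cmeas ((fun z => phi (w * z)) \o @Defs.point R).
Proof.
move=> [m1 m2].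
have mr := measurable_plane_linear (complex.Re w) (- complex.Im w) (complex.Im w) (complex.Re w).
split; [have := measurableT_comp m1 mr|have := measurableT_comp m2 mr];
 apply: eq_measurable_fun => u _ /=; by rewrite mul_point mulNr.
Qed.

(** One rotation by [w] at a time, because a power [w ^+ k] may be the half turn that
    [integral_dens_rot] excludes. *)
Lemma integral_dens_rotX phi (w : C) k : nm w = 1 -> w != -1 ->
  cmeas (phi \o @Defs.point R) ->
  (\int[mu2]_u (dens (fun z => phi (w ^+ k * z)) u)%:E = \int[mu2]_u (dens phi u)%:E)%E.
Proof.
move=> w1 wN1; elim: k phi => [|k IH] phi mphi.
  by apply: eq_integral => u _; rewrite /dens expr0 mul1r.
rewrite -(integral_dens_rot w1 wN1 mphi).
rewrite -(IH (fun z => phi (w * z)) (cmeas_rot w mphi)).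
apply: eq_integral => u _; rewrite /dens.
by rewrite (_ : w ^+ k.+1 * Defs.point u = w * (w ^+ k * Defs.point u))// exprS mulrA.
Qed.

(** Finite counterpart of the mean over the angle: its integral is that of [dens phi], and on
    polynomials of degree below [N] it has no cross terms. *)
Definition avg phi (w : C) N (u : R * R) : R :=
  (N%:R)^-1 * \sum_(k < N) dens (fun z => phi (w ^+ k * z)) u.

Lemma integral_avg phi (w : C) N : (2 < N)%N -> N.-primitive_root w ->
  cmeas (phi \o @Defs.point R) ->
  (\int[mu2]_u (avg phi w N u)%:E = \int[mu2]_u (dens phi u)%:E)%E.
Proof.
move=> N2 pw mphi; have N0 : (0 < N)%N by exact: leq_trans N2.
have w1 : nm w = 1 by exact: normc_unity_root (prim_expr_order pw).
(* The order of -1 divides 2, and [N] exceeds 2. *)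
have wN1 : w != -1.
  apply/eqP => wE; have := prim_order_dvd pw 2; rewrite wE sqrrN expr1n eqxx.
  by move=> /dvdn_leq => /(_ isT); rewrite leqNgt N2.
have mk k := measurable_Edens (cmeas_rot (w ^+ k) mphi).
have msum : measurable_fun setT (fun u => (\sum_(k < N) dens (fun z => phi (w ^+ k * z)) u)%:E).
  by apply/measurable_EFinP; apply: measurable_sum => k; exact: measurable_dens (cmeas_rot (w ^+ k) mphi).
under eq_integral do rewrite /avg EFinM.
rewrite ge0_integralZl_EFin ?invr_ge0//; last first.
  by move=> u _; rewrite lee_fin sumr_ge0// => k _; rewrite dens_ge0.
under eq_integral do rewrite -sumEFin.
rewrite ge0_integral_sum//; last 2 first.
- by move=> k; exact: mk.
- by move=> k u _; rewrite lee_fin dens_ge0.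
under eq_bigr do rewrite integral_dens_rotX//.
rewrite sumr_const card_ord -[X in (_ * X)%E]/((\int[mu2]_u (dens phi u)%:E) *+ N)%E -mule_natl muleA -EFinM mulVf ?mul1e//.
by rewrite pnatr_eq0 -lt0n.
Qed.

Lemma measurable_avg phi (w : C) N : cmeas (phi \o @Defs.point R) ->
  measurable_fun setT (fun u => (avg phi w N u)%:E).
Proof.
move=> mphi; apply/measurable_EFinP; apply: measurable_funM => //.
by apply: measurable_sum => k; exact: measurable_dens (cmeas_rot (w ^+ k) mphi).
Qed.

Lemma avg_ge0 phi (w : C) N u : 0 <= avg phi w N u.
Proof. by rewrite mulr_ge0 ?invr_ge0// sumr_ge0// => k _; exact: dens_ge0. Qed.

Definition mom n (u : R * R) : R := (u.1 ^+ 2 + u.2 ^+ 2) ^+ n * gauss_weight u.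

Lemma mom_ge0 n u : 0 <= mom n u.
Proof. by rewrite mulr_ge0 ?expR_ge0// exprn_ge0// addr_ge0 ?sqr_ge0. Qed.

Lemma measurable_mom n : measurable_fun setT (fun u => (mom n u)%:E).
Proof.
apply/measurable_EFinP; apply: measurable_funM; last exact: measurable_gauss_weight.
by apply: measurable_funX; apply: measurable_funD; apply: measurable_funX.
Qed.

Lemma avg_psum a (w : C) N u : N.-primitive_root w ->
  avg (psum a N) w N u = \sum_(n < N) nm (a n) ^+ 2 * mom n u.
Proof.
move=> pw; have N0 := prim_order_gt0 pw.
rewrite /avg /dens -mulr_suml parseval_roots// !mulrA mulVf ?pnatr_eq0 -?lt0n//.
rewrite mul1r mulr_suml; apply: eq_bigr => n _.
by rewrite -mulrA /mom (exprM (nm (Defs.point u))) (normc_sqr (Defs.point u)).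
Qed.

(** [M] stands for the Gaussian moments, whose values are only supplied in [integral_mom]. *)
Lemma integral_psum (M : nat -> \bar R) a N :
  (forall n, \int[mu2]_u (mom n u)%:E = M n)%E ->
  (\int[mu2]_u (dens (psum a N) u)%:E = \sum_(0 <= n < N) (nm (a n) ^+ 2)%:E * M n)%E.
Proof.
move=> HM.
(* Padding with zeros allows roots of unity of order [N.+3], above the 2 required by
   [integral_avg]. *)
pose b n : C := if (n < N)%N then a n else 0.
have pb K z : (N <= K)%N -> psum b K z = psum a N z.
  move=> NK; rewrite /psum (big_cat_nat (leq0n N) NK)//= [X in _ + X]big1_seq ?addr0.
    by apply: eq_big_nat => n /andP[_ nN]; rewrite /b nN.
  move=> n; rewrite mem_index_iota => /andP[_ /andP[Nn _]].
  by rewrite /b ltnNge Nn/= mul0r.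
have [w pw] := @prim_root_complex R N.+3 isT.
have -> : psum a N = psum b N.+3 by apply/funext => z; rewrite pb// !leqW.
rewrite -(@integral_avg _ w N.+3)//; last exact: cmeas_psum.
under eq_integral do rewrite avg_psum// -sumEFin.
rewrite ge0_integral_sum//; last 2 first.
- move=> n; under eq_fun do rewrite EFinM.
  by apply: measurable_funeM; exact: measurable_mom.
- by move=> n u _; rewrite lee_fin mulr_ge0 ?sqr_ge0 ?mom_ge0.
rewrite -(big_mkord xpredT (fun n => \int[mu2]_u (nm (b n) ^+ 2 * mom n u)%:E)%E).
rewrite (big_cat_nat (leq0n N) (_ : N <= N.+3)%N) ?leqW//=.
rewrite [X in (_ + X)%E]big1_seq ?adde0; last first.
  move=> n; rewrite mem_index_iota => /andP[_ /andP[Nn _]].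
  have -> : b n = 0 by rewrite /b ltnNge Nn.
  rewrite Normc.normc0 expr0n/=.
  by under eq_integral do rewrite mul0r; rewrite integral0.
apply: eq_big_nat => n /andP[_ nN]; rewrite /b nN.
under eq_integral do rewrite EFinM.
rewrite ge0_integralZl_EFin ?sqr_ge0 ?HM//.
- by move=> u _; rewrite lee_fin mom_ge0.
- exact: measurable_mom.
Qed.

Lemma limn_einf_ge (v : nat -> \bar R) c N :
  (forall k, (N <= k)%N -> (c <= v k)%E) -> (c <= limn_einf v)%E.
Proof.
move=> cv; rewrite limn_einf_lim; apply: lime_ge; first exact: is_cvg_einfs.
exists N => // n /= Nn; apply: le_ereal_inf_tmp => _ [k /= nk <-].
by apply: cv; exact: leq_trans nk.
Qed.

Lemma measurable_limn_einf d (T : measurableType d) (f : (T -> \bar R)^nat) :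
  (forall k, measurable_fun setT (f k)) ->
  measurable_fun setT (fun x => limn_einf (f ^~ x)).
Proof.
move=> mf; apply: (@emeasurable_fun_cvg _ _ _ _ (fun n x => einfs (f ^~ x) n)) => //.
  by move=> n; apply: measurable_fun_einfs.
by move=> x _; rewrite limn_einf_lim; exact: is_cvg_einfs.
Qed.

Lemma limn_einf_cst (c : \bar R) : limn_einf (fun=> c) = c.
Proof. by have [] := @cvg_limn_einf_sup _ (fun=> c) c (@cvg_cst _ c _ _ _). Qed.

(** Multiplication by a root of unity preserves the modulus, so one tail bound on a disc around 0
    serves all the rotated points; hence [K] depends neither on [N] nor on [w]. *)
Lemma avg_near a (u : R * R) : rapid a -> exists K, forall N (w : C), N.-primitive_root w ->
  `|avg (psv a) w N u - avg (psum a N) w N u| <= K * 2^-1 ^+ N.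
Proof.
move=> ra; set z := Defs.point u.
have r0 : 0 < nm z + 1 by rewrite ltr_wpDl ?normc_ge0.
have [K K0 HK] := psv_tail ra r0.
exists (K * (K + 2 * K) * gauss_weight u) => N w pw; have N0 := prim_order_gt0 pw.
rewrite /avg -mulrBr -sumrB normrM ger0_norm ?invr_ge0// ler_pdivrMl ?ltr0n//.
rewrite (le_trans (ler_norm_sum _ _ _))//.
set B := K * _ * _ * _; apply: (@le_trans _ _ (\sum_(k < N) B)); last first.
  by rewrite sumr_const card_ord mulr_natl.
apply: ler_sum => k _; rewrite /B {B}.
rewrite /dens -mulrBl normrM [`|gauss_weight u|]ger0_norm ?expR_ge0//.
rewrite mulrAC ler_wpM2r ?expR_ge0// -/z.
set x := psv a _; set y := psum a N _.
have wz : nm (w ^+ k * z) <= nm z + 1.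
  rewrite Normc.normcM normcX (normc_unity_root N0 (prim_expr_order pw)) expr1n mul1r.
  by rewrite lerDl.
have xy : nm (x - y) <= K * 2^-1 ^+ N by exact: HK.
have h1 : (2^-1 : R) ^+ N <= 1 by rewrite exprn_ile1// ?invr_ge0// invf_le1// ler1n.
(* The tail bound at an empty partial sum bounds the function itself. *)
have xK : nm x <= K.
  by have := HK _ 0%N wz; rewrite /psum big_geq// subr0 expr0 mulr1.
have yK : nm y <= 2 * K.
  have -> : y = x - (x - y) by rewrite opprB addrC subrK.
  rewrite (le_trans (le_normcD _ _))// normcN mulr_natl mulr2n lerD//.
  by rewrite (le_trans xy)// ler_piMr.
rewrite subr_sqr normrM mulrAC; apply: ler_pM => //.
  apply: le_trans xy; rewrite ler_norml; apply/andP; split.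
    rewrite lerNl opprB lerBlDr; have := le_normcD (y - x) x.
    by rewrite subrK => /le_trans; apply; rewrite -normcN opprB.
  by rewrite lerBlDr; have := le_normcD (x - y) y; rewrite subrK.
by rewrite ger0_norm ?addr_ge0 ?normc_ge0// lerD.
Qed.

(** Fatou's lemma on the averages over roots of unity: their integrals are all equal to the
    right-hand side, while pointwise their lower limit is at least any partial sum of the
    [nm (a n) ^+ 2 * mom n u]. *)
Lemma integral_psv_ge (M : nat -> \bar R) a N : rapid a ->
  (forall n, \int[mu2]_u (mom n u)%:E = M n)%E ->
  (\sum_(0 <= n < N) (nm (a n) ^+ 2)%:E * M n <= \int[mu2]_u (dens (psv a) u)%:E)%E.
Proof.
move=> ra HM.
have M0 n : (0 <= M n)%E by rewrite -HM integral_ge0// => u _; rewrite lee_fin mom_ge0.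
have /choice[W pw] : forall k, exists w : C, k.+3.-primitive_root w.
  by move=> k; exact: prim_root_complex.
pose f k u := (avg (psv a) (W k) k.+3 u)%:E.
have intf k : (\int[mu2]_u f k u = \int[mu2]_u (dens (psv a) u)%:E)%E.
  by rewrite /f integral_avg//; exact: cmeas_psv.
have -> : (\int[mu2]_u (dens (psv a) u)%:E = limn_einf (fun k => \int[mu2]_u f k u))%E.
  rewrite -[LHS]limn_einf_cst; congr limn_einf; apply/funext => k; exact/esym/intf.
apply: (@le_trans _ _ (\int[mu2]_u limn_einf (f ^~ u))%E); last first.
  apply: fatou => //.
  - by move=> k; exact: measurable_avg (cmeas_psv ra).
  - by move=> k u _; rewrite lee_fin avg_ge0.
rewrite (_ : (\sum_(0 <= n < N) _)%E = \int[mu2]_u (\sum_(n < N) nm (a n) ^+ 2 * mom n u)%:E)%E; last first.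
  under eq_integral do rewrite -sumEFin.
  rewrite ge0_integral_sum//; last 2 first.
  - move=> n; under eq_fun do rewrite EFinM.
    by apply: measurable_funeM; exact: measurable_mom.
  - by move=> n u _; rewrite lee_fin mulr_ge0 ?sqr_ge0 ?mom_ge0.
  rewrite big_mkord; apply: eq_bigr => n _.
  under eq_integral do rewrite EFinM.
  rewrite ge0_integralZl_EFin ?sqr_ge0 ?HM//.
  - by move=> u _; rewrite lee_fin mom_ge0.
  - exact: measurable_mom.
apply: ge0_le_integral => //.
- move=> u _; rewrite lee_fin sumr_ge0// => n _.
  by rewrite mulr_ge0 ?sqr_ge0 ?mom_ge0.
- apply/measurable_EFinP; apply: measurable_sum => n; apply: measurable_funM => //.
  by apply/measurable_EFinP; exact: measurable_mom.
- apply: measurable_limn_einf => k; exact: measurable_avg (cmeas_psv ra).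
(* For large [k] the average of the series is within [e] of the average of its partial sum, and the
   latter contains the first [N] terms among nonnegative ones. *)
move=> u _; have [K HK] := avg_near u ra.
apply/lee_addgt0Pr => e e0.
have /cvgrPdist_lt /(_ _ e0)[m _ Hm] := geometric_half_cvg0 K.
rewrite -leeBlDr//; apply: (limn_einf_ge (N := m + N)) => k mk.
rewrite -EFinB lee_fin lerBlDr -lerBlDl.
apply: (@le_trans _ _ (avg (psum a k.+3) (W k) k.+3 u - avg (psv a) (W k) k.+3 u)).
  rewrite lerD2r avg_psum// -!(big_mkord xpredT (fun n => nm (a n) ^+ 2 * mom n u)).
  have Nk : (N <= k.+3)%N by rewrite (leq_trans _ (leq_trans mk _))// ?leq_addl// !leqW.
  rewrite [leRHS](big_cat_nat (leq0n N) Nk)//= lerDl sumr_ge0// => n _.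
  by rewrite mulr_ge0 ?sqr_ge0 ?mom_ge0.
apply: le_trans (ler_norm _) _; rewrite distrC; apply: le_trans (HK _ _ (pw k)) _.
apply: ltW; apply: le_lt_trans (Hm k.+3 _); first by rewrite sub0r normrN ler_norm.
by rewrite /= (leq_trans _ (leq_trans mk _))// ?leq_addr// !leqW.
Qed.

(** The remaining inequality is Fatou's lemma on the partial sums, whose densities converge
    pointwise. Both sides may be infinite, so the identity also decides membership in the space. *)
Lemma integral_psv (M : nat -> \bar R) a : rapid a ->
  (forall n, \int[mu2]_u (mom n u)%:E = M n)%E ->
  (\int[mu2]_u (dens (psv a) u)%:E = \sum_(n <oo) (nm (a n) ^+ 2)%:E * M n)%E.
Proof.
move=> ra HM.
have M0 n : (0 <= M n)%E by rewrite -HM integral_ge0// => u _; rewrite lee_fin mom_ge0.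
have T0 n : (0 <= (nm (a n) ^+ 2)%:E * M n)%E by rewrite mule_ge0// lee_fin sqr_ge0.
apply/eqP; rewrite eq_le; apply/andP; split; last first.
  apply: lime_le; first by apply: is_cvg_nneseries => n _ _; exact: T0.
  by apply: nearW => N; exact: integral_psv_ge.
pose f k u := (dens (psum a k) u)%:E.
have cf : cvgn (fun k => \int[mu2]_u f k u)%E.
  rewrite (_ : (fun _ => _) = (fun k => \sum_(0 <= n < k) (nm (a n) ^+ 2)%:E * M n)%E).
    by apply: is_cvg_nneseries => n _ _; exact: T0.
  by apply/funext => k; exact: integral_psum.
have -> : (\sum_(n <oo) (nm (a n) ^+ 2)%:E * M n = limn_einf (fun k => \int[mu2]_u f k u))%E.
  rewrite is_cvg_limn_einfE//; congr (limn _).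
  by apply/funext => k; rewrite /f (integral_psum a k HM).
apply: (@le_trans _ _ (\int[mu2]_u limn_einf (f ^~ u))%E); last first.
  apply: fatou => //.
  - by move=> k; exact: measurable_Edens (cmeas_psum a k).
  - by move=> k u _; rewrite lee_fin dens_ge0.
rewrite le_eqVlt; apply/orP; left; apply/eqP; apply: eq_integral => u _.
suff /cvg_limn_einf_sup[-> _] : f ^~ u @ \oo --> (dens (psv a) u)%:E by [].
apply: cvg_EFin; first by apply: nearW.
rewrite /f /= /dens; apply: cvgMr_tmp.
have := psum_cvg (z := Defs.point u) ra => /cvgc_ReImP[h1 h2].
rewrite normc_sqr; under eq_fun do rewrite normc_sqr.
by apply: cvgD; apply: cvgM.
Qed.

End NormOfPowerSeries.

(** * Gaussian moments *)

Section GaussianMoments.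
Context {R : realType}.
Local Notation mu := (@lebesgue_measure R).
Local Notation mu2 := (@plane_measure R).
Local Notation g := (@gauss_fun R).

Lemma continuous_powM_gauss (n : nat) : continuous (fun x : R => x ^+ n * g x).
Proof.
move=> x; apply: cvgM; first exact: exprn_continuous.
exact: continuous_gauss_fun.
Qed.

(** Integrating this derivative is the integration by parts that links the moments of orders [n.+2]
    and [n]. *)
Lemma is_derive_powM_gauss (n : nat) (x : R) :
  is_derive x 1 (fun x : R => x ^+ n.+1 * g x) (n.+1%:R * x ^+ n * g x - 2 * (x ^+ n.+2 * g x)).
Proof.
have d1 : is_derive x (1 : R) (fun x : R => x ^+ n.+1) (n.+1%:R * x ^+ n).
  have -> : (fun x : R => x ^+ n.+1) = id ^+ n.+1 by apply/funext => y; rewrite fctE.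
  by apply: is_derive_eq; rewrite /GRing.scale/= mulr1.
have d2 : is_derive x (1 : R) (fun x : R => - x ^+ 2) (- (2 * x)).
  by apply: is_derive_eq; rewrite /GRing.scale/=; ring.
have d3 : is_derive x (1 : R) g (g x * (- (2 * x))).
  exact: (@is_derive1_comp _ expR (fun x : R => - x ^+ 2)).
apply: is_derive_eq; rewrite /= /GRing.scale/= !exprS; ring.
Qed.

(** One term of the exponential series, [(k^2)^(n+1) / (n+1)!], already leaves a decay of order
    [1 / k]. Integer [k] are enough, since half-line integrals are taken as limits over segments
    with integer end points. *)
Lemma cvg_powM_gauss (n : nat) : (k%:R : R) ^+ n * g k%:R @[k --> \oo] --> (0 : R).
Proof.
apply: (@squeeze_cvgr _ _ _ _ (fun=> 0) (fun k : nat => n.+1`!%:R * (k%:R)^-1)); last 2 first.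
- exact: cvg_cst.
- rewrite -(mulr0 (n.+1`!%:R)); apply: cvgMl_tmp.
  have := @cvg_harmonic R; rewrite /harmonic => h.
  by rewrite -cvg_shiftS.
exists 1%N => // k /= k1.
have k0 : 0 < k%:R :> R by rewrite ltr0n.
rewrite mulr_ge0 ?exprn_ge0 ?gauss_fun_ge0//=.
rewrite ler_pdivlMr// mulrAC -exprSr /gauss_fun expRN ler_pdivrMr ?expR_gt0//.
rewrite mulrC -ler_pdivrMr ?ltr0n ?fact_gt0//.
have := @expR_ge1Dxn R (k%:R ^+ 2) n (sqr_ge0 _).
apply: le_trans; rewrite -[leLHS]add0r lerD// ler_wpM2r ?invr_ge0//.
by rewrite -exprM ler_weXn2l ?ler1n// leq_pmull.
Qed.

Definition gmom (n : nat) : \bar R := (\int[mu]_x (x ^+ (2 * n) * g x)%:E)%E.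

Lemma measurable_powM_gauss (n : nat) : measurable_fun setT (fun x : R => x ^+ n * g x).
Proof. by apply: continuous_measurable_fun; exact: continuous_powM_gauss. Qed.

Lemma powM_gauss_ge0 (n : nat) x : 0 <= x ^+ (2 * n) * g x.
Proof. by rewrite mulr_ge0 ?gauss_fun_ge0// exprM exprn_ge0// sqr_ge0. Qed.

Lemma gmomE n : gmom n = (2%:E * \int[mu]_(x in `[0%R, +oo[) (x ^+ (2 * n) * g x)%:E)%E.
Proof.
rewrite /gmom ge0_symfun_integralT.
- by rewrite set_itvcy.
- exact: powM_gauss_ge0.
- exact: continuous_powM_gauss.
- by move=> x /=; rewrite /gauss_fun !exprM sqrrN.
Qed.

Lemma integral_0n_powM_gauss (n k : nat) :
  (2%:E * \int[mu]_(x in `[0%R, k.+1%:R]) (x ^+ n.+2 * g x)%:E =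
   n.+1%:R%:E * \int[mu]_(x in `[0%R, k.+1%:R]) (x ^+ n * g x)%:E - (k.+1%:R ^+ n.+1 * g k.+1%:R)%:E)%E.
Proof.
have k0 : (0 : R) < k.+1%:R by rewrite ltr0n.
have ci m : mu.-integrable `[0%R, k.+1%:R] (EFin \o (fun x : R => x ^+ m * g x)).
  apply: continuous_compact_integrable; first exact: segment_compact.
  by apply: continuous_subspaceT; exact: continuous_powM_gauss.
have cF m : continuous (fun x : R => x ^+ m * g x) by exact: continuous_powM_gauss.
have := @continuous_FTC2 R (fun x : R => n.+1%:R * x ^+ n * g x - 2 * (x ^+ n.+2 * g x))
   (fun x : R => x ^+ n.+1 * g x) 0 k.+1%:R k0.
case/(_ _ _ _)/Wrap.
- apply: continuous_subspaceT => x; apply: cvgB; last by apply: cvgMl_tmp; exact: cF.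
  under [X in X @ _ --> _]eq_fun do rewrite -mulrA; rewrite -mulrA.
  by apply: cvgMl_tmp; exact: cF.
- split.
  + by move=> x _; have [] := is_derive_powM_gauss n x.
  + exact/cvg_at_right_filter/cF.
  + exact/cvg_at_left_filter/cF.
- by move=> x _; rewrite derive1E; have [_] := is_derive_powM_gauss n x.
have fi m : (\int[mu]_(x in `[0%R, k.+1%:R]) (x ^+ m * g x)%:E)%E \is a fin_num.
  by apply: integrable_fin_num => //; exact: ci.
have -> : (\int[mu]_(x in `[0%R, k.+1%:R]) (n.+1%:R * x ^+ n * g x - 2 * (x ^+ n.+2 * g x))%:E =
   n.+1%:R%:E * \int[mu]_(x in `[0%R, k.+1%:R]) (x ^+ n * g x)%:E -
   2%:E * \int[mu]_(x in `[0%R, k.+1%:R]) (x ^+ n.+2 * g x)%:E)%E.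
  under eq_integral do rewrite EFinB -mulrA EFinM [(2 * _)%:E]EFinM.
  rewrite integralB//=; last 2 first.
  - exact: integrableZl (ci n).
  - exact: integrableZl (ci n.+2).
  by rewrite (integralZl _ (ci n))//= (integralZl _ (ci n.+2)).
move: (fi n) (fi n.+2) => /fineK <- /fineK <-.
rewrite expr0n/= mul0r sube0 -!EFinM -!EFinB => -[] h; congr EFin.
by rewrite -h; ring.
Qed.

(** Limit of [integral_0n_powM_gauss]: the boundary term tends to 0, and half of [(2 * n).+1] is
    [n + 1/2]. *)
Lemma gmom_rec_half (n : nat) (a : R) :
  (\int[mu]_(x in `[0%R, +oo[) (x ^+ (2 * n) * g x)%:E = a%:E)%E ->
  (\int[mu]_(x in `[0%R, +oo[) (x ^+ (2 * n.+1) * g x)%:E = ((n%:R + 2^-1) * a)%:E)%E.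
Proof.
move=> ha.
have c1 := @ge0_cvgn_integral R mu _ (powM_gauss_ge0 n) (measurable_powM_gauss (2 * n)).
have c2 := @ge0_cvgn_integral R mu _ (powM_gauss_ge0 n.+1) (measurable_powM_gauss (2 * n.+1)).
rewrite ha -cvg_shiftS in c1; rewrite -cvg_shiftS in c2.
suff h : (\int[mu]_(x in `[0%R, k.+1%:R]) (x ^+ (2 * n.+1) * g x)%:E)%E @[k --> \oo] --> ((n%:R + 2^-1) * a)%:E.
  exact: (cvg_unique _ c2 h).
have -> : (fun k : nat => \int[mu]_(x in `[0%R, k.+1%:R]) (x ^+ (2 * n.+1) * g x)%:E)%E =
  (fun k : nat => (2^-1)%:E * ((2 * n).+1%:R%:E * \int[mu]_(x in `[0%R, k.+1%:R]) (x ^+ (2 * n) * g x)%:E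
     - (k.+1%:R ^+ (2 * n).+1 * g k.+1%:R)%:E))%E.
  apply/funext => k; rewrite -integral_0n_powM_gauss muleA -EFinM mulVf// mul1e.
  by rewrite mulnS add2n.
have -> : (((n%:R + 2^-1) * a)%:E = (2^-1)%:E * ((2 * n).+1%:R%:E * a%:E - 0%:E))%E.
  rewrite sube0 -!EFinM; congr EFin; rewrite mulrA; congr (_ * _).
  by rewrite -[(2 * n).+1%:R]natr1 natrM; field.
apply: cvgeZl => //; apply: cvgeB => //.
- by apply: cvgeZl.
- apply: cvg_EFin; first exact: nearW.
  by have := cvg_powM_gauss (2 * n).+1; rewrite -cvg_shiftS.
Qed.

(** These are the values [Gamma (n + 1/2)]. *)
Fixpoint gm (n : nat) : R := if n is m.+1 then (m%:R + 2^-1) * gm m else Num.sqrt pi.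

Lemma gm_ge0 n : 0 <= gm n.
Proof. by elim: n => [|n IH] /=; rewrite ?sqrtr_ge0// mulr_ge0// addr_ge0// invr_ge0. Qed.

Lemma gmom_gm n : gmom n = (gm n)%:E.
Proof.
rewrite gmomE.
suff -> : (\int[mu]_(x in `[0%R, +oo[) (x ^+ (2 * n) * g x)%:E = (2^-1 * gm n)%:E)%E.
  by rewrite -EFinM mulrA divff// mul1r.
elim: n => [|n IH].
  rewrite muln0 /=; under eq_integral do rewrite expr0 mul1r.
  by rewrite integral0y_gauss mulrC.
by rewrite (gmom_rec_half IH) /=; congr EFin; ring.
Qed.

Lemma integral_monomial (j k : nat) :
  (\int[mu2]_u ((u.1 ^+ (2 * j) * g u.1) * (u.2 ^+ (2 * k) * g u.2))%:E = (gm j * gm k)%:E)%E.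
Proof.
have mm (n : nat) : measurable_fun setT (fun x : R => (x ^+ (2 * n) * g x)%:E).
  by apply/measurable_EFinP; exact: measurable_powM_gauss.
rewrite plane_tonelli1; last 2 first.
- apply/measurable_EFinP; apply: measurable_funM.
  + exact: (measurableT_comp (measurable_powM_gauss (2 * j)) measurable_fst).
  + exact: (measurableT_comp (measurable_powM_gauss (2 * k)) measurable_snd).
- by move=> u; rewrite lee_fin mulr_ge0 ?powM_gauss_ge0.
under eq_integral => x _.
  under eq_integral do rewrite EFinM /=.
  rewrite ge0_integralZl_EFin ?powM_gauss_ge0//; last 2 first.
  - by move=> y _; rewrite lee_fin powM_gauss_ge0.
  - exact: mm.
  rewrite -/(gmom k) gmom_gm muleC.
  over.
rewrite ge0_integralZl_EFin ?gm_ge0//; last 2 first.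
- by move=> y _; rewrite lee_fin powM_gauss_ge0.
- exact: mm.
by rewrite -/(gmom j) gmom_gm -EFinM mulrC.
Qed.

(** Pascal's rule groups the terms into pairs, and in each pair the recursion factors [j + 1/2] and
    [n - j + 1/2] add up to [n + 1]. *)
Lemma sum_bin_gm (n : nat) : \sum_(j < n.+1) 'C(n, j)%:R * (gm j * gm (n - j)) = pi * n`!%:R.
Proof.
elim: n => [|n IH].
  by rewrite big_ord_recl big_ord0 /= bin0 mul1r addr0 fact0 mulr1 -expr2 sqr_sqrtr ?pi_ge0.
pose G j k := gm j * gm k.
have Pascal : \sum_(j < n.+2) 'C(n.+1, j)%:R * G j (n.+1 - j)%N =
   \sum_(j < n.+1) 'C(n, j)%:R * (G j.+1 (n - j)%N + G j (n - j).+1).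
  under [RHS]eq_bigr do rewrite mulrDr.
  rewrite big_split/= [LHS]big_ord_recl bin0 [X in _ = _ + X]big_ord_recl bin0 /=.
  rewrite !subn0 addrCA; congr (_ + _).
  under eq_bigr do rewrite /bump /= add1n binS natrD mulrDl subSS.
  rewrite big_split/= addrC; congr (_ + _).
  rewrite big_ord_recr/= bin_small// mul0r addr0.
  by apply: eq_bigr => i _; rewrite /bump/= add1n -subSn.
rewrite -/(G _ _) Pascal factS natrM mulrCA -IH mulr_sumr; apply: eq_bigr => j _.
rewrite mulrCA; congr (_ * _); rewrite /G /=.
have -> : n.+1%:R = j%:R + (n - j)%:R + 1 :> R.
  by rewrite -natrD subnKC -1?ltnS// -natr1.
by field.
Qed.

(** The binomial expansion of [(x^2 + y^2)^n] splits the plane integral into products of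
    one-dimensional moments. *)
Lemma integral_mom (n : nat) : (\int[mu2]_u (mom n u)%:E = (pi * n`!%:R)%:E)%E.
Proof.
have E u : mom n u = \sum_(j < n.+1) 'C(n, j)%:R *
    ((u.1 ^+ (2 * j) * g u.1) * (u.2 ^+ (2 * (n - j)) * g u.2)) :> R.
  rewrite /mom addrC exprDn mulr_suml; apply: eq_bigr => j _.
  rewrite /gauss_weight opprD expRD /gauss_fun -!exprM -mulr_natl.
  by ring.
under eq_integral do rewrite E -sumEFin.
rewrite ge0_integral_sum//; last 2 first.
- move=> j; apply/measurable_EFinP; apply: measurable_funM => //; apply: measurable_funM.
  + exact: (measurableT_comp (measurable_powM_gauss (2 * j)) measurable_fst).
  + exact: (measurableT_comp (measurable_powM_gauss (2 * (n - j))) measurable_snd).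
- by move=> j u _; rewrite lee_fin mulr_ge0// mulr_ge0 ?powM_gauss_ge0.
rewrite -sum_bin_gm -sumEFin; apply: eq_bigr => j _.
under eq_integral do rewrite EFinM.
rewrite ge0_integralZl_EFin//; last 2 first.
- by move=> u _; rewrite lee_fin mulr_ge0 ?powM_gauss_ge0.
- apply/measurable_EFinP; apply: measurable_funM.
  + exact: (measurableT_comp (measurable_powM_gauss (2 * j)) measurable_fst).
  + exact: (measurableT_comp (measurable_powM_gauss (2 * (n - j))) measurable_snd).
by rewrite integral_monomial -EFinM.
Qed.

End GaussianMoments.

Section FockNorm.
Context {R : realType}.
Local Notation C := R[i].
Local Notation nm := Normc.normc.

Definition fock (a : nat -> C) : \bar R := (\sum_(n <oo) (n`!%:R * nm (a n) ^+ 2)%:E)%E.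

Lemma bargmann_norm2_psv a : rapid a -> bargmann_norm2 (psv a) = fock a.
Proof.
move=> ra; rewrite bargmann_norm2E (integral_psv ra integral_mom) /fock.
rewrite -nneseriesZl; last by move=> n _; rewrite -EFinM lee_fin mulr_ge0 ?sqr_ge0// mulr_ge0 ?pi_ge0.
congr (limn _); apply/funext => N; apply: eq_bigr => n _.
rewrite -!EFinM; congr EFin; rewrite mulrCA mulKf 1?mulrC//.
by rewrite gt_eqF// pi_gt0.
Qed.

End FockNorm.

(** * Taylor expansion of entire functions *)

Section ComplexIntegral.
Context {R : realType}.
Local Notation C := R[i].
Local Notation nm := Normc.normc.
Local Notation mu := (@lebesgue_measure R).
Implicit Types (f g : R -> C) (a b c : R).

Definition ccont f := continuous (fun t => complex.Re (f t)) /\ continuous (fun t => complex.Im (f t)).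

(** An integral over the set [[a, b]], hence 0 and not sign-reversed when [b < a]; additivity and
    the fundamental theorem therefore assume ordered end points. *)
Definition cint a b f : C :=
  Rintegral mu `[a, b] (fun t => complex.Re (f t)) +i*
  Rintegral mu `[a, b] (fun t => complex.Im (f t)).

Lemma continuous_integrable_itv a b (u : R -> R) : continuous u ->
  mu.-integrable `[a, b] (EFin \o u).
Proof.
move=> cu; apply: continuous_compact_integrable; first exact: segment_compact.
exact: continuous_subspaceT.
Qed.

Lemma ccont_cst (z : C) : ccont (fun=> z).
Proof. by split; exact: cst_continuous. Qed.

Lemma ccontD f g : ccont f -> ccont g -> ccont (fun t => f t + g t).
Proof.
move=> [f1 f2] [g1 g2]; split => t.
- by rewrite /continuous_at; under [X in X @ _ --> _]eq_fun do rewrite cReD; rewrite cReD; apply: cvgD; [exact: f1|exact: g1].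
- by rewrite /continuous_at; under [X in X @ _ --> _]eq_fun do rewrite cImD; rewrite cImD; apply: cvgD; [exact: f2|exact: g2].
Qed.

Lemma ccontM f g : ccont f -> ccont g -> ccont (fun t => f t * g t).
Proof.
move=> [f1 f2] [g1 g2]; split => t.
- rewrite /continuous_at; under [X in X @ _ --> _]eq_fun do rewrite cReM.
  rewrite cReM; apply: cvgB; apply: cvgM;
    by [exact: f1|exact: g1|exact: f2|exact: g2].
- rewrite /continuous_at; under [X in X @ _ --> _]eq_fun do rewrite cImM.
  rewrite cImM; apply: cvgD; apply: cvgM;
    by [exact: f1|exact: g1|exact: f2|exact: g2].
Qed.

Lemma ccont_real (u : R -> R) : continuous u -> ccont (fun t => (u t)%:C).
Proof. by move=> cu; split => //; exact: cst_continuous. Qed.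

Lemma cintD a b f g : ccont f -> ccont g ->
  cint a b (fun t => f t + g t) = cint a b f + cint a b g.
Proof.
move=> [f1 f2] [g1 g2]; apply: complex_eq; rewrite ?cReD ?cImD /=.
- rewrite -RintegralD//; try exact: continuous_integrable_itv.
  by apply: eq_Rintegral => t _; rewrite cReD.
- rewrite -RintegralD//; try exact: continuous_integrable_itv.
  by apply: eq_Rintegral => t _; rewrite cImD.
Qed.

Lemma cintZ a b (z : C) f : ccont f -> cint a b (fun t => z * f t) = z * cint a b f.
Proof.
move=> [f1 f2]; apply: complex_eq; rewrite ?cReM ?cImM /=.
- rewrite -!RintegralZl//; try exact: continuous_integrable_itv.
  rewrite -RintegralB//.
  + by apply: eq_Rintegral => t _; rewrite cReM.
  + by apply: continuous_integrable_itv => t; apply: cvgMl_tmp; exact: f1.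
  + by apply: continuous_integrable_itv => t; apply: cvgMl_tmp; exact: f2.
- rewrite -!RintegralZl//; try exact: continuous_integrable_itv.
  rewrite -RintegralD//.
  + by apply: eq_Rintegral => t _; rewrite cImM.
  + by apply: continuous_integrable_itv => t; apply: cvgMl_tmp; exact: f2.
  + by apply: continuous_integrable_itv => t; apply: cvgMl_tmp; exact: f1.
Qed.

Lemma cintB a b f g : ccont f -> ccont g ->
  cint a b (fun t => f t - g t) = cint a b f - cint a b g.
Proof.
move=> cf cg; have := cintZ a b (-1) cg; rewrite mulN1r => <-.
rewrite -cintD//; last by apply: ccontM => //; exact: ccont_cst.
by congr cint; apply/funext => t; rewrite mulN1r.
Qed.

Lemma cint_cat a b c f : a <= b -> b <= c -> ccont f ->
  cint a c f = cint a b f + cint b c f.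
Proof.
move=> ab bc [f1 f2].
have H (u : R -> R) : continuous u -> Rintegral mu `[a, c] u =
    Rintegral mu `[a, b] u + Rintegral mu `[b, c] u.
  move=> cu; have := @Rintegral_itvB R u (BLeft a) (BRight c) b
    (continuous_integrable_itv a c cu).
  rewrite !bnd_simp => /(_ ab bc) h.
  rewrite -[X in _ = _ + X]Rintegral_itv_obnd_cbnd -?h ?subrKC//.
  apply: integrableS (continuous_integrable_itv a c cu) => //.
  by apply: subset_itvScc => //; rewrite bnd_simp.
by apply: complex_eq; rewrite ?cReD ?cImD /= H.
Qed.

(** The factor 2 comes from estimating the real and imaginary parts separately. *)
Lemma cint_le a b f (M : R) : a <= b -> ccont f ->
  (forall t, a <= t <= b -> nm (f t) <= M) -> nm (cint a b f) <= 2 * M * (b - a).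
Proof.
move=> ab [f1 f2] fM.
have H (u : R -> R) : continuous u -> (forall t, a <= t <= b -> `|u t| <= M) ->
    `|Rintegral mu `[a, b] u| <= M * (b - a).
  move=> cu uM; apply: le_trans (le_normr_Rintegral _ _) _ => //.
    exact: continuous_integrable_itv.
  have -> : M * (b - a) = Rintegral mu `[a, b] (cst M).
    have mab : mu `[a, b]%classic = (b - a)%:E.
      rewrite lebesgue_measure_itv/= lte_fin; case: ltP => // ba.
      by have -> : b = a; [apply/eqP; rewrite eq_le ab ba|rewrite subrr].
    by rewrite Rintegral_cst//= ?mab//= mulrC.
  apply: le_Rintegral => //=.
  - by apply: continuous_integrable_itv => t; apply: cvg_norm; exact: cu.
  - by apply: continuous_integrable_itv => t; exact: cvg_cst.
apply: le_trans (normc_le_ReIm _) _; rewrite -mulrA mulr_natl mulr2n /=; apply: lerD.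
- by apply: H => // t /fM; apply: le_trans; exact: normc_ge_absRe.
- by apply: H => // t /fM; apply: le_trans; exact: normc_ge_absIm.
Qed.

Definition cderiv g f := forall t : R,
  is_derive t (1 : R) (fun t => complex.Re (g t)) (complex.Re (f t)) /\
  is_derive t (1 : R) (fun t => complex.Im (g t)) (complex.Im (f t)).

Lemma cint_FTC a b f g : a <= b -> ccont f -> cderiv g f -> cint a b f = g b - g a.
Proof.
rewrite le_eqVlt => /predU1P[<- _ _|ab [f1 f2] gf].
  by apply: complex_eq; rewrite /= ?cReD ?cImD ?cReN ?cImN set_itv1 Rintegral_set1 subrr.
have H (u v : R -> R) : continuous u -> (forall t : R, is_derive t (1 : R) v (u t)) ->
    Rintegral mu `[a, b] u = v b - v a.
  move=> cu vu; rewrite /Rintegral (@continuous_FTC2 R u v a b)//.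
  - exact: continuous_subspaceT.
  - have cv : continuous v.
      by move=> t; apply/differentiable_continuous/derivable1_diffP; have [] := vu t.
    split; [by move=> t _; have [] := vu t|exact/cvg_at_right_filter/cv|exact/cvg_at_left_filter/cv].
  - by move=> t _; rewrite derive1E; have [_] := vu t.
apply: complex_eq; rewrite ?cReD ?cImD ?cReN ?cImN /=.
- by apply: (H (fun t => complex.Re (f t)) (fun t => complex.Re (g t))) => // t; have [] := gf t.
- by apply: (H (fun t => complex.Im (f t)) (fun t => complex.Im (g t))) => // t; have [] := gf t.
Qed.

End ComplexIntegral.

(** * Goursat's bisection for an additive rectangle function *)

Section Goursat.
Context {R : realType}.
Local Notation C := R[i].
Local Notation nm := Normc.normc.
Variables (J : R -> R -> R -> C) (al be S T : R).
Hypotheses (al0 : 0 <= al) (be0 : 0 <= be).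
Hypothesis Jadd : forall s t d, 0 < d ->
  J s t (2 * d) = J s t d + J (s + al * d) t d + J s (t + be * d) d + J (s + al * d) (t + be * d) d.
(** Second-order smallness at a single point, for the subrectangles that contain it and stay inside
    the initial one; this is what complex differentiability at the point gives. *)
Hypothesis Jloc : forall s0 t0, S <= s0 <= S + al -> T <= t0 <= T + be -> forall e, 0 < e ->
  exists2 D, 0 < D & forall s t d, 0 < d -> d < D -> s <= s0 <= s + al * d -> t <= t0 <= t + be * d ->
    S <= s -> s + al * d <= S + al -> T <= t -> t + be * d <= T + be -> nm (J s t d) <= e * d ^+ 2.

(* [J s t d] stands for the integral over the boundary of the rectangle
   [s, s + al d] x [t, t + be d]. *)
Lemma goursat_bisection : J S T 1 = 0.
Proof.
apply: contrapT => J0.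
have c0 : 0 < nm (J S T 1).
  by rewrite lt_def normc_ge0 andbT; apply/eqP => /Normc.eq0_normc.
set c := nm _ in c0.
(* One of the four quarters carries at least a quarter of the norm. *)
have step (p : R * R) (n : nat) : exists q : R * R,
   [/\ p.1 <= q.1, q.1 + al * 2^-1 ^+ n.+1 <= p.1 + al * 2^-1 ^+ n,
       p.2 <= q.2, q.2 + be * 2^-1 ^+ n.+1 <= p.2 + be * 2^-1 ^+ n &
       nm (J p.1 p.2 (2^-1 ^+ n)) <= 4 * nm (J q.1 q.2 (2^-1 ^+ n.+1))].
  set d := 2^-1 ^+ n.+1 : R.
  have d0 : 0 < d by rewrite exprn_gt0.
  have dE : 2^-1 ^+ n = 2 * d :> R by rewrite /d exprS mulrA mulfV ?mul1r.
  rewrite dE Jadd//; set x1 := J _ _ d; set x2 := J _ _ d; set x3 := J _ _ d; set x4 := J _ _ d.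
  have tri : nm (x1 + x2 + x3 + x4) <= nm x1 + nm x2 + nm x3 + nm x4.
    by do 3 (apply: le_trans (le_normcD _ _) _; rewrite lerD2r).
  have ad : 0 <= al * d by rewrite mulr_ge0// ltW.
  have bd : 0 <= be * d by rewrite mulr_ge0// ltW.
  have E4 : [\/ nm (x1 + x2 + x3 + x4) <= 4 * nm x1, nm (x1 + x2 + x3 + x4) <= 4 * nm x2,
     nm (x1 + x2 + x3 + x4) <= 4 * nm x3 | nm (x1 + x2 + x3 + x4) <= 4 * nm x4].
    apply: contrapT => H.
    have [h1 h2 h3 h4] : [/\ 4 * nm x1 < nm (x1 + x2 + x3 + x4), 4 * nm x2 < nm (x1 + x2 + x3 + x4),
      4 * nm x3 < nm (x1 + x2 + x3 + x4) & 4 * nm x4 < nm (x1 + x2 + x3 + x4)].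
      by split; rewrite ltNge; apply/negP => h; apply: H;
        [apply: Or41|apply: Or42|apply: Or43|apply: Or44].
    by move: tri h1 h2 h3 h4; lra.
  case: E4 => h.
  - by exists p; split => //; rewrite mulrCA mulr_natl mulr2n addrA lerDl.
  - exists (p.1 + al * d, p.2); split => //=; rewrite ?lerDl//.
      by rewrite mulrCA mulr_natl mulr2n addrA.
    by rewrite mulrCA mulr_natl mulr2n addrA lerDl.
  - exists (p.1, p.2 + be * d); split => //=; rewrite ?lerDl//.
      by rewrite mulrCA mulr_natl mulr2n addrA lerDl.
    by rewrite mulrCA mulr_natl mulr2n addrA.
  - exists (p.1 + al * d, p.2 + be * d); split => //=; rewrite ?lerDl//.
      by rewrite mulrCA mulr_natl mulr2n addrA.
    by rewrite mulrCA mulr_natl mulr2n addrA.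
have /choice[F HF] : forall pn : (R * R) * nat, exists q : R * R,
   [/\ pn.1.1 <= q.1, q.1 + al * 2^-1 ^+ pn.2.+1 <= pn.1.1 + al * 2^-1 ^+ pn.2,
       pn.1.2 <= q.2, q.2 + be * 2^-1 ^+ pn.2.+1 <= pn.1.2 + be * 2^-1 ^+ pn.2 &
       nm (J pn.1.1 pn.1.2 (2^-1 ^+ pn.2)) <= 4 * nm (J q.1 q.2 (2^-1 ^+ pn.2.+1))].
  by move=> [p n]; exact: step.
pose fix P n : R * R := if n is m.+1 then F (P m, m) else (S, T).
have PS n := HF (P n, n).
have Pc n : c <= 4 ^+ n * nm (J (P n).1 (P n).2 (2^-1 ^+ n)).
  elim: n => [|n IH]; first by rewrite !expr0 mul1r.
  apply: le_trans IH _; rewrite exprSr -mulrA ler_wpM2l ?exprn_ge0//.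
  by have [] := PS n.
(* Nested intervals, stated once for both coordinates: a common point, and containment in the
   initial interval. *)
have nest (x : nat -> R) (ga X : R) : 0 <= ga -> x 0%N = X ->
   (forall n, x n <= x n.+1 /\ x n.+1 + ga * 2^-1 ^+ n.+1 <= x n + ga * 2^-1 ^+ n) ->
   exists x0, [/\ forall n, x n <= x0 <= x n + ga * 2^-1 ^+ n &
     forall n, X <= x n /\ x n + ga * 2^-1 ^+ n <= X + ga].
  move=> ga0 x0X H.
  have mono n m : (n <= m)%N -> x n <= x m /\ x m + ga * 2^-1 ^+ m <= x n + ga * 2^-1 ^+ n.
    move=> /subnK <-; elim: (m - n)%N => [|k [h1 h2]]; first by rewrite add0n.
    have [h3 h4] := H (k + n)%N; rewrite addSn; split; [exact: le_trans h3|exact: le_trans h4 _].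
  have h2 k : 0 <= ga * 2^-1 ^+ k by rewrite mulr_ge0// exprn_ge0.
  have cx : cvgn x.
    apply: (@geometric_cauchy_cvg _ _ ga) => N M NM; have [h1 h3] := mono _ _ NM.
    rewrite ger0_norm ?subr_ge0// lerBlDl; apply: le_trans h3; by rewrite lerDl.
  exists (limn x); split.
    move=> n; apply/andP; split.
      by apply: limr_ge => //; exists n => // m /= nm'; have [] := mono _ _ nm'.
    apply: limr_le => //; exists n => // m /= nm'; have [_] := mono _ _ nm'.
    by apply: le_trans; rewrite lerDl.
  by move=> n; have [] := mono _ _ (leq0n n); rewrite x0X expr0 mulr1.
have [s0 [Hs0 Hs1]] := nest (fun n => (P n).1) al S al0 erefl (fun n => ltac:(by have [] := PS n)).
have [t0 [Ht0 Ht1]] := nest (fun n => (P n).2) be T be0 erefl (fun n => ltac:(by have [] := PS n)).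
have s0S : S <= s0 <= S + al by have := Hs0 0%N; rewrite /= expr0 mulr1.
have t0T : T <= t0 <= T + be by have := Ht0 0%N; rewrite /= expr0 mulr1.
have c2 : 0 < c / 2 by rewrite divr_gt0.
have [D D0 HD] := Jloc s0S t0T c2.
have /cvgrPdist_lt /(_ _ D0)[N _ HN] := @geometric_half_cvg0 R 1.
have dN : (2^-1 : R) ^+ N < D.
  apply: le_lt_trans (HN N (leqnn N)).
  by rewrite sub0r normrN mul1r ler_norm.
have [a1 a2] := Hs1 N; have [b1 b2] := Ht1 N.
have := HD _ _ _ (exprn_gt0 N (_ : 0 < 2^-1)) dN (Hs0 N) (Ht0 N) a1 a2 b1 b2.
rewrite invr_gt0 => /(_ (ltr0Sn R 1)) h.
(* At depth [N] this reads [c <= 4^N * (c / 2) * (2^-N)^2], that is [c <= c / 2]. *)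
have := le_trans (Pc N) (ler_wpM2l (exprn_ge0 N (ler0n R 4)) h).
rewrite -exprM mulnC exprM mulrCA -exprMn.
have -> : 4 * 2^-1 ^+ 2 = 1 :> R by field.
by rewrite expr1n mulr1 leNgt ltr_pdivrMr// mulr_natr mulr2n ltrDl c0.
Qed.

End Goursat.

(** * The unit circle, and continuity along curves *)

Section CauchyFormula.
Context {R : realType}.
Local Notation C := R[i].
Local Notation nm := Normc.normc.
Implicit Types (f g : R -> C) (phi Phi : C -> C).

Lemma is_derive_eqf (u v : R -> R) (t l : R) : u = v -> is_derive t (1 : R) v l -> is_derive t (1 : R) u l.
Proof. by move=> ->. Qed.

Lemma cderiv_cst (z : C) : cderiv (fun=> z) (fun=> 0 : C).
Proof. by move=> t; split; exact: is_derive_cst. Qed.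

Lemma cderivM (f g f' g' : R -> C) : cderiv f f' -> cderiv g g' ->
  cderiv (fun t => f t * g t) (fun t => f' t * g t + f t * g' t).
Proof.
move=> hf hg t; have [f1 f2] := hf t; have [g1 g2] := hg t; split.
- have h := is_deriveB (is_deriveM f1 g1) (is_deriveM f2 g2).
  have -> : (fun t => complex.Re (f t * g t)) = (fun t => complex.Re (f t)) * (fun t => complex.Re (g t)) - (fun t => complex.Im (f t)) * (fun t => complex.Im (g t)).
    by apply/funext => x; rewrite cReM.
  apply: is_derive_eq h _.
  by rewrite /GRing.scale/= cReD !cReM; ring.
- have h := is_deriveD (is_deriveM f1 g2) (is_deriveM f2 g1).
  have -> : (fun t => complex.Im (f t * g t)) = (fun t => complex.Re (f t)) * (fun t => complex.Im (g t)) + (fun t => complex.Im (f t)) * (fun t => complex.Re (g t)).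
    by apply/funext => x; rewrite cImM.
  apply: is_derive_eq h _.
  by rewrite /GRing.scale/= cImD !cImM; ring.
Qed.

Lemma cderiv_eq (f g g' : R -> C) : g =1 g' -> cderiv f g -> cderiv f g'.
Proof. by move=> /funext ->. Qed.

Lemma cderivZ (z : C) (f f' : R -> C) : cderiv f f' -> cderiv (fun t => z * f t) (fun t => z * f' t).
Proof.
move=> hf; apply: cderiv_eq (cderivM (cderiv_cst z) hf) => t.
by rewrite mul0r add0r.
Qed.

Lemma cderiv_ccont f f' : cderiv f f' -> ccont f.
Proof.
by move=> h; split => t; apply/differentiable_continuous/derivable1_diffP; have [[? _] [? _]] := h t.
Qed.

Definition circle (t : R) : C := cos t +i* sin t.
(** The inverse on the unit circle, written as a conjugate so that its derivative is read off from
    those of cosine and sine. *)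
Definition circle_inv (t : R) : C := conjc (circle t).
Local Notation E := circle.
Local Notation uE := circle_inv.

Lemma E_uE t : E t * uE t = 1.
Proof.
apply: complex_eq; rewrite /uE ReImE /=; last by ring.
by rewrite mulrN opprK -!expr2 cos2Dsin2.
Qed.

Lemma nm_uE t : nm (uE t) = 1.
Proof. by rewrite /= sqrrN cos2Dsin2 sqrtr1. Qed.

Lemma nm_E t : nm (E t) = 1.
Proof. by rewrite /= cos2Dsin2 sqrtr1. Qed.

Lemma cderiv_E : cderiv E (fun t => 'i * E t).
Proof.
move=> t; split; rewrite /E.
- have -> : complex.Re ('i * (cos t +i* sin t)) = - sin t by rewrite cReM/=; ring.
  exact: is_derive_cos.
- have -> : complex.Im ('i * (cos t +i* sin t)) = cos t by rewrite cImM/=; ring.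
  exact: is_derive_sin.
Qed.

Lemma cderiv_uE : cderiv uE (fun t => - 'i * uE t).
Proof.
move=> t; split; rewrite /uE /E.
- have -> : complex.Re (- 'i * conjc (cos t +i* sin t)) = - sin t by rewrite cReM/=; ring.
  exact: is_derive_cos.
- have -> : complex.Im (- 'i * conjc (cos t +i* sin t)) = - cos t by rewrite cImM/=; ring.
  exact: is_deriveN.
Qed.

Lemma cderiv_uEX n : cderiv (fun t => uE t ^+ n) (fun t => - 'i * n%:R * uE t ^+ n).
Proof.
elim: n => [|n IH].
  apply: cderiv_eq (cderiv_cst 1) => t; by rewrite mulr0 mul0r.
have -> : (fun t => uE t ^+ n.+1) = (fun t => uE t * uE t ^+ n) by apply/funext => t; rewrite exprS.
apply: cderiv_eq (cderivM cderiv_uE IH) => t.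
by rewrite exprS -[n.+1%:R]natr1; ring.
Qed.

Lemma E_2pi : E (pi *+ 2) = E 0.
Proof. by rewrite /E cos2pi sin2pi cos0 sin0. Qed.

Lemma uEX_ccont n : ccont (fun t => uE t ^+ n).
Proof. exact: cderiv_ccont (cderiv_uEX n). Qed.

Lemma cint_uEX n : cint 0 (pi *+ 2) (fun t => uE t ^+ n) = if n == 0%N then (pi *+ 2)%:C else 0.
Proof.
have pi2 : 0 <= pi *+ 2 :> R by rewrite mulrn_wge0 ?pi_ge0.
case: eqP => [->|/eqP n0].
  rewrite (@cint_FTC _ _ _ _ (fun t => t%:C))//.
  - by rewrite subr0.
  - exact: uEX_ccont.
  - by move=> t; split; [exact: is_derive_id|exact: is_derive_cst].
(* Multiplied by [- 'i * n%:R], the integrand becomes the derivative of the periodic function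
   [uE t ^+ n]. *)
have ni0 : - 'i * n%:R != 0 :> C.
  by rewrite mulf_neq0 ?oppr_eq0 ?pnatr_eq0// eq_complex/= oner_eq0 andbF.
apply: (mulfI ni0); rewrite mulr0 -cintZ; last exact: uEX_ccont.
rewrite (cint_FTC pi2 _ (cderiv_uEX n)).
  by rewrite /uE E_2pi subrr.
by apply: ccontM; [exact: ccont_cst|exact: uEX_ccont].
Qed.

Lemma ccontV f : ccont f -> (forall t, f t != 0) -> ccont (fun t => (f t)^-1).
Proof.
move=> [f1 f2] f0.
have n0 t : complex.Re (f t) ^+ 2 + complex.Im (f t) ^+ 2 != 0.
  apply: contra (f0 t); rewrite paddr_eq0 ?sqr_ge0// !sqrf_eq0 => /andP[/eqP h1 /eqP h2].
  by apply/eqP; exact: complex_eq.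
have cV : continuous (fun t => (complex.Re (f t) ^+ 2 + complex.Im (f t) ^+ 2)^-1).
  move=> t; apply: cvgV => //; apply: cvgD.
    by under [X in X @ _ --> _]eq_fun do rewrite expr2; rewrite expr2; apply: cvgM; exact: f1.
  by under [X in X @ _ --> _]eq_fun do rewrite expr2; rewrite expr2; apply: cvgM; exact: f2.
have -> : (fun t => (f t)^-1) = (fun t => conjc (f t) * ((complex.Re (f t) ^+ 2 + complex.Im (f t) ^+ 2)^-1)%:C).
  apply/funext => t; apply: (mulfI (f0 t)); rewrite mulfV// mulrA.
  apply: complex_eq; rewrite !ReImE /=; last by ring.
  by have := n0 t; move: (complex.Re _) (complex.Im _) => x y h; field.
apply: ccontM; last exact: ccont_real.
split => t.
- by rewrite /continuous_at; under [X in X @ _ --> _]eq_fun do rewrite cReJ; rewrite cReJ; exact: f1.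
- by rewrite /continuous_at; under [X in X @ _ --> _]eq_fun do rewrite cImJ; rewrite cImJ; apply: cvgN; exact: f2.
Qed.

(** Continuity in the form that path integrals use: preservation of continuous curves. *)
Definition good Phi := forall f, ccont f -> ccont (fun t => Phi (f t)).

Lemma entire_diff phi (z : C) : entire phi -> exists l, forall e, 0 < e ->
  exists2 d, 0 < d & forall h, nm h < d -> nm (phi (z + h) - phi z - l * h) <= e * nm h.
Proof.
move=> /(_ z) /cvg_ex[/= l /cvgrPdist_le H]; exists l => e e0.
have /H [d0 /= /ltc0E[-> d_gt0] Hd] : 0 < e%:C :> C by rewrite ltcR.
exists (complex.Re d0) => // h hd.
have [->|h0] := eqVneq h 0; first by rewrite addr0 subrr mulr0 subr0 Normc.normc0 mulr0.
have := Hd h; rewrite /ball_/= sub0r normrN normcE' ltcR => /(_ hd h0).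
rewrite normcE' lecR => H1.
have nh : 0 < nm h by rewrite lt_def normc_ge0 andbT; apply: contra h0 => /eqP/Normc.eq0_normc ->.
have -> : phi (z + h) - phi z - l * h = - h * (l - h^-1 *: (phi (h *: (1 : C^o) + z) - phi z)).
  rewrite [h *: 1]mulr1 [_ *: _]/(_ * _) [h + z]addrC mulrBr [- h * (_ * _)]mulNr mulVKf//.
  ring.
by rewrite Normc.normcM normcN mulrC ler_wpM2r ?normc_ge0.
Qed.

Lemma entire_cont phi (z : C) : entire phi -> forall e, 0 < e ->
  exists2 d, 0 < d & forall h, nm h < d -> nm (phi (z + h) - phi z) < e.
Proof.
move=> ephi e e0; have [l Hl] := entire_diff z ephi.
have [d d0 Hd] := Hl 1 ltr01.
exists (Num.min d (e / (nm l + 1))).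
  by rewrite lt_min d0 divr_gt0// ltr_wpDl ?normc_ge0.
move=> h; rewrite lt_min => /andP[/Hd hd he].
have -> : phi (z + h) - phi z = (phi (z + h) - phi z - l * h) + l * h by ring.
apply: le_lt_trans (le_normcD _ _) _; rewrite Normc.normcM.
apply: (@le_lt_trans _ _ ((nm l + 1) * nm h)).
  by rewrite mulrDl addrC lerD2l.
by rewrite mulrC -ltr_pdivlMr// ltr_wpDl ?normc_ge0.
Qed.

Lemma entire_good phi : entire phi -> good phi.
Proof.
move=> ephi f [f1 f2].
suff H (t : R) : (fun x => phi (f x) : C^o) @ t --> (phi (f t) : C^o).
  by split => t; have /cvgc_ReImP[] := H t.
apply/cvgc_normP/cvgrPdist_lt => e e0.
have [d d0 Hd] := entire_cont (f t) ephi e0.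
have /cvgc_normP/cvgrPdist_lt /(_ _ d0) : (fun x => f x : C^o) @ t --> (f t : C^o).
  by apply/cvgc_ReImP; split; [exact: f1|exact: f2].
apply: filterS => x; rewrite !sub0r !normrN !ger0_norm ?normc_ge0// => /Hd.
by rewrite subrKC.
Qed.

Lemma good_cst z : good (fun=> z).
Proof. by move=> f _; exact: ccont_cst. Qed.
Lemma good_id : good (fun z => z).
Proof. by []. Qed.
Lemma goodD Phi Psi : good Phi -> good Psi -> good (fun z => Phi z + Psi z).
Proof. by move=> h1 h2 f cf; apply: ccontD; [exact: h1|exact: h2]. Qed.
Lemma goodM Phi Psi : good Phi -> good Psi -> good (fun z => Phi z * Psi z).
Proof. by move=> h1 h2 f cf; apply: ccontM; [exact: h1|exact: h2]. Qed.

Lemma ccont_bounded f (a b : R) : a <= b -> ccont f -> exists M, forall t, a <= t <= b -> nm (f t) <= M.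
Proof.
move=> ab [f1 f2].
have [c _ Hc] := @EVT_max R (fun t => `|complex.Re (f t)|) a b ab
  (continuous_subspaceT (fun t => cvg_norm (f1 t))).
have [d _ Hd] := @EVT_max R (fun t => `|complex.Im (f t)|) a b ab
  (continuous_subspaceT (fun t => cvg_norm (f2 t))).
exists (`|complex.Re (f c)| + `|complex.Im (f d)|) => t tab.
by apply: le_trans (normc_le_ReIm _) _; apply: lerD; [apply: Hc|apply: Hd]; rewrite in_itv.
Qed.

End CauchyFormula.

(** * Closedness of the form phi d log (z - a) *)

Section Homotopy.
Context {R : realType}.
Local Notation C := R[i].
Local Notation nm := Normc.normc.
Local Notation E := (@circle R).
Local Notation uE := (@circle_inv R).
Implicit Types (f g : R -> C) (phi Phi : C -> C).
Variables (a : C) (r : R).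
Hypothesis ar : nm a < r.

(* [ze s] runs over the circle of radius [r] about 0 contracted towards [a]
   by the factor [exp s], and [kk t dt + ds] is [d log (ze s t - a)]. *)
Definition W t : C := r%:C * E t - a.
Definition ze (s t : R) : C := a + (expR s)%:C * W t.
Definition kk t : C := 'i * r%:C * E t * (W t)^-1.

Let r0 : 0 < r. Proof. exact: le_lt_trans (normc_ge0 a) ar. Qed.

Lemma W_neq0 t : W t != 0.
Proof.
apply/eqP => W0; have : nm (r%:C * E t) = nm a by congr nm; apply/eqP; rewrite -subr_eq0; exact/eqP.
by rewrite Normc.normcM nm_E mulr1 normc_real gtr0_norm// => ra; move: ar; rewrite ra ltxx.
Qed.

Lemma W_le t : nm (W t) <= r + nm a.
Proof.
by rewrite (le_trans (le_normcD _ _))// normcN lerD2r Normc.normcM nm_E mulr1 normc_real gtr0_norm.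
Qed.

Lemma cderiv_W : cderiv W (fun t => 'i * r%:C * E t).
Proof.
move=> t; have [h1 h2] := cderivZ r%:C cderiv_E t; split.
- apply: (is_derive_eqf (v := (fun t => complex.Re (r%:C * E t)) - cst (complex.Re a))).
    by apply/funext => x; rewrite /W cReD cReN.
  apply: is_derive_eq (is_deriveB h1 (is_derive_cst _ _ _)) _.
  by rewrite subr0; congr complex.Re; ring.
- apply: (is_derive_eqf (v := (fun t => complex.Im (r%:C * E t)) - cst (complex.Im a))).
    by apply/funext => x; rewrite /W cImD cImN.
  apply: is_derive_eq (is_deriveB h2 (is_derive_cst _ _ _)) _.
  by rewrite subr0; congr complex.Im; ring.
Qed.

Lemma W_ccont : ccont W. Proof. exact: cderiv_ccont cderiv_W. Qed.

Lemma cderiv_expR : cderiv (fun s : R => (expR s)%:C) (fun s => (expR s)%:C).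
Proof. by move=> t; split; [exact: is_derive_expR|exact: is_derive_cst]. Qed.

Lemma expR_ccont : ccont (fun s : R => (expR s)%:C).
Proof. exact: cderiv_ccont cderiv_expR. Qed.

Lemma E_ccont : ccont E. Proof. exact: cderiv_ccont cderiv_E. Qed.

Lemma ze_ccont1 t : ccont (fun s => ze s t).
Proof.
apply: ccontD; first exact: ccont_cst.
by apply: ccontM; [exact: expR_ccont|exact: ccont_cst].
Qed.

Lemma ze_ccont2 s : ccont (ze s).
Proof.
apply: ccontD; first exact: ccont_cst.
by apply: ccontM; [exact: ccont_cst|exact: W_ccont].
Qed.

Lemma kk_ccont : ccont kk.
Proof.
apply: ccontM; first by apply: ccontM; [exact: ccont_cst|exact: E_ccont].
apply: ccontV; [exact: W_ccont|exact: W_neq0].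
Qed.

(** [edgeA] and [edgeB] integrate the pullback by [ze] of [Phi(z) dz / (z - a)]. The derivative of
    [ze] in [s] is [ze - a], whence the weight 1 on [edgeA]; the weight [kk] on [edgeB] does not
    depend on [s]. *)
Definition edgeA Phi s s' t := cint s s' (fun x => Phi (ze x t)).
Definition edgeB Phi t t' s := cint t t' (fun y => Phi (ze s y) * kk y).

Lemma edgeA_cc Phi t : good Phi -> ccont (fun x => Phi (ze x t)).
Proof. by apply; exact: ze_ccont1. Qed.
Lemma edgeB_cc Phi s : good Phi -> ccont (fun y => Phi (ze s y) * kk y).
Proof. by move=> gP; apply: ccontM; [apply: gP; exact: ze_ccont2|exact: kk_ccont]. Qed.

Variables (al be : R).
Definition bdry Phi s t d :=
  edgeA Phi s (s + al * d) t + edgeB Phi t (t + be * d) (s + al * d)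
  - edgeA Phi s (s + al * d) (t + be * d) - edgeB Phi t (t + be * d) s.

(* [ring] is slow on goals whose atoms are integrals. *)
Local Ltac gen_edges :=
  repeat match goal with
  | |- context [edgeA ?P ?s ?s' ?t] => generalize (edgeA P s s' t); intro
  | |- context [edgeB ?P ?s ?s' ?t] => generalize (edgeB P s s' t); intro
  end.

Lemma bdryD Phi Psi s t d : good Phi -> good Psi ->
  bdry (fun z => Phi z + Psi z) s t d = bdry Phi s t d + bdry Psi s t d.
Proof.
move=> gP gQ.
have hA s1 s2 t1 : edgeA (fun z => Phi z + Psi z) s1 s2 t1 = edgeA Phi s1 s2 t1 + edgeA Psi s1 s2 t1.
  by rewrite /edgeA cintD//; exact: edgeA_cc.
have hB s1 s2 t1 : edgeB (fun z => Phi z + Psi z) s1 s2 t1 = edgeB Phi s1 s2 t1 + edgeB Psi s1 s2 t1.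
  rewrite /edgeB -cintD; [|exact: edgeB_cc|exact: edgeB_cc].
  by congr cint; apply/funext => y; rewrite mulrDl.
rewrite /bdry !hA !hB; gen_edges; ring.
Qed.

Lemma bdryZ (c : C) Phi s t d : good Phi -> bdry (fun z => c * Phi z) s t d = c * bdry Phi s t d.
Proof.
move=> gP.
have hA s1 s2 t1 : edgeA (fun z => c * Phi z) s1 s2 t1 = c * edgeA Phi s1 s2 t1.
  by rewrite /edgeA cintZ//; exact: edgeA_cc.
have hB s1 s2 t1 : edgeB (fun z => c * Phi z) s1 s2 t1 = c * edgeB Phi s1 s2 t1.
  rewrite /edgeB -cintZ; last exact: edgeB_cc.
  by congr cint; apply/funext => y; rewrite mulrA.
rewrite /bdry !hA !hB; gen_edges; ring.
Qed.

Hypotheses (al0 : 0 <= al) (be0 : 0 <= be).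

(** The form is [ds + kk t dt]: opposite edges carry the same integral and cancel. *)
Lemma bdry1 s t d : bdry (fun=> 1) s t d = 0.
Proof.
rewrite /bdry [edgeA _ _ _ (t + _)](_ : _ = edgeA (fun=> 1) s (s + al * d) t)//.
rewrite [edgeB _ _ _ s](_ : _ = edgeB (fun=> 1) t (t + be * d) (s + al * d))//.
by gen_edges; ring.
Qed.

(** Here the form is [dz], with primitive [expR s * W t]. *)
Lemma bdry_sub s t d : 0 <= d -> bdry (fun z => z - a) s t d = 0.
Proof.
move=> d0.
have sd : s <= s + al * d by rewrite lerDl mulr_ge0.
have td : t <= t + be * d by rewrite lerDl mulr_ge0.
have hA t1 : edgeA (fun z => z - a) s (s + al * d) t1 = ((expR (s + al * d))%:C - (expR s)%:C) * W t1.
  rewrite /edgeA (cint_FTC (g := fun x => W t1 * (expR x)%:C) sd).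
  - by ring.
  - by under [X in ccont X]eq_fun do rewrite /ze addrC addKr; apply: ccontM; [exact: expR_ccont|exact: ccont_cst].
  - apply: cderiv_eq (cderivZ (W t1) cderiv_expR) => x.
    by rewrite /ze; ring.
have hB s1 : edgeB (fun z => z - a) t (t + be * d) s1 = (expR s1)%:C * (W (t + be * d) - W t).
  rewrite /edgeB (cint_FTC (g := fun y => (expR s1)%:C * W y) td).
  - by ring.
  - exact: (@edgeB_cc (fun z => z - a) s1 (goodD (@good_id R) (good_cst (- a)))).
  - apply: cderiv_eq (cderivZ (expR s1)%:C cderiv_W) => y.
    rewrite /ze /kk addrAC subrr add0r -[RHS]mulrA; congr (_ * _).
    by rewrite [RHS]mulrC mulfVK// W_neq0.
rewrite /bdry !hA !hB.
by move: (W t) (W _) (expR s)%:C (expR _)%:C => w1 w2 x1 x2; ring.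
Qed.

(** The interior edges of the four subrectangles cancel in pairs. *)
Lemma bdry_add Phi s t d : good Phi -> 0 < d ->
  bdry Phi s t (2 * d) = bdry Phi s t d + bdry Phi (s + al * d) t d
     + bdry Phi s (t + be * d) d + bdry Phi (s + al * d) (t + be * d) d.
Proof.
move=> gP d0.
have ad : 0 <= al * d by rewrite mulr_ge0// ltW.
have bd : 0 <= be * d by rewrite mulr_ge0// ltW.
have hA t1 : edgeA Phi s (s + al * d + al * d) t1 = edgeA Phi s (s + al * d) t1 + edgeA Phi (s + al * d) (s + al * d + al * d) t1.
  by apply: cint_cat; rewrite ?lerDl//; exact: edgeA_cc.
have hB s1 : edgeB Phi t (t + be * d + be * d) s1 = edgeB Phi t (t + be * d) s1 + edgeB Phi (t + be * d) (t + be * d + be * d) s1.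
  by apply: cint_cat; rewrite ?lerDl//; exact: edgeB_cc.
have E1 : s + al * (2 * d) = s + al * d + al * d by ring.
have E2 : t + be * (2 * d) = t + be * d + be * d by ring.
rewrite /bdry E1 E2 !hA !hB; gen_edges; ring.
Qed.

(** The 4 is 2 for each pair of opposite edges, times the 2 of [cint_le]. *)
Lemma bdry_le Phi s t d (M K : R) : good Phi -> 0 <= d -> 0 <= M ->
  (forall y, t <= y <= t + be * d -> nm (kk y) <= K) ->
  (forall x y, s <= x <= s + al * d -> t <= y <= t + be * d -> nm (Phi (ze x y)) <= M) ->
  nm (bdry Phi s t d) <= 4 * M * (al + K * be) * d.
Proof.
move=> gP d0 M0 HK HM.
have ad : 0 <= al * d by rewrite mulr_ge0.
have bd : 0 <= be * d by rewrite mulr_ge0.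
have hA t1 : t <= t1 <= t + be * d -> nm (edgeA Phi s (s + al * d) t1) <= 2 * M * (al * d).
  move=> ht1; have : nm (edgeA Phi s (s + al * d) t1) <= 2 * M * (s + al * d - s).
    by apply: cint_le; [rewrite lerDl|exact: edgeA_cc|move=> x hx; exact: HM].
  by rewrite [s + _ - s]addrAC subrr add0r.
have hB s1 : s <= s1 <= s + al * d -> nm (edgeB Phi t (t + be * d) s1) <= 2 * (M * K) * (be * d).
  move=> hs1; have : nm (edgeB Phi t (t + be * d) s1) <= 2 * (M * K) * (t + be * d - t).
    apply: cint_le; [by rewrite lerDl|exact: edgeB_cc|move=> y hy].
    by rewrite Normc.normcM ler_pM ?normc_ge0// ?HM ?HK.
  by rewrite [t + _ - t]addrAC subrr add0r.
have s1 : s <= s <= s + al * d by rewrite lexx lerDl.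
have s2 : s <= s + al * d <= s + al * d by rewrite lexx andbT lerDl.
have t1 : t <= t <= t + be * d by rewrite lexx lerDl.
have t2 : t <= t + be * d <= t + be * d by rewrite lexx andbT lerDl.
have := hA _ t1; have := hA _ t2; have := hB _ s1; have := hB _ s2.
rewrite /bdry; set x1 := edgeA _ _ _ t; set x2 := edgeA _ _ _ _; set x3 := edgeB _ _ _ s; set x4 := edgeB _ _ _ _.
move=> h4 h3 h2 h1.
have : nm (x1 + x4 - x2 - x3) <= nm x1 + nm x4 + nm x2 + nm x3.
  do 2 (apply: le_trans (le_normcD _ _) _; rewrite normcN lerD2r).
  exact: le_normcD.
move=> /le_trans; apply.
apply: (le_trans (lerD (lerD (lerD h1 h4) h2) h3)).
by rewrite le_eqVlt; apply/orP; left; apply/eqP; ring.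
Qed.

Lemma expR_lip (x y : R) : x <= 0 -> y <= 0 -> `|expR x - expR y| <= `|x - y|.
Proof.
wlog xy : x y / y <= x.
  move=> H x0 y0; have [h|/ltW h] := leP y x; first exact: H.
  by rewrite distrC [leRHS]distrC; exact: H.
move=> x0 y0; rewrite !ger0_norm ?subr_ge0 ?ler_expR//.
have h := expR_ge1Dx (y - x).
have -> : expR y = expR x * expR (y - x) by rewrite -expRD subrKC.
have e1 : expR x <= 1 by rewrite -expR0 ler_expR.
have e0 : 0 <= expR x by exact: expR_ge0.
have xy0 : 0 <= x - y by rewrite subr_ge0.
have h2 : expR x * (1 + (y - x)) <= expR x * expR (y - x) by rewrite ler_wpM2l.
have h3 : expR x * (x - y) <= x - y by rewrite ler_piMl.
by move: h2 h3; lra.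
Qed.

Lemma E_lip (x y : R) : nm (E x - E y) <= 2 * `|x - y|.
Proof.
wlog xy : x y / y <= x.
  move=> H; have [h|/ltW h] := leP y x; first exact: H.
  by rewrite distrC -normcN opprB; exact: H.
have hE := cint_FTC xy (ccontM (ccont_cst 'i) E_ccont) (@cderiv_E R).
rewrite -hE ger0_norm ?subr_ge0// -[2]mulr1; apply: cint_le => //.
  by apply: ccontM; [exact: ccont_cst|exact: E_ccont].
by move=> t _; rewrite Normc.normcM nm_E mulr1 /= expr0n expr1n add0r sqrtr1.
Qed.

Lemma ze_lip s s0 t t0 : s <= 0 -> s0 <= 0 ->
  nm (ze s t - ze s0 t0) <= (r + nm a) * `|s - s0| + 2 * r * `|t - t0|.
Proof.
move=> hs hs0.
have -> : ze s t - ze s0 t0 = (expR s - expR s0)%:C * W t + (expR s0)%:C * (r%:C * (E t - E t0)).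
  by rewrite /ze /W rmorphB /=; ring.
apply: le_trans (le_normcD _ _) _; rewrite !Normc.normcM !normc_real; apply: lerD.
  by rewrite mulrC ler_pM ?normc_ge0// ?W_le// expR_lip.
rewrite ger0_norm ?expR_ge0// gtr0_norm//.
apply: (@le_trans _ _ (1 * (r * (2 * `|t - t0|)))).
  rewrite ler_pM ?expR_ge0 ?mulr_ge0 ?normc_ge0 ?(ltW r0)//.
    by rewrite -expR0 ler_expR.
  by rewrite ler_wpM2l ?(ltW r0)// E_lip.
by rewrite mul1r mulrCA mulrA.
Qed.

(** Around [z0] the function is a constant, plus a multiple of [z - a], plus a remainder [rho]. The
    first two contribute nothing by [bdry1] and [bdry_sub]; [rho] is small relative to [d] on a
    boundary of length proportional to [d]. The condition [S + al <= 0] keeps [s] where the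
    exponential is 1-Lipschitz. *)
Lemma bdry_loc phi (S T : R) : entire phi -> S + al <= 0 ->
  forall s0 t0, S <= s0 <= S + al -> T <= t0 <= T + be -> forall e, 0 < e ->
  exists2 D, 0 < D & forall s t d, 0 < d -> d < D -> s <= s0 <= s + al * d -> t <= t0 <= t + be * d ->
    S <= s -> s + al * d <= S + al -> T <= t -> t + be * d <= T + be -> nm (bdry phi s t d) <= e * d ^+ 2.
Proof.
move=> ephi Sal s0 t0 hs0 ht0 e e0.
have Tbe : T <= T + be by rewrite lerDl.
have [K HK] := ccont_bounded Tbe kk_ccont.
have K0 : 0 <= K by apply: le_trans (HK T _); rewrite ?normc_ge0// lexx.
set z0 := ze s0 t0.
have [l Hl] := entire_diff z0 ephi.
(* By [ze_lip], a rectangle of scale [d] around [(s0, t0)] is mapped within [La * d] of [z0]. *)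
pose La := (r + nm a) * al + 2 * r * be.
have La0 : 0 <= La by rewrite /La addr_ge0// !mulr_ge0// ?addr_ge0 ?normc_ge0// ltW.
(* The total factor that [bdry_le] puts in front of [d ^+ 2]; dividing [e] by [Q + 1] beforehand
   compensates it. *)
pose Q := 4 * La * (al + K * be).
have Q0 : 0 <= Q by rewrite /Q !mulr_ge0// addr_ge0// mulr_ge0.
have e1 : 0 < e / (Q + 1) by rewrite divr_gt0// ltr_wpDl.
have [dl dl0 Hdl] := Hl _ e1.
exists (dl / (La + 1)); first by rewrite divr_gt0// ltr_wpDl.
move=> s t d d0 dD hs ht hS hSa hT hTb.
pose rho z := phi z - phi z0 - l * (z - z0).
have grho : good rho.
  move=> f cf; have c1 := entire_good ephi cf.
  have -> : (fun t => rho (f t)) = (fun t => phi (f t) + (- phi z0 + - l * (f t + - z0))).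
    by apply/funext => x; rewrite /rho; ring.
  by apply: ccontD => //; apply: ccontD; [exact: ccont_cst|apply: ccontM; [exact: ccont_cst|apply: ccontD => //; exact: ccont_cst]].
have gid : good (fun z => z - a) := goodD (@good_id R) (good_cst (- a)).
(* The affine part is re-expanded at [a] instead of [z0], to match [bdry1] and [bdry_sub]. *)
have E1 : phi = (fun z => rho z + ((phi z0 + l * (a - z0)) * 1 + l * (z - a))).
  by apply/funext => z; rewrite /rho; ring.
have -> : bdry phi s t d = bdry rho s t d.
  have g1 : good (fun=> (phi z0 + l * (a - z0)) * 1) := good_cst _.
  have g2 : good (fun z => l * (z - a)) := goodM (good_cst l) gid.
  rewrite {1}E1 (bdryD _ _ _ grho (goodD g1 g2)) (bdryD _ _ _ g1 g2).
  rewrite (@bdryZ _ (fun=> 1))//; last exact: good_cst.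
  by rewrite bdry1 (bdryZ _ _ _ _ gid) bdry_sub ?(ltW d0)// !mulr0 !addr0.
have ad : 0 <= al * d by rewrite mulr_ge0// ltW.
have bd : 0 <= be * d by rewrite mulr_ge0// ltW.
have Hz x y : s <= x <= s + al * d -> t <= y <= t + be * d -> nm (ze x y - z0) <= La * d.
  move=> /andP[hx1 hx2] /andP[hy1 hy2].
  have [/andP[hs1 hs2] /andP[ht1 ht2] /andP[_ hs02]] := And3 hs ht hs0.
  apply: le_trans (ze_lip _ _ _ _) _.
  - by apply: le_trans hx2 (le_trans hSa Sal).
  - exact: le_trans hs02 Sal.
  have -> : La * d = (r + nm a) * (al * d) + 2 * r * (be * d) by rewrite /La; ring.
  apply: lerD; rewrite ler_wpM2l//.
  - by rewrite addr_ge0 ?normc_ge0// ltW.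
  - by rewrite ler_distl; apply/andP; split; lra.
  - by rewrite mulr_ge0// ltW.
  - by rewrite ler_distl; apply/andP; split; lra.
have : nm (bdry rho s t d) <= 4 * (e / (Q + 1) * (La * d)) * (al + K * be) * d.
  apply: bdry_le => //; rewrite ?(ltW d0)//.
  - by apply: mulr_ge0; [exact: ltW|rewrite mulr_ge0// ltW].
  - by move=> y /andP[h1 h2]; apply: HK; rewrite (le_trans hT h1)/= (le_trans h2).
  move=> x y hx hy; have hz := Hz _ _ hx hy.
  have := Hdl (ze x y - z0); rewrite subrKC /rho => H.
  apply: le_trans (H _) _.
    apply: le_lt_trans hz _; move: dD; rewrite ltr_pdivlMr ?ltr_wpDl// => dD.
    apply: le_lt_trans dD; rewrite mulrC ler_wpM2l ?(ltW d0)//; lra.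
  by rewrite ler_wpM2l// ltW.
move=> /le_trans; apply.
have -> : 4 * (e / (Q + 1) * (La * d)) * (al + K * be) * d = (e / (Q + 1) * Q) * d ^+ 2.
  by rewrite /Q; ring.
rewrite ler_wpM2r ?sqr_ge0// mulrAC ler_pdivrMr ?ltr_wpDl// ler_wpM2l ?(ltW e0)//; lra.
Qed.

Lemma bdry_entire phi (S T : R) : entire phi -> S + al <= 0 -> bdry phi S T 1 = 0.
Proof.
move=> ephi Sal.
apply: (goursat_bisection al0 be0 (J := bdry phi)).
  by move=> s t d d0; apply: bdry_add => //; exact: entire_good.
exact: bdry_loc.
Qed.

End Homotopy.

(** * Cauchy's formula and Taylor coefficients *)

Section Taylor.
Context {R : realType}.
Local Notation C := R[i].
Local Notation nm := Normc.normc.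
Local Notation E := (@circle R).
Local Notation uE := (@circle_inv R).
Implicit Types (h : R -> C) (phi : C -> C).

Lemma pi2_ge0 : 0 <= pi *+ 2 :> R.
Proof. by rewrite mulrn_wge0 ?pi_ge0. Qed.

Lemma squeeze_nm0 (z : C) (K : R) (m : nat) : (forall n, (m <= n)%N -> nm z <= K * n.+1%:R^-1) -> z = 0.
Proof.
move=> H; apply: Normc.eq0_normc; apply/eqP; rewrite eq_le normc_ge0 andbT.
have cv : K * n.+1%:R^-1 @[n --> \oo] --> (0 : R).
  by rewrite -(mulr0 K); apply: cvgMl_tmp; exact: cvg_harmonic.
by apply: (ler_cvg_to (cvg_cst (nm z)) cv); exists m.
Qed.

Lemma cvgc_eq (u v : nat -> C) (l : C) : u =1 v ->
  (u : nat -> C^o) @ \oo --> (l : C^o) -> (v : nat -> C^o) @ \oo --> (l : C^o).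
Proof. by move=> /funext ->. Qed.

(** Vanishing on the rectangle [[-n, 0] x [0, 2 pi]] says that the integral over the circle
    contracted by [exp(-n)] does not depend on [n]; as [n] grows, [phi] tends to [phi a] uniformly
    on these circles. The integral of [kk] is kept symbolic and computed in [tcoef_cvg]. *)
Lemma cauchy_formula phi (a : C) (r : R) : entire phi -> nm a < r ->
  cint 0 (pi *+ 2) (fun t => phi (r%:C * E t) * kk a r t) =
  phi a * cint 0 (pi *+ 2) (kk a r).
Proof.
move=> ephi ar; have gphi := entire_good ephi.
pose B s := edgeB a r phi 0 (pi *+ 2) s.
have B0 : B 0 = cint 0 (pi *+ 2) (fun t => phi (r%:C * E t) * kk a r t).
  by congr cint; apply/funext => t; rewrite /ze /W expR0 mul1r subrKC.
have BB (n : nat) : B (- n%:R) = B 0.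
  have := bdry_entire ar (ler0n R n) pi2_ge0 0 ephi (_ : - n%:R + n%:R <= 0).
  rewrite addNr lexx => /(_ isT); rewrite /bdry !mulr1 addNr !add0r -!/(B _).
  (* The sides [t = 0] and [t = 2 pi] are the same curve, so they cancel. *)
  have -> : edgeA a r phi (- n%:R) 0 (pi *+ 2) = edgeA a r phi (- n%:R) 0 0.
    by congr cint; apply/funext => x; rewrite /ze /W E_2pi.
  move: (edgeA _ _ _ _ _ _) => x; rewrite [x + _]addrC addrK => /eqP.
  by rewrite subr_eq0 => /eqP ->.
have [l Hl] := entire_diff a ephi.
have [d d0 Hd] := Hl 1 ltr01.
have [K HK] := ccont_bounded pi2_ge0 (kk_ccont ar).
have K0 : 0 <= K by apply: le_trans (HK 0 _); rewrite ?normc_ge0// lexx pi2_ge0.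
have r0 : 0 < r by apply: le_lt_trans ar; exact: normc_ge0.
have ra0 : 0 <= r + nm a by rewrite addr_ge0 ?normc_ge0// ltW.
rewrite -B0; apply/eqP; rewrite -subr_eq0; apply/eqP.
have [m _ Hm] : \forall n \near \oo, (r + nm a) * n.+1%:R^-1 < d.
  have cv : (r + nm a) * n.+1%:R^-1 @[n --> \oo] --> (0 : R).
    by rewrite -(mulr0 (r + nm a)); apply: cvgMl_tmp; exact: cvg_harmonic.
  move/cvgrPdist_lt : cv => /(_ _ d0); apply: filterS => n.
  by rewrite sub0r normrN ger0_norm// mulr_ge0// invr_ge0.
apply: (@squeeze_nm0 _ (2 * ((nm l + 1) * (r + nm a) * K) * (pi *+ 2)) m) => n mn.
rewrite -(BB n).
have -> : B (- n%:R) - phi a * cint 0 (pi *+ 2) (kk a r) =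
   cint 0 (pi *+ 2) (fun y => (phi (ze a r (- n%:R) y) - phi a) * kk a r y).
  rewrite -cintZ; last exact: kk_ccont.
  rewrite -cintB; [|exact: edgeB_cc|apply: ccontM; [exact: ccont_cst|exact: kk_ccont]].
  by congr cint; apply/funext => y; rewrite mulrBl.
have en : expR (- n%:R) <= n.+1%:R^-1 :> R.
  rewrite expRN lef_pV2 ?posrE ?expR_gt0//.
  by rewrite -natr1 addrC; exact: expR_ge1Dx.
apply: le_trans (cint_le (M := (nm l + 1) * ((r + nm a) * n.+1%:R^-1) * K) pi2_ge0 _ _) _.
- apply: ccontM; last exact: kk_ccont.
  by apply: ccontD; [apply: gphi; exact: ze_ccont2|exact: ccont_cst].
- move=> y hy; rewrite Normc.normcM ler_pM ?normc_ge0 ?HK// /ze.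
  set h := _%:C * _.
  have hh : nm h <= (r + nm a) * n.+1%:R^-1.
    rewrite /h Normc.normcM normc_real ger0_norm ?expR_ge0// mulrC.
    by rewrite ler_pM ?normc_ge0 ?expR_ge0// W_le.
  have -> : phi (a + h) - phi a = (phi (a + h) - phi a - l * h) + l * h by ring.
  apply: le_trans (le_normcD _ _) _; rewrite Normc.normcM.
  apply: (@le_trans _ _ ((nm l + 1) * nm h)).
    by rewrite mulrDl addrC lerD2l; apply: Hd; apply: le_lt_trans hh _; exact: Hm.
  by rewrite ler_wpM2l// addr_ge0 ?normc_ge0.
- by rewrite subr0 le_eqVlt; apply/orP; left; apply/eqP; ring.
Qed.

(** Term-by-term integration with an exact remainder, the integral of [q ^+ N] times a bounded
    function, so no theorem on limits under the integral is involved. *)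
Lemma geometric_integral h (q : C) : ccont h -> nm q < 1 ->
  (fun N => \sum_(0 <= n < N) q ^+ n * cint 0 (pi *+ 2) (fun t => h t * uE t ^+ n) : C^o) @ \oo -->
  (cint 0 (pi *+ 2) (fun t => h t * (1 - q * uE t)^-1) : C^o).
Proof.
move=> ch q1.
have n0 t : 1 - q * uE t != 0.
  apply/eqP => /eqP; rewrite subr_eq0 => /eqP e1; have : nm (1 : C) = nm q by rewrite e1 Normc.normcM nm_uE mulr1.
  by rewrite Normc.normc1 => e2; move: q1; rewrite -e2 ltxx.
have n1 t : 1 - nm q <= nm (1 - q * uE t).
  rewrite lerBlDr; have := le_normcD (1 - q * uE t) (q * uE t).
  by rewrite subrK Normc.normc1 Normc.normcM nm_uE mulr1.
have cu n : ccont (fun t => uE t ^+ n) by exact: uEX_ccont.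
have cV : ccont (fun t => (1 - q * uE t)^-1).
  apply: ccontV => //; apply: ccontD; first exact: ccont_cst.
  have -> : (fun t => - (q * uE t)) = (fun t => - q * uE t ^+ 1) by apply/funext => t; rewrite mulNr.
  by apply: ccontM; [exact: ccont_cst|exact: cu].
have [M HM] := ccont_bounded pi2_ge0 ch.
have M0 : 0 <= M by apply: le_trans (HM 0 _); rewrite ?normc_ge0// lexx pi2_ge0.
have rem N : cint 0 (pi *+ 2) (fun t => h t * (1 - q * uE t)^-1) -
   \sum_(0 <= n < N) q ^+ n * cint 0 (pi *+ 2) (fun t => h t * uE t ^+ n) =
   cint 0 (pi *+ 2) (fun t => q ^+ N * (h t * uE t ^+ N * (1 - q * uE t)^-1)).
  elim: N => [|N IH].
    by rewrite big_geq// subr0; congr cint; apply/funext => t; rewrite !expr0 mul1r mulr1.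
  rewrite big_nat_recr//= opprD addrA IH -cintZ; last by apply: ccontM.
  rewrite -cintB; last 2 first.
  - by apply: ccontM; [exact: ccont_cst|apply: ccontM => //; apply: ccontM].
  - by apply: ccontM; [exact: ccont_cst|apply: ccontM].
  congr cint; apply/funext => t; rewrite !exprSr.
  by have := n0 t; move: (uE t) (q ^+ N) (_ ^+ N) (h t) => u x y hh n0t; field.
apply/cvgc_normP.
apply: (@squeeze_cvgr _ _ _ _ (fun=> 0) (fun N => (2 * (M * (1 - nm q)^-1) * (pi *+ 2)) * nm q ^+ N)); last 2 first.
- exact: cvg_cst.
- by apply: cvg_geometric; rewrite ger0_norm ?normc_ge0.
apply: nearW => N; rewrite normc_ge0/= -normcN opprB rem cintZ; last first.
  by apply: ccontM => //; apply: ccontM.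
rewrite Normc.normcM normcX mulrC ler_wpM2r ?exprn_ge0 ?normc_ge0//.
apply: le_trans (cint_le (M := M * (1 - nm q)^-1) pi2_ge0 _ _) _; last by rewrite subr0.
  by apply: ccontM => //; apply: ccontM.
move=> t ht; rewrite !Normc.normcM normcX nm_uE expr1n mulr1 ler_pM ?normc_ge0 ?HM//.
by rewrite Normc.normcV lef_pV2 ?posrE ?subr_gt0// (lt_le_trans _ (n1 t))// subr_gt0.
Qed.

Definition tcoef phi (r : R) (n : nat) : C :=
  ((pi *+ 2)^-1 * r ^- n)%:C * cint 0 (pi *+ 2) (fun t => phi (r%:C * E t) * uE t ^+ n).

Lemma circle_ccont phi (r : R) : entire phi -> ccont (fun t => phi (r%:C * E t)).
Proof.
move=> ephi; apply: (entire_good ephi); apply: ccontM; [exact: ccont_cst|].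
exact: cderiv_ccont (@cderiv_E R).
Qed.

(** With [q = a / r], the kernel [kk] equals ['i * (1 - q * uE t)^-1], whose geometric expansion
    turns Cauchy's formula into the Taylor series. *)
Lemma tcoef_cvg phi (r : R) (a : C) : entire phi -> nm a < r ->
  (fun N => psum (tcoef phi r) N a : C^o) @ \oo --> (phi a : C^o).
Proof.
move=> ephi ar; have r0 : 0 < r by apply: le_lt_trans ar; exact: normc_ge0.
have rC0 : r%:C != 0 :> C by rewrite eq_complex/= gt_eqF.
pose q := a / r%:C.
have q1 : nm q < 1.
  by rewrite /q Normc.normcM Normc.normcV normc_real gtr0_norm// ltr_pdivrMr// mul1r.
have kkE t : kk a r t = 'i * (1 - q * uE t)^-1.
  have Eu := E_uE t.
  have E0 : E t != 0 by apply/eqP => h; move: Eu; rewrite h mul0r => /eqP; rewrite eq_sym oner_eq0.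
  have WE : W a r t = (r%:C * E t) * (1 - q * uE t).
    rewrite /W mulrBr mulr1; congr (_ - _).
    by rewrite [RHS](_ : _ = a * (r%:C / r%:C) * (E t * uE t)); [rewrite mulfV// Eu !mulr1|rewrite /q; ring].
  have rE0 : r%:C * E t != 0 by rewrite mulf_neq0.
  rewrite /kk WE -['i * r%:C * E t]mulrA.
  by move: (r%:C * E t) rE0 => x x0; rewrite invfM mulrA mulfK.
have i0 : 'i != 0 :> C by rewrite eq_complex/= oner_eq0 andbF.
have pi0 : (pi *+ 2)%:C != 0 :> C by rewrite eq_complex/= mulrn_eq0/= gt_eqF// pi_gt0.
have cV : ccont (fun t => (1 - q * uE t)^-1).
  have -> : (fun t => (1 - q * uE t)^-1) = (fun t => 'i^-1 * kk a r t).
    by apply/funext => t; rewrite kkE mulKf.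
  by apply: ccontM; [exact: ccont_cst|exact: kk_ccont].
have := cauchy_formula ephi ar.
have -> : (fun t => phi (r%:C * E t) * kk a r t) = (fun t => 'i * (phi (r%:C * E t) * (1 - q * uE t)^-1)).
  by apply/funext => t; rewrite kkE mulrCA.
have -> : kk a r = (fun t => 'i * (1 - q * uE t)^-1) by apply/funext => t; rewrite kkE.
rewrite !cintZ//; last by apply: ccontM => //; exact: circle_ccont.
(* The same expansion for the constant function 1, where only the term [n = 0] has a nonzero
   integral. *)
have -> : cint 0 (pi *+ 2) (fun t => (1 - q * uE t)^-1) = (pi *+ 2)%:C.
  have -> : (fun t => (1 - q * uE t)^-1) = (fun t => 1 * (1 - q * uE t)^-1) by apply/funext => t; rewrite mul1r.
  pose v N : C := \sum_(0 <= n < N) q ^+ n * cint 0 (pi *+ 2) (fun t => 1 * uE t ^+ n).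
  have hv : (v : nat -> C^o) @ \oo --> ((pi *+ 2)%:C : C^o).
    rewrite -(cvg_shiftS (v : nat -> C^o)).
    apply: (@cvgc_eq (fun=> (pi *+ 2)%:C)); last exact: cvg_cst.
    have uE1 n : (fun t => 1 * uE t ^+ n) = (fun t => uE t ^+ n) by apply/funext => t; rewrite mul1r.
    move=> N /=; rewrite /v big_nat_recl// expr0 mul1r big1 ?addr0; last first.
      by move=> n _; rewrite uE1 cint_uEX mulr0.
    by rewrite uE1 cint_uEX.
  exact: (cvg_unique _ (geometric_integral (ccont_cst 1) q1) hv).
rewrite mulrCA => /(mulfI i0) Hphi.
have -> : phi a = (pi *+ 2)%:C^-1 * cint 0 (pi *+ 2) (fun t => phi (r%:C * E t) * (1 - q * uE t)^-1).
  by rewrite Hphi mulrCA mulVf ?mulr1.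
apply: (cvgc_eq _ (cvgcZ (c := (pi *+ 2)%:C^-1) (geometric_integral (circle_ccont r ephi) q1))) => N; rewrite /psum mulr_sumr.
apply: eq_bigr => n _; rewrite /tcoef /q exprMn exprVn.
rewrite !rmorphM /= !fmorphV /= !rmorphXn /=.
by move: (cint _ _ _) => I; ring.
Qed.

Lemma tcoef_bound phi (r : R) : entire phi -> 0 < r -> exists K, forall n, nm (tcoef phi r n) * r ^+ n <= K.
Proof.
move=> ephi r0; have [M HM] := ccont_bounded pi2_ge0 (circle_ccont r ephi).
have pp : 0 < pi *+ 2 :> R by rewrite mulrn_wgt0 ?pi_gt0.
exists (2 * M) => n; rewrite /tcoef Normc.normcM normc_real ger0_norm; last first.
  by rewrite mulr_ge0 ?invr_ge0 ?exprn_ge0 ?ltW.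
rewrite mulrAC mulfVK ?gt_eqF ?exprn_gt0// ler_pdivrMl// mulrC.
apply: le_trans (cint_le (M := M) pi2_ge0 _ _) _; last by rewrite subr0.
  by apply: ccontM; [exact: circle_ccont|exact: uEX_ccont].
by move=> t ht; rewrite Normc.normcM normcX nm_uE expr1n mulr1 HM.
Qed.

Lemma geom_sum_le (x : R) (m N : nat) : 0 <= x -> x <= 2^-1 -> \sum_(m <= j < N) x ^+ j <= 2 * x ^+ m.
Proof.
move=> x0 x1; have [Nm|mN] := leqP N m.
  by rewrite big_geq// mulr_ge0// exprn_ge0.
rewrite -(subnK (ltnW mN)); set k := (N - m)%N.
suff : \sum_(m <= j < k + m) x ^+ j <= 2 * x ^+ m - 2 * x ^+ (k + m).
  by move=> /le_trans; apply; rewrite lerBlDr lerDl mulr_ge0// exprn_ge0.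
elim: k => [|k IH]; first by rewrite big_geq// subrr.
rewrite addSn big_nat_recr ?leq_addl//= exprS.
have : x * x ^+ (k + m) <= 2^-1 * x ^+ (k + m) by rewrite ler_wpM2r ?exprn_ge0.
move: IH; move: (\sum_(_ <= _ < _) _) (x ^+ (k + m)) (x ^+ m) (x * _) => p q s t.
lra.
Qed.

(** Strong induction: once the earlier coefficients vanish, evaluating at a point of modulus
    [x * rho] bounds [nm (b n) * rho ^+ n] by [2 * K * x], and [x] may be taken arbitrarily
    small. *)
Lemma coef_unique (b : nat -> C) (rho : R) K : 0 < rho ->
  (forall n, nm (b n) * rho ^+ n <= K) ->
  (forall a, nm a < rho -> (fun N => psum b N a : C^o) @ \oo --> (0 : C^o)) ->
  forall n, b n = 0.
Proof.
move=> rho0 HK H0; have K0 : 0 <= K by apply: le_trans (HK 0%N); rewrite expr0 mulr1 normc_ge0.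
elim/ltn_ind => n IH.
suff h : b n * (rho ^+ n)%:C = 0.
  have rn : (rho ^+ n)%:C != 0 :> C.
    by rewrite -(rmorph0 (real_complex R)) (inj_eq (@complexI R)) gt_eqF ?exprn_gt0.
  by apply: (mulIf rn); rewrite h mul0r.
(* Starting at [m = 1] ensures [x <= 1/2], as [geom_sum_le] requires. *)
apply: (@squeeze_nm0 _ (2 * K) 1) => m m1.
pose x : R := m.+1%:R^-1.
have x0 : 0 < x by rewrite invr_gt0.
have x2 : x <= 2^-1 by rewrite lef_pV2 ?posrE// ler_nat.
pose a : C := (x * rho)%:C.
have na : nm a = x * rho by rewrite normc_real gtr0_norm// mulr_gt0.
have ar : nm a < rho by rewrite na gtr_pMl//; apply: le_lt_trans x2 _; rewrite invf_lt1// ltr1n.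
have hb j : nm (b j * a ^+ j) <= K * x ^+ j.
  by rewrite Normc.normcM normcX na exprMn mulrCA mulrC ler_wpM2r ?exprn_ge0 ?(ltW x0)// mulrC.
have : nm (0 - b n * a ^+ n) <= K * (2 * x ^+ n.+1).
  apply: (cvgc_le (N := n.+1) (H0 _ ar)) => N nN.
  rewrite /psum (big_cat_nat (leq0n n.+1) nN)/= big_nat_recr//= big1_seq ?add0r; last first.
    by move=> j; rewrite mem_index_iota => /andP[_ /andP[_ jn]]; rewrite IH// mul0r.
  rewrite addrAC subrr add0r (le_trans (normc_sum _ _ _))//.
  apply: le_trans (ler_sum _ (fun j _ => hb j)) _.
  by rewrite -mulr_sumr ler_wpM2l// geom_sum_le// ltW.
rewrite sub0r normcN Normc.normcM normcX na exprMn => h.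
rewrite Normc.normcM normc_real ger0_norm ?exprn_ge0 ?(ltW rho0)//.
rewrite -(ler_pM2r (exprn_gt0 n x0)) -mulrA [rho ^+ n * _]mulrC (le_trans h)//.
by rewrite exprS -/x le_eqVlt; apply/orP; left; apply/eqP; ring.
Qed.

(** The coefficients computed on circles of different radii agree by uniqueness on the smaller disc;
    the estimate [tcoef_bound] at every radius is then a property of one sequence, which is
    [rapid]. *)
Lemma entire_psv phi : entire phi -> exists2 a, rapid a & phi = psv a.
Proof.
move=> ephi; pose a := tcoef phi 1.
have aE r n : 0 < r -> tcoef phi r n = a n.
  move=> r0; have [K1 H1] := tcoef_bound ephi r0; have [K2 H2] := tcoef_bound ephi ltr01.
  pose rho := Num.min r 1.
  have rho0 : 0 < rho by rewrite lt_min r0 ltr01.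
  apply/eqP; rewrite -subr_eq0; apply/eqP.
  apply: (@coef_unique (fun n => tcoef phi r n - a n) rho (K1 + K2) rho0) => [k|z].
    apply: (@le_trans _ _ ((nm (tcoef phi r k) + nm (a k)) * rho ^+ k)).
      by rewrite ler_wpM2r ?exprn_ge0 ?(ltW rho0)// (le_trans (le_normcD _ _))// normcN.
    rewrite mulrDl; apply: lerD; [apply: le_trans (H1 k)|apply: le_trans (H2 k)];
      by rewrite ler_wpM2l ?normc_ge0// lerXn2r ?nnegrE ?(ltW rho0) ?(ltW r0)// ge_min lexx ?orbT.
  rewrite lt_min => /andP[z1 z2].
  rewrite -(subrr (phi z)).
  apply: (cvgc_eq _ (cvgcB (tcoef_cvg ephi z1) (tcoef_cvg ephi z2))) => N.
  by rewrite /psum -sumrB; apply: eq_bigr => k _; rewrite mulrBl.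
have ra : rapid a.
  by move=> r r0; have [K HK] := tcoef_bound ephi r0; exists K => n; rewrite -(aE r).
exists a => //; apply/funext => z; apply/esym/psv_eq.
have z1 : nm z < nm z + 1 by rewrite ltrDl.
have := tcoef_cvg ephi z1.
by have -> : tcoef phi (nm z + 1) = a by apply/funext => n; rewrite aE// ltr_wpDl ?normc_ge0.
Qed.

End Taylor.

(** * The tridiagonal model *)

Section FockSequences.
Context {R : realType}.
Local Notation C := R[i].
Local Notation nm := Normc.normc.
Implicit Types (a b : nat -> C).

Definition us a n : R := n`!%:R * nm (a n) ^+ 2.
Definition ps a N : R := \sum_(0 <= n < N) us a n.
Definition ffin a := exists B, forall N, ps a N <= B.
(** The squared norm [fock a] as a real number, to be used under [ffin a]. *)
Definition fn a : R := limn (ps a).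

Lemma us_ge0 a n : 0 <= us a n.
Proof. by rewrite mulr_ge0 ?sqr_ge0. Qed.

Lemma ps_nd a N M : (N <= M)%N -> ps a N <= ps a M.
Proof.
by move=> NM; rewrite /ps (big_cat_nat (leq0n N) NM)//= lerDl sumr_ge0// => n _; exact: us_ge0.
Qed.

Lemma ps_ge0 a N : 0 <= ps a N.
Proof. by rewrite sumr_ge0// => n _; exact: us_ge0. Qed.

Lemma ffin_cvg a : ffin a -> ps a @ \oo --> fn a.
Proof.
move=> [B HB]; apply: nondecreasing_is_cvgn; first by move=> N M; exact: ps_nd.
by exists B => _ [N _ <-]; exact: HB.
Qed.

Lemma ps_le_fn a N : ffin a -> ps a N <= fn a.
Proof.
move=> fa; apply: (ler_cvg_to (cvg_cst (ps a N)) (ffin_cvg fa)).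
by exists N => // M /= NM; exact: ps_nd.
Qed.

Lemma fn_ge0 a : ffin a -> 0 <= fn a.
Proof. by move=> fa; apply: le_trans (ps_le_fn 0 fa); exact: ps_ge0. Qed.

Lemma fn_le a B : (forall N, ps a N <= B) -> fn a <= B.
Proof.
move=> HB; apply: (ler_cvg_to (ffin_cvg _) (cvg_cst B)); first by exists B.
exact: nearW.
Qed.

Lemma fock_fn a : ffin a -> fock a = (fn a)%:E.
Proof.
move=> fa; apply/cvg_lim => //.
under eq_fun do rewrite -/(us a _) sumEFin.
by apply: cvg_EFin; [exact: nearW|exact: ffin_cvg].
Qed.

Lemma fock_ffin a : (fock a < +oo)%E -> ffin a.
Proof.
move=> fa; have fa0 : (0 <= fock a)%E.
  by apply: nneseries_ge0 => n _ _; rewrite lee_fin us_ge0.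
exists (fine (fock a)) => N; rewrite -lee_fin fineK ?ge0_fin_numE//.
rewrite /ps -sumEFin; apply: nneseries_lim_ge => n _ _.
by rewrite lee_fin us_ge0.
Qed.

Lemma us_le_fn a n : ffin a -> us a n <= fn a.
Proof.
move=> fa; apply: le_trans (ps_le_fn n.+1 fa).
by rewrite /ps big_nat_recr//= lerDr ps_ge0.
Qed.

Lemma nm_le_fn a n : ffin a -> nm (a n) ^+ 2 <= fn a.
Proof.
move=> fa; apply: le_trans (us_le_fn n fa).
by rewrite /us ler_peMl ?sqr_ge0// ler1n fact_gt0.
Qed.

(** By the inequality between the two means, [nm (a n) * r ^+ n] is at most
    [us a n + (r ^+ 2) ^+ n / n!], and the last term is at most [expR (r ^+ 2)]. A sequence of
    finite norm is thus the Taylor sequence of an entire function. *)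
Lemma ffin_rapid a : ffin a -> rapid a.
Proof.
move=> fa r r0; exists (fn a + expR (r ^+ 2)) => n.
have h1 : nm (a n) * r ^+ n <= us a n + (r ^+ 2) ^+ n / n`!%:R.
  have f0 : 0 < n`!%:R :> R by rewrite ltr0n fact_gt0.
  rewrite -(ler_pM2l f0) mulrDr [_ * (_ / _)]mulrCA mulfV ?gt_eqF// mulr1.
  have -> : (r ^+ 2) ^+ n = (r ^+ n) ^+ 2 by rewrite -!exprM mulnC.
  have : 0 <= (n`!%:R * nm (a n) - r ^+ n) ^+ 2 by exact: sqr_ge0.
  have : 0 <= n`!%:R * nm (a n) * r ^+ n by rewrite !mulr_ge0 ?normc_ge0 ?exprn_ge0 ?ltW.
  rewrite /us; move: (nm (a n)) (r ^+ n) (n`!%:R) => x y f; nra.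
apply: le_trans h1 _; apply: lerD; first exact: us_le_fn.
case: n => [|n]; first by rewrite expr0 fact0 divr1 -expR0 ler_expR sqr_ge0.
by have := @expR_ge1Dxn R (r ^+ 2) n (sqr_ge0 _); apply: le_trans; rewrite lerDr.
Qed.

Lemma nm2D (x y : C) : nm (x + y) ^+ 2 <= 2 * nm x ^+ 2 + 2 * nm y ^+ 2.
Proof.
have h := le_normcD x y; have := normc_ge0 (x + y); have := normc_ge0 x; have := normc_ge0 y.
move=> y0 x0 z0; have h2 : nm (x + y) ^+ 2 <= (nm x + nm y) ^+ 2.
  by rewrite lerXn2r ?nnegrE ?addr_ge0.
have := sqr_ge0 (nm x - nm y); move: h2; move: (nm (x + y)) (nm x) (nm y) => p q r.
lra.
Qed.

Lemma psD a b N : ps (fun n => a n + b n) N <= 2 * ps a N + 2 * ps b N.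
Proof.
rewrite /ps !mulr_sumr -big_split/=; apply: ler_sum => n _.
move: (ler_wpM2l (ler0n R n`!) (nm2D (a n) (b n))); rewrite /us.
move: (nm _) (nm _) (nm _) (n`!%:R) => p q r f; lra.
Qed.

Lemma psZ (c : C) a N : ps (fun n => c * a n) N = nm c ^+ 2 * ps a N.
Proof.
by rewrite /ps mulr_sumr; apply: eq_bigr => n _; rewrite /us Normc.normcM exprMn mulrCA.
Qed.

Lemma ffinD a b : ffin a -> ffin b -> ffin (fun n => a n + b n).
Proof.
move=> fa fb; exists (2 * fn a + 2 * fn b) => N; apply: le_trans (psD _ _ _) _.
by apply: lerD; rewrite ler_wpM2l// ps_le_fn.
Qed.

Lemma fnD a b : ffin a -> ffin b -> fn (fun n => a n + b n) <= 2 * fn a + 2 * fn b.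
Proof.
move=> fa fb; apply: fn_le => N; apply: le_trans (psD _ _ _) _.
by apply: lerD; rewrite ler_wpM2l// ps_le_fn.
Qed.

Lemma ffinZ (c : C) a : ffin a -> ffin (fun n => c * a n).
Proof.
by move=> fa; exists (nm c ^+ 2 * fn a) => N; rewrite psZ ler_wpM2l ?sqr_ge0// ps_le_fn.
Qed.

Lemma fnZ (c : C) a : ffin a -> fn (fun n => c * a n) <= nm c ^+ 2 * fn a.
Proof.
by move=> fa; apply: fn_le => N; rewrite psZ ler_wpM2l ?sqr_ge0// ps_le_fn.
Qed.

Lemma us_le_ffin (K : R) a b : (forall n, nm (b n) ^+ 2 <= K * nm (a n) ^+ 2) ->
  ffin a -> ffin b /\ fn b <= K * fn a.
Proof.
move=> H fa.
(* A negative [K] forces [a = 0], and the bound then reads 0. *)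
have K0 : (0 <= K) \/ (forall n, us a n = 0).
  have [K0|K0] := leP 0 K; [by left|right => n].
  have : nm (a n) ^+ 2 = 0.
    apply/eqP; rewrite eq_le sqr_ge0 andbT.
    by have := le_trans (sqr_ge0 _) (H n); rewrite nmulr_rge0.
  by rewrite /us => ->; rewrite mulr0.
have hp N : ps b N <= K * fn a.
  apply: (@le_trans _ _ (K * ps a N)).
    rewrite /ps mulr_sumr; apply: ler_sum => n _.
    move: (ler_wpM2l (ler0n R n`!) (H n)); rewrite /us.
    move: (nm _) (nm _) (n`!%:R) => p q f; lra.
  case: K0 => [K0|a0]; first by rewrite ler_wpM2l// ps_le_fn.
  have p0 M : ps a M = 0 by rewrite /ps big1.
  by rewrite p0 /fn (_ : ps a = fun=> 0) ?lim_cst//; exact/funext.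
by split; [exists (K * fn a)|exact: fn_le].
Qed.

Lemma ffin_eq0 a : ffin a -> fn a <= 0 -> forall n, a n = 0.
Proof.
move=> fa a0 n; apply: Normc.eq0_normc; apply/eqP; rewrite -sqrf_eq0 eq_le sqr_ge0 andbT.
exact: le_trans (nm_le_fn n fa) a0.
Qed.

Lemma ffin_fin a K : (forall n, (K <= n)%N -> a n = 0) -> ffin a.
Proof.
move=> a0; exists (ps a K) => N; have [NK|/ltnW KN] := leqP N K; first exact: ps_nd.
rewrite /ps (big_cat_nat (leq0n K) KN)/= [X in _ + X]big1_seq ?addr0//.
move=> n; rewrite mem_index_iota => /andP[_ /andP[Kn _]].
by rewrite /us a0// Normc.normc0 expr0n mulr0.
Qed.

Definition trunc a N n : C := if (n < N)%N then a n else 0.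

Lemma fn_tail a : ffin a -> fn (fun n => trunc a N n - a n) @[N --> \oo] --> 0.
Proof.
move=> fa.
have ub N : fn (fun n => trunc a N n - a n) <= fn a - ps a N.
  apply: fn_le => M; rewrite lerBrDr addrC.
  apply: le_trans (ps_le_fn (maxn N M) fa).
  apply: (@le_trans _ _ (ps a N + ps (fun n => trunc a N n - a n) (maxn N M))).
    by rewrite lerD2l ps_nd// leq_maxr.
  rewrite /ps !(big_cat_nat (leq0n N) (leq_maxl N M))/=.
  rewrite [X in _ + (X + _) <= _]big1_seq ?add0r.
    rewrite lerD2l le_eqVlt; apply/orP; left; apply/eqP; apply: eq_big_nat => n /andP[Nn _].
    by rewrite /us /trunc ltnNge Nn/= sub0r normcN.
  move=> n; rewrite mem_index_iota => /andP[_ /andP[_ nN]].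
  by rewrite /us /trunc nN subrr Normc.normc0 expr0n mulr0.
apply: (@squeeze_cvgr _ _ _ _ (fun=> 0) (fun N => fn a - ps a N)); last 2 first.
- exact: cvg_cst.
- by rewrite -(subrr (fn a)); apply: cvgB; [exact: cvg_cst|exact: ffin_cvg].
apply: nearW => N; rewrite ub andbT fn_ge0//.
apply: ffinD; last by have := ffinZ (-1) fa; under eq_fun do rewrite mulN1r.
by apply: (@ffin_fin _ N) => n Nn; rewrite /trunc ltnNge Nn.
Qed.

Lemma ps_cvg (A : nat -> nat -> C) a N :
  (forall n, (fun k => A k n : C^o) @ \oo --> (a n : C^o)) ->
  ps (A k) N @[k --> \oo] --> ps a N.
Proof.
move=> H; rewrite /ps; elim: N => [|n IH].
  by under eq_fun do rewrite big_geq//; rewrite big_geq//; exact: cvg_cst.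
under eq_fun do rewrite big_nat_recr//=; rewrite big_nat_recr//=; apply: cvgD => //.
rewrite /us; apply: cvgMl_tmp.
have /cvgc_ReImP[h1 h2] := H n.
rewrite normc_sqr; under eq_fun do rewrite normc_sqr.
by apply: cvgD; apply: cvgM.
Qed.

(** Lower semicontinuity of the norm under coordinatewise limits; it is what puts limits of bounded
    approximations back into a domain. *)
Lemma fn_lim_le (A : nat -> nat -> C) a B :
  (forall n, (fun k => A k n : C^o) @ \oo --> (a n : C^o)) ->
  (forall N, \forall k \near \oo, ps (A k) N <= B) -> ffin a /\ fn a <= B.
Proof.
move=> H HB; have h N : ps a N <= B.
  exact: (ler_cvg_to (ps_cvg (N := N) H) (cvg_cst B) (HB N)).
by split; [exists B|exact: fn_le].
Qed.

End FockSequences.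

(** * The matrix of the operator and its weighted estimates *)

Section Tridiagonal.
Context {R : realType}.
Local Notation C := R[i].
Local Notation nm := Normc.normc.
Implicit Types (a b : nat -> C).
Variables mu lam lam' : R.

(** The action of [A^* (A + A^* ) A] on Taylor coefficients: the entry [n] receives
    [(n + 1) n a_(n+1) + (n - 1) a_(n-1)]. *)
Definition hB a n : C := (n.+1%:R * n%:R) * a n.+1 + (if n is m.+1 then m%:R * a m else 0).
Definition s2 a n : C := (n%:R * n.-1%:R) * a n.
Definition hml a n : C := (mu * n%:R)%:C * a n + (0 +i* lam) * hB a n.
Definition hfull a n : C := lam'%:C * s2 a n + hml a n.
Definition dd (be : R) (n : nat) : R := lam' * (n%:R * n.-1%:R) + mu * n%:R + be.
Definition opD be a n : C := (dd be n)%:C * a n.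
Definition opT be a n : C := hfull a n + be%:C * a n.

Lemma natC (n : nat) : (n%:R : R)%:C = n%:R :> C.
Proof. exact: rmorph_nat. Qed.

Lemma opTE be a n : opT be a n = opD be a n + (0 +i* lam) * hB a n.
Proof. by rewrite /opT /hfull /hml /opD /dd /s2 !rmorphD !rmorphM /= !natC; ring. Qed.

Lemma nm_ilam : nm (0 +i* lam : C) = `|lam|.
Proof. by rewrite /= expr0n add0r sqrtr_sqr. Qed.

Lemma hBD a b n : hB (fun n => a n + b n) n = hB a n + hB b n.
Proof. by case: n => [|n]; rewrite /hB; ring. Qed.
Lemma hBZ (c : C) a n : hB (fun n => c * a n) n = c * hB a n.
Proof. by case: n => [|n]; rewrite /hB; ring. Qed.
Lemma opTD be a b n : opT be (fun n => a n + b n) n = opT be a n + opT be b n.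
Proof. by rewrite !opTE hBD /opD; ring. Qed.
Lemma opTZ be (c : C) a n : opT be (fun n => c * a n) n = c * opT be a n.
Proof. by rewrite !opTE hBZ /opD; ring. Qed.

Lemma shift_up (A : nat -> R) N : (forall n, 0 <= A n) ->
  \sum_(0 <= n < N) A n.+1 <= \sum_(0 <= n < N.+1) A n.
Proof. by move=> A0; rewrite [leRHS]big_nat_recl// lerDr. Qed.

Lemma sum_nat_recr (A : nat -> R) N : (forall n, 0 <= A n) ->
  \sum_(0 <= n < N) A n <= \sum_(0 <= n < N.+1) A n.
Proof. by move=> A0; rewrite [leRHS]big_nat_recr//= lerDl. Qed.

Lemma shift_down (A : nat -> R) N : (forall n, 0 <= A n) ->
  \sum_(0 <= n < N) (if n is m.+1 then A m else 0) <= \sum_(0 <= n < N) A n.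
Proof.
move=> A0; case: N => [|N]; first by rewrite !big_geq.
by rewrite big_nat_recl// add0r; exact: sum_nat_recr.
Qed.

(* [n! (n+1) = (n+1)!], so the shift costs only a factor [m + 1] at index [m]. *)
Lemma ps_hB a N : ps (hB a) N <= \sum_(0 <= m < N.+1) 4 * ((m%:R + 1) * m%:R ^+ 2) * us a m.
Proof.
(* [A] and [B] are indexed by the coefficient they involve: [A n.+1] bounds the contribution of
   [a n.+1] to the entry [n], and [B m] that of [a m] to the entry [m.+1]. *)
pose A (n : nat) := 2 * ((n%:R * n.-1%:R ^+ 2) * us a n).
pose B (n : nat) := 2 * (((n%:R + 1) * n%:R ^+ 2) * us a n).
have step n : us (hB a) n <= A n.+1 + (if n is m.+1 then B m else 0).
  rewrite /us /hB; case: n => [|n].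
    by rewrite !mulr0 !mul0r addr0 Normc.normc0 expr0n/= /A /= mulr0 expr0n/= mulr0 mul0r !mulr0 addr0.
  have := nm2D ((n.+2%:R * n.+1%:R) * a n.+2) (n%:R * a n : C).
  rewrite !Normc.normcM !normc_nat => h.
  have := ler_wpM2l (ler0n R n.+1`!) h; rewrite /A /B /us /=.
  rewrite [n.+2`!]factS [n.+1`!]factS [(n.+2 * _)%N]mulnC !natrM -[n.+2%:R]natr1 -[n.+1%:R]natr1.
  by move: (nm _) (nm _) (nm _) (n`!%:R) (n%:R) => x y z f k; lra.
have A0 m : 0 <= A m by rewrite /A mulr_ge0// mulr_ge0 ?us_ge0// mulr_ge0 ?sqr_ge0.
have B0 m : 0 <= B m by rewrite /B mulr_ge0// mulr_ge0 ?us_ge0// mulr_ge0 ?sqr_ge0// addr_ge0.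
apply: le_trans (ler_sum _ (fun n _ => step n)) _; rewrite big_split/=.
apply: le_trans (lerD (shift_up N A0) (le_trans (shift_down N B0) (sum_nat_recr N B0))) _.
rewrite -big_split/=; apply: ler_sum => -[|m] _.
  by rewrite /A /B /= expr0n/= !(mulr0, mul0r) addr0.
rewrite /A /B /= -[m.+1%:R]natr1; have k0 : 0 <= m%:R :> R by [].
have := us_ge0 a m.+1; move: (us _ _) (m%:R) k0 => u k k0 u0.
have : 0 <= (k + 1) * (3 * k + 2) * u by rewrite mulr_ge0// mulr_ge0 ?addr_ge0 ?mulr_ge0.
lra.
Qed.

(** Partial sums of the quadratic form of [S2]. *)
Definition Gs a N : R := \sum_(0 <= m < N) (m%:R * m.-1%:R) * us a m.

Lemma Gs_nd a N M : (N <= M)%N -> Gs a N <= Gs a M.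
Proof.
move=> NM; rewrite /Gs (big_cat_nat (leq0n N) NM)//= lerDl sumr_ge0// => n _.
by rewrite mulr_ge0 ?us_ge0// mulr_ge0.
Qed.

(** Either [m - 1] is at most [1 / de], or [de * (m - 1)] is at least 1 and the quadratic term alone
    dominates. *)
Lemma nat_le_quad (de : R) (m : nat) : 0 < de -> m%:R <= de * (m%:R * m.-1%:R) + (1 + de^-1).
Proof.
move=> de0; have dV : 0 < de^-1 by rewrite invr_gt0.
case: m => [|k]; first by rewrite mul0r mulr0 add0r addr_ge0 ?ltW.
rewrite /= -natr1; have k0 : 0 <= k%:R :> R by []; move: (k%:R) k0 => x x0.
have dd1 : de * de^-1 = 1 by rewrite mulfV ?gt_eqF.
have [xd|xd] := leP x de^-1.
  have : 0 <= de * ((x + 1) * x) by rewrite mulr_ge0 ?(ltW de0)// mulr_ge0 ?addr_ge0.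
  lra.
have : 0 <= de * (x + 1) * (x - de^-1).
  by rewrite mulr_ge0 ?subr_ge0 ?(ltW xd)// mulr_ge0 ?addr_ge0 ?(ltW de0).
by have -> : de * (x + 1) * (x - de^-1) = de * ((x + 1) * x) - (x + 1) * (de * de^-1); [ring|rewrite dd1; lra].
Qed.

(** A weighted Cauchy-Schwarz inequality puts a small multiple of [n (n - 1)] on the upper neighbour
    and a large multiple of [n] on the lower one; [nat_le_quad] then absorbs all the linear terms.
    The range grows to [N.+1] because the last row reaches one coefficient further. *)
Lemma form_bound (eps : R) : 0 < eps -> exists2 K, 0 < K & forall a N,
  \sum_(0 <= n < N) n`!%:R * (nm (hml a n) * nm (a n)) <= eps * Gs a N.+1 + K * ps a N.+1.
Proof.
(* [ga] makes [|lam| * ga <= eps / 2]; below, [de] makes [L * de <= eps / 2], where [L] collects the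
   linear terms. *)
move=> e0; pose ga := eps / (2 * (`|lam| + 1)).
have l1 : 0 < `|lam| + 1 by rewrite ltr_wpDl.
have ga0 : 0 < ga by rewrite divr_gt0// mulr_gt0.
have gaV : 0 < ga^-1 by rewrite invr_gt0.
pose L := `|mu| + `|lam| * ga^-1.
have L0 : 0 <= L by rewrite addr_ge0// mulr_ge0// ltW.
pose de := eps / (2 * (L + 1)).
have L1 : 0 < L + 1 by rewrite ltr_wpDl.
have de0 : 0 < de by rewrite divr_gt0// mulr_gt0.
exists (L * (1 + de^-1) + 1).
  by rewrite ltr_wpDl// mulr_ge0// addr_ge0// invr_ge0 ltW.
move=> a N.
(* The coupling of [n] and [n.+1]. Since [(n+1)! n = n! (n+1) n], it is the same seen from either of
   the two rows. *)
pose v n : R := n`!%:R * (n.+1%:R * n%:R * (nm (a n.+1) * nm (a n))).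
have v0 n : 0 <= v n by rewrite /v !mulr_ge0 ?normc_ge0.
have step n : n`!%:R * (nm (hml a n) * nm (a n)) <=
    `|mu| * (n%:R * us a n) + `|lam| * (v n + (if n is m.+1 then v m else 0)).
  have h1 : nm (hml a n) <= `|mu| * n%:R * nm (a n) + `|lam| * nm (hB a n).
    rewrite /hml (le_trans (le_normcD _ _))// !Normc.normcM nm_ilam normc_real normrM.
    by rewrite (ger0_norm (ler0n R n)).
  have h2 : n`!%:R * (nm (hB a n) * nm (a n)) <= v n + (if n is m.+1 then v m else 0).
    rewrite /hB /v; case: n {h1} => [|n].
      rewrite (_ : _ + 0 = 0 :> C); last by ring.
      by rewrite Normc.normc0 !(mul0r, mulr0, addr0).
    have := le_normcD ((n.+2%:R * n.+1%:R) * a n.+2) (n%:R * a n : C).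
    rewrite !Normc.normcM !normc_nat => h.
    have := ler_wpM2r (normc_ge0 (a n.+1)) h.
    move=> /(ler_wpM2l (ler0n R n.+1`!)); rewrite factS natrM.
    by move: (nm _) (nm _) (nm _) (nm _) (n`!%:R) => x y z w f; lra.
  have := ler_wpM2r (normc_ge0 (a n)) h1 => /(ler_wpM2l (ler0n R n`!)).
  have := ler_wpM2l (normr_ge0 lam) h2; rewrite /us.
  by move: (nm (hml a n)) (nm (hB a n)) (nm (a n)) (n`!%:R) (v n + _) => x y z f g; lra.
have vb n : 2 * v n <= ga * (n.+1%:R * n%:R * us a n.+1) + ga^-1 * (n%:R * us a n).
  have E : ga * (n.+1%:R * n%:R * us a n.+1) + ga^-1 * (n%:R * us a n) - 2 * v n =
     n`!%:R * n%:R * ga * (n.+1%:R * nm (a n.+1) - ga^-1 * nm (a n)) ^+ 2.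
    rewrite /us /v factS natrM.
    have gn : ga != 0 by rewrite gt_eqF.
    by move: (nm _) (nm _) (n`!%:R) (n.+1%:R) (n%:R) => x y f p k; field.
  by rewrite -subr_ge0 E mulr_ge0 ?sqr_ge0// mulr_ge0 ?(ltW ga0)// mulr_ge0.
pose u1 n : R := n%:R * us a n.
have u10 n : 0 <= u1 n by rewrite mulr_ge0 ?us_ge0.
pose g n : R := n%:R * n.-1%:R * us a n.
have g0 n : 0 <= g n by rewrite mulr_ge0 ?us_ge0// mulr_ge0.
have S1 : 2 * \sum_(0 <= n < N) v n <= ga * Gs a N.+1 + ga^-1 * \sum_(0 <= n < N.+1) u1 n.
  rewrite mulr_sumr; apply: le_trans (ler_sum _ (fun n _ => vb n)) _.
  rewrite big_split/= -!mulr_sumr; apply: lerD.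
    by rewrite ler_wpM2l ?(ltW ga0)//; exact: (shift_up N g0).
  by rewrite ler_wpM2l ?(ltW gaV)//; exact: (sum_nat_recr N u10).
have S2 : \sum_(0 <= n < N.+1) u1 n <= de * Gs a N.+1 + (1 + de^-1) * ps a N.+1.
  rewrite /Gs /ps !mulr_sumr -big_split/=; apply: ler_sum => n _.
  have := ler_wpM2r (us_ge0 a n) (nat_le_quad n de0); rewrite /u1; lra.
apply: le_trans (ler_sum _ (fun n _ => step n)) _.
rewrite big_split/= -!mulr_sumr big_split/=.
have S3 := shift_down N v0; have S4 := sum_nat_recr N u10.
have S5 : `|lam| * (\sum_(0 <= n < N) v n + \sum_(0 <= n < N) (if n is m.+1 then v m else 0)) <=
   `|lam| * (ga * Gs a N.+1 + ga^-1 * \sum_(0 <= n < N.+1) u1 n).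
  by rewrite ler_wpM2l//; lra.
have S6 : `|mu| * \sum_(0 <= n < N) u1 n <= `|mu| * \sum_(0 <= n < N.+1) u1 n by rewrite ler_wpM2l.
have S7 := ler_wpM2l L0 S2.
have G0 : 0 <= Gs a N.+1 by apply: sumr_ge0 => m _; exact: g0.
have P0 := ps_ge0 a N.+1.
have c1 : `|lam| * ga * Gs a N.+1 <= eps / 2 * Gs a N.+1.
  rewrite ler_wpM2r// /ga mulrA ler_pdivrMr ?mulr_gt0//.
  by move: (`|lam|) => l; lra.
have c2 : L * de * Gs a N.+1 <= eps / 2 * Gs a N.+1.
  rewrite ler_wpM2r// /de mulrA ler_pdivrMr ?mulr_gt0//.
  by move: (L) => l; lra.
move: S5 S6 S7 c1 c2 G0 P0; rewrite /L; move: (\sum_(0 <= n < N.+1) u1 n) (\sum_(0 <= n < N) u1 n) (_ + \sum_(0 <= n < N) _) (Gs _ _) (ps _ _) => x y z G P.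
lra.
Qed.

(** The comparison is [4 (m + 1) m^2 <= 12 (m^2 (m - 1)^2 + 1)]; the added 1 takes care of [m = 1],
    where the quartic term vanishes. *)
Lemma ffin_hB_s2 a : ffin a -> ffin (s2 a) -> ffin (hB a).
Proof.
move=> fa fs; exists (12 * (fn (s2 a) + fn a)) => N; apply: le_trans (ps_hB a N) _.
apply: (@le_trans _ _ (12 * (ps (s2 a) N.+1 + ps a N.+1))); last first.
  by rewrite ler_wpM2l// lerD// ps_le_fn.
rewrite /ps -big_split/= mulr_sumr; apply: ler_sum => m _.
have -> : us (s2 a) m = (m%:R * m.-1%:R) ^+ 2 * us a m.
  by rewrite /us /s2 !Normc.normcM !normc_nat; ring.
have u0 := us_ge0 a m; case: m u0 => [|[|k]] u0; rewrite /=.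
- by rewrite mul0r !expr0n/= !(mulr0, mul0r) add0r mulr_ge0.
- lra.
have k0 : 0 <= k%:R :> R by []; rewrite -[k.+2%:R]natr1 -[k.+1%:R]natr1.
move: (us _ _) u0 (k%:R) k0 => u u0 x x0.
have : 0 <= (x + 2) ^+ 2 * (3 * x ^+ 2 + 5 * x) * u.
  by rewrite mulr_ge0// mulr_ge0 ?sqr_ge0// addr_ge0 ?mulr_ge0 ?sqr_ge0.
lra.
Qed.

(* The lower bounds on the diagonal that make the off-diagonal part relatively
   small, of relative norm at most 1/2. *)
Definition dominant be := forall m : nat,
  [/\ 16 * lam ^+ 2 * ((m%:R + 1) * m%:R ^+ 2) <= dd be m ^+ 2,
      1 <= `|dd be m| & `|lam'| * (m%:R * m.-1%:R) <= 2 * `|dd be m|].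

(** If [m - 1 >= 3 / eta], the quartic term dominates through [m + 1 <= 3 (m - 1)], valid for
    [m >= 2]. Otherwise both [m] and [m + 1] are at most [t], and [t ^+ 3] bounds the left side; the
    2 in [t] also covers [m = 1]. *)
Lemma cube_le_quartic (eta : R) : 0 < eta -> exists2 K, 0 <= K &
  forall m : nat, (m%:R + 1) * m%:R ^+ 2 <= eta * (m%:R * m.-1%:R) ^+ 2 + K.
Proof.
move=> e0; have V0 : 0 < eta^-1 by rewrite invr_gt0.
pose t := 2 + 3 * eta^-1.
have t0 : 0 <= t by rewrite addr_ge0// mulr_ge0// ltW.
exists (t ^+ 3); first by rewrite exprn_ge0.
move=> [|[|k]] /=.
- by rewrite expr0n/= !mulr0 expr0n/= mulr0 add0r exprn_ge0.
- rewrite mulr0 expr0n/= mulr0 add0r expr1n mulr1.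
  have : 2 <= t by rewrite lerDl mulr_ge0// ltW.
  move=> h; have : 2 ^+ 3 <= t ^+ 3 by rewrite lerXn2r ?nnegrE.
  lra.
rewrite -[k.+2%:R]natr1 -[k.+1%:R]natr1; have k0 : 0 <= k%:R :> R by [].
move: (k%:R) k0 => x x0.
have [h|h] := leP (3 * eta^-1) (x + 1).
  have h1 : 3 <= eta * (x + 1).
    by have := ler_wpM2l (ltW e0) h; rewrite mulrCA mulfV ?gt_eqF// mulr1.
  have p3 : 0 <= t ^+ 3 by rewrite exprn_ge0.
  have h2 := ler_wpM2l (_ : 0 <= (x + 1) * (x + 2) ^+ 2) h1.
  have : 0 <= (x + 1) * (x + 2) ^+ 2 by rewrite mulr_ge0 ?sqr_ge0 ?addr_ge0.
  move=> /[dup] hh /h2 {}h2.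
  have : 0 <= 2 * x * (x + 2) ^+ 2 by rewrite mulr_ge0 ?sqr_ge0 ?mulr_ge0.
  lra.
have ht : x + 2 <= t by rewrite /t; lra.
have hx : (x + 1 + 1 + 1) * (x + 1 + 1) ^+ 2 <= t ^+ 3.
  rewrite [t ^+ 3]exprS; apply: ler_pM; rewrite ?addr_ge0 ?sqr_ge0//.
    by rewrite /t; lra.
  by rewrite lerXn2r ?nnegrE// ?addr_ge0//; lra.
by apply: le_trans hx _; rewrite lerDr mulr_ge0 ?sqr_ge0 ?(ltW e0).
Qed.

(** Giving [be] the sign of [lam'] makes the quadratic term and [be] add up in absolute value, so
    that [mu * m] can only consume half of the quadratic term and a constant. *)
Lemma exists_dominant : lam' != 0 -> exists be, dominant be.
Proof.
move=> l0; have L0 : 0 < `|lam'| by rewrite normr_gt0.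
pose de := `|lam'| / (2 * (`|mu| + 1)).
have m1 : 0 < `|mu| + 1 by rewrite ltr_wpDl.
have de0 : 0 < de by rewrite divr_gt0// mulr_gt0.
pose c1 := `|mu| * (1 + de^-1).
have c10 : 0 <= c1 by rewrite mulr_ge0// addr_ge0// invr_ge0 ltW.
pose q := 16 * lam ^+ 2.
have q0 : 0 <= q by rewrite mulr_ge0 ?sqr_ge0.
(* Chosen so that [q * eta <= (|lam'| / 2)^2], the part of the square of the diagonal that remains
   available. *)
pose eta := `|lam'| ^+ 2 / (4 * (q + 1)).
have q1 : 0 < q + 1 by rewrite ltr_wpDl.
have eta0 : 0 < eta by rewrite divr_gt0 ?exprn_gt0 ?mulr_gt0.
have [K K0 HK] := cube_le_quartic eta0.
(* [c1] pays for the term in [mu], 1 for the lower bound on the diagonal, and [q * K] for the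
   finitely many indices at which the quartic term is too small. *)
pose b := c1 + 1 + q * K.
have b0 : 0 <= b by rewrite /b !addr_ge0// mulr_ge0.
exists (Num.sg lam' * b) => m.
pose x : R := m%:R * m.-1%:R.
have x0 : 0 <= x by rewrite mulr_ge0.
have lo : `|lam'| / 2 * x + 1 + q * K <= `|dd (Num.sg lam' * b) m|.
  have -> : dd (Num.sg lam' * b) m = Num.sg lam' * (`|lam'| * x + b) + mu * m%:R.
    by rewrite /dd -/x {1}[lam']numEsg; ring.
  have h1 : `|mu * m%:R| <= `|lam'| / 2 * x + c1.
    rewrite normrM (ger0_norm (ler0n R m)).
    apply: le_trans (ler_wpM2l (normr_ge0 mu) (nat_le_quad m de0)) _.
    rewrite mulrDr -/c1 lerD2r -/x mulrA ler_wpM2r//.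
    rewrite /de mulrA ler_pdivrMr ?mulr_gt0//.
    by move: (`|mu|) (`|lam'|) L0 => p l l1; lra.
  have h2 : `|Num.sg lam' * (`|lam'| * x + b)| = `|lam'| * x + b.
    by rewrite normrM normr_sg l0 mul1r ger0_norm// addr_ge0// mulr_ge0.
  have := lerB_normD (Num.sg lam' * (`|lam'| * x + b)) (mu * m%:R); rewrite h2.
  by move: h1; rewrite /b; lra.
have qK : 0 <= q * K by rewrite mulr_ge0.
have lx : 0 <= `|lam'| / 2 * x by rewrite mulr_ge0// divr_ge0.
split.
- rewrite -/q -[dd _ _ ^+ 2]real_normK ?num_real//.
  apply: (@le_trans _ _ ((`|lam'| / 2 * x + 1 + q * K) ^+ 2)); last first.
    by rewrite lerXn2r ?nnegrE// ?addr_ge0//.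
  apply: le_trans (ler_wpM2l q0 (HK m)) _; rewrite -/x.
  have h3 : q * (eta * x ^+ 2) <= (`|lam'| / 2 * x) ^+ 2.
    have -> : (`|lam'| / 2 * x) ^+ 2 = (`|lam'| / 2) ^+ 2 * x ^+ 2 by ring.
    have -> : q * (eta * x ^+ 2) = (q * eta) * x ^+ 2 by ring.
    rewrite ler_wpM2r ?sqr_ge0// /eta mulrA ler_pdivrMr ?mulr_gt0//.
    have -> : (`|lam'| / 2) ^+ 2 * (4 * (q + 1)) = `|lam'| ^+ 2 * (q + 1) by field.
    by rewrite mulrC ler_wpM2l ?sqr_ge0// lerDl.
  rewrite mulrDr; move: h3 lx qK; move: (_ / 2 * x) (q * K) (q * (_ * _)) => u v w.
  move=> h3 u0 v0.
  have : 0 <= u * v by rewrite mulr_ge0.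
  have : 0 <= v ^+ 2 by rewrite sqr_ge0.
  nra.
- by apply: le_trans lo; lra.
- by rewrite -/x; move: lo; lra.
Qed.

End Tridiagonal.

(** * A priori estimate and Neumann series *)

Section Resolvent.
Context {R : realType}.
Local Notation C := R[i].
Local Notation nm := Normc.normc.
Implicit Types (a b x : nat -> C).
Variables mu lam lam' be : R.
Hypothesis dom : dominant mu lam lam' be.
Local Notation d := (dd mu lam' be).
Local Notation D := (opD mu lam' be).
Local Notation T := (opT mu lam lam' be).
Local Notation B := (fun a n => (0 +i* lam) * hB a n).

Lemma opT_DB a : T a = (fun n => D a n + B a n).
Proof. by apply/funext => n; rewrite opTE. Qed.

Lemma nm_opD a n : nm (D a n) ^+ 2 = d n ^+ 2 * nm (a n) ^+ 2.
Proof. by rewrite /opD Normc.normcM exprMn normc_real real_normK ?num_real. Qed.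

(** For squared norms, 1/4 expresses relative bound 1/2: the 4 of [ps_hB] against the 16 of
    [dominant]. *)
Lemma ps_B_le a N : ps (B a) N <= 4^-1 * ps (D a) N.+1.
Proof.
rewrite psZ nm_ilam real_normK ?num_real//.
apply: le_trans (ler_wpM2l (sqr_ge0 lam) (ps_hB a N)) _.
rewrite /ps !mulr_sumr; apply: ler_sum => m _.
rewrite {2}/us nm_opD; have [h _ _] := dom m.
have -> : 4^-1 * (m`!%:R * (d m ^+ 2 * nm (a m) ^+ 2)) = 4^-1 * d m ^+ 2 * us a m by rewrite /us; ring.
rewrite [lam ^+ 2 * _]mulrA ler_wpM2r ?us_ge0//.
by move: h; move: (d m ^+ 2) (lam ^+ 2) (m%:R) => p q r; lra.
Qed.

Lemma ffin_B a : ffin (D a) -> ffin (B a) /\ fn (B a) <= 4^-1 * fn (D a).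
Proof.
move=> fD; have h N : ps (B a) N <= 4^-1 * fn (D a).
  by apply: le_trans (ps_B_le a N) _; rewrite ler_wpM2l ?invr_ge0// ps_le_fn.
by split; [exists (4^-1 * fn (D a))|exact: fn_le].
Qed.

Lemma ffin_opD a : ffin (D a) -> ffin a /\ fn a <= fn (D a).
Proof.
move=> fD; suff H n : nm (a n) ^+ 2 <= 1 * nm (D a n) ^+ 2.
  by have [fa ha] := us_le_ffin H fD; rewrite mul1r in ha.
rewrite mul1r nm_opD ler_peMl ?sqr_ge0//.
have [_ h _] := dom n; rewrite -[d n ^+ 2]real_normK ?num_real//.
by rewrite exprn_ege1.
Qed.

(** The third clause of [dominant] places the domain of the diagonal part inside that of [S2]. *)
Lemma ffin_opD_s2 a : lam' != 0 -> ffin (D a) -> ffin (s2 a).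
Proof.
move=> l0 fD; have L0 : 0 < `|lam'| by rewrite normr_gt0.
suff H n : nm (s2 a n) ^+ 2 <= (4 / `|lam'| ^+ 2) * nm (D a n) ^+ 2.
  by have [] := us_le_ffin H fD.
rewrite nm_opD /s2 !Normc.normcM !normc_nat [(_ * nm (a n)) ^+ 2]exprMn.
rewrite [4 / _ * _]mulrA ler_wpM2r ?sqr_ge0//.
rewrite mulrAC ler_pdivlMr ?exprn_gt0// -exprMn.
have [_ _ h] := dom n.
have -> : 4 * d n ^+ 2 = (2 * `|d n|) ^+ 2 by rewrite exprMn real_normK ?num_real//; ring.
by rewrite mulrC lerXn2r ?nnegrE ?mulr_ge0.
Qed.

Lemma ffin_opT a : ffin (D a) -> ffin (T a) /\ fn (T a) <= 3 * fn (D a).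
Proof.
move=> fD; have [fB hB] := ffin_B fD; rewrite opT_DB; split; first exact: ffinD.
apply: le_trans (fnD fD fB) _; have := fn_ge0 fD; lra.
Qed.

(** From [D a = T a - B a], [fn (D a)] is at most [2 * fn (T a)] plus half of itself. The absorption
    presupposes that [fn (D a)] is finite, so the estimate is first applied to polynomials and then
    carried to limits by [fn_lim_le]. *)
Lemma apriori a : ffin (D a) -> fn (D a) <= 4 * fn (T a).
Proof.
move=> fD; have [fB hB] := ffin_B fD; have [fT _] := ffin_opT fD.
have E : D a = (fun n => T a n + (-1) * B a n) by apply/funext => n; rewrite opTE; ring.
have h1 := fnD fT (ffinZ (-1) fB).
have h2 := fnZ (-1) fB.
rewrite normcN Normc.normc1 expr1n mul1r in h2.
rewrite -E in h1; lra.
Qed.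

Lemma dd_neq0 n : d n != 0.
Proof. by have [_ h _] := dom n; rewrite -normr_gt0 (lt_le_trans ltr01). Qed.

Definition Dinv x n : C := ((d n)^-1)%:C * x n.

Lemma opD_Dinv x : D (Dinv x) = x.
Proof.
apply/funext => n; rewrite /opD /Dinv mulrA -rmorphM mulfV ?dd_neq0//.
by rewrite rmorph1 mul1r.
Qed.

Lemma cvgc_coord (A : nat -> nat -> C) (F : R) : 0 <= F ->
  (forall k n, nm (A k.+1 n - A k n) <= F * 2^-1 ^+ k) ->
  exists x, forall n, (fun k => A k n : C^o) @ \oo --> (x n : C^o).
Proof.
move=> F0 H.
have tail n N M : (N <= M)%N -> nm (A M n - A N n) <= 2 * F * 2^-1 ^+ N.
  move=> NM; apply: (@le_trans _ _ (\sum_(N <= k < M) F * 2^-1 ^+ k)).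
    rewrite -(telescope_sumr (fun k => A k n) NM).
    by apply: le_trans (normc_sum _ _ _) _; apply: ler_sum => k _; exact: H.
  by rewrite -mulr_sumr mulrAC [leRHS]mulrC ler_wpM2l// geometric_half_le.
exists (fun n => limn (fun k => complex.Re (A k n)) +i* limn (fun k => complex.Im (A k n))) => n.
apply/cvgc_ReImP; split => /=; apply: (@geometric_cauchy_cvg _ _ (2 * F)) => N M NM;
  apply: le_trans (tail n N M NM).
- by rewrite -cReN -cReD normc_ge_absRe.
- by rewrite -cImN -cImD normc_ge_absIm.
Qed.

Lemma recurrence_lim (X Y : nat -> C) (b x y : C) : (forall k, X k.+1 = b - Y k) ->
  (X : nat -> C^o) @ \oo --> (x : C^o) -> (Y : nat -> C^o) @ \oo --> (y : C^o) -> x = b - y.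
Proof.
move=> XY cX cY.
have c1 : ((fun k => b - Y k) : nat -> C^o) @ \oo --> (b - y : C^o).
  exact: (cvgcB (cvg_cst _) cY).
have c2 : ((fun k => X k.+1) : nat -> C^o) @ \oo --> (x : C^o).
  rewrite (cvg_shiftS (X : nat -> C^o)); exact: cX.
have E : (fun k => X k.+1) = (fun k => b - Y k) by apply/funext.
by rewrite E in c2; exact: (cvg_unique _ c2 c1).
Qed.

(* Neumann series for [(1 + B D^-1) x = b]. *)
Lemma solve b : ffin b -> exists2 a, ffin (D a) & T a = b.
Proof.
move=> fb; pose K x := B (Dinv x).
have KD (x y : nat -> C) n : K x n - K y n = K (fun n => x n - y n) n.
  rewrite /K /hB /Dinv; case: n => [|n]; ring.
have fK x : ffin x -> ffin (K x) /\ fn (K x) <= 4^-1 * fn x.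
  by move=> fx; have := @ffin_B (Dinv x); rewrite opD_Dinv => /(_ fx).
pose fix X k : nat -> C := if k is m.+1 then (fun n => b n - K (X m) n) else (fun=> 0).
have f0 : ffin (fun=> 0 : C) by apply: (@ffin_fin _ _ 0).
have nn x : (fun n => b n - K x n) = (fun n => b n + (-1) * K x n).
  by apply/funext => n; rewrite mulN1r.
(* 4 is stable under the recursion: [2 * fn b + 2 * 4^-1 * (4 * fn b) = 4 * fn b]. *)
have fX k : ffin (X k) /\ fn (X k) <= 4 * fn b.
  elim: k => [|k [IH1 IH2]].
    split => //; apply: (@le_trans _ _ 0); last by rewrite mulr_ge0// fn_ge0.
    by apply: fn_le => N; rewrite /ps big1// => n _; rewrite /us Normc.normc0 expr0n mulr0.
  have [h1 h2] := fK _ IH1.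
  have h3 := ffinZ (-1) h1; have h4 := fnZ (-1) h1; have h5 := fnD fb h3.
  rewrite normcN Normc.normc1 expr1n mul1r in h4.
  rewrite /= nn; split; first exact: ffinD.
  by have := fn_ge0 fb; lra.
have F0 := fn_ge0 fb.
(* Squared increments shrink by 1/4 per step, so every coordinate moves by at most
   [Num.sqrt (fn b) * 2^-1 ^+ k] and converges. *)
have dX k : ffin (fun n => X k.+1 n - X k n) /\ fn (fun n => X k.+1 n - X k n) <= 4^-1 ^+ k * fn b.
  elim: k => [|k [IH1 IH2]].
    have -> : (fun n => X 1%N n - X 0%N n) = b.
      apply/funext => n; rewrite /= subr0 (_ : K _ n = 0) ?subr0//.
      by rewrite /K /hB /Dinv; case: n => [|n]; rewrite !mulr0 ?addr0 ?mulr0.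
    by rewrite expr0 mul1r.
  have -> : (fun n => X k.+2 n - X k.+1 n) = (fun n => (-1) * K (fun n => X k.+1 n - X k n) n).
    apply/funext => n; rewrite -KD.
    have E j : X j.+1 n = b n - K (X j) n by [].
    rewrite (E k.+1) (E k); move: (K _ n) (K _ n) (b n) => p q r; ring.
  have [h1 h2] := fK _ IH1; split; first exact: ffinZ.
  have h4 := fnZ (-1) h1; rewrite normcN Normc.normc1 expr1n mul1r in h4.
  apply: le_trans h4 (le_trans h2 _); rewrite exprS -mulrA ler_wpM2l ?invr_ge0//.
pose F := Num.sqrt (fn b).
have [x Hx] : exists x, forall n, (fun k => X k n : C^o) @ \oo --> (x n : C^o).
  apply: (@cvgc_coord X F); first exact: sqrtr_ge0.
  move=> k n; have [h1 h2] := dX k.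
  rewrite -(@ler_pXn2r _ 2) ?nnegrE ?normc_ge0 ?mulr_ge0 ?sqrtr_ge0 ?exprn_ge0 ?invr_ge0//.
  apply: le_trans (nm_le_fn n h1) (le_trans h2 _).
  rewrite exprMn /F sqr_sqrtr// -exprM mulnC exprM mulrC.
  by have -> : 2^-1 ^+ 2 = 4^-1 :> R by rewrite expr2 -invfM -natrM.
have [fx _] : ffin x /\ fn x <= 4 * fn b.
  apply: (fn_lim_le Hx) => N; apply: nearW => k; have [h1 h2] := fX k.
  exact: le_trans (ps_le_fn N h1) h2.
exists (Dinv x); first by rewrite opD_Dinv.
rewrite opT_DB opD_Dinv; apply/funext => n.
have cK : (fun k => K (X k) n : C^o) @ \oo --> (K x n : C^o).
  rewrite /K /hB /Dinv; apply: cvgcZ; apply: cvgcD; first by do 2 apply: cvgcZ; exact: Hx.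
  case: n => [|n]; first exact: cvg_cst.
  by do 2 apply: cvgcZ; exact: Hx.
have E : x n = b n - K x n.
  apply: (@recurrence_lim (fun k => X k n) (fun k => K (X k) n)); last exact: cK.
  - by move=> k.
  - exact: Hx.
transitivity (x n + K x n); first by [].
by move: E; move: (K x n) (x n) (b n) => p q r ->; rewrite subrK.
Qed.

End Resolvent.

(** * Back to the Bargmann space *)

Section Bargmann.
Context {R : realType}.
Local Notation C := R[i].
Local Notation nm := Normc.normc.
Local Notation mu2 := (@plane_measure R).
Implicit Types (a b : nat -> C) (phi psi : C -> C).

Lemma integral_dens_psv a : ffin a -> (\int[mu2]_w (dens (psv a) w)%:E = (pi * fn a)%:E)%E.
Proof.
move=> fa; have := bargmann_norm2_psv (ffin_rapid fa); rewrite fock_fn// bargmann_norm2E EFinM => <-.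
by rewrite muleA -EFinM mulfV ?mul1e// gt_eqF// pi_gt0.
Qed.

Lemma bargmann_psv a : ffin a -> bargmann (psv a).
Proof.
move=> fa; split; first exact: psv_entire (ffin_rapid fa).
by rewrite (bargmann_norm2_psv (ffin_rapid fa)) fock_fn// ltry.
Qed.

Lemma bargmannP phi : bargmann phi -> exists2 a, ffin a & phi = psv a.
Proof.
move=> [/entire_psv[a ra ->]]; rewrite bargmann_norm2_psv// => fa.
by exists a => //; exact: fock_ffin.
Qed.

Lemma bnorm_psv a : ffin a -> bnorm (psv a) = Num.sqrt (fn a).
Proof. by move=> fa; rewrite /bnorm (bargmann_norm2_psv (ffin_rapid fa)) fock_fn. Qed.

Lemma bnorm_psv_sqr a : ffin a -> bnorm (psv a) ^+ 2 = fn a.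
Proof. by move=> fa; rewrite bnorm_psv// sqr_sqrtr// fn_ge0. Qed.

Lemma s2E a : s2 a = mulz (mulz (dcoef (dcoef a))).
Proof.
apply/funext => -[|[|n]]; rewrite /s2 /mulz /dcoef /=; [by rewrite !mul0r|by rewrite mulr0 mul0r|].
by rewrite mulrCA mulrA.
Qed.

Lemma hBE a : hB a = mulz (fun n => dcoef (dcoef a) n + mulz (dcoef a) n).
Proof.
apply/funext => -[|n]; rewrite /hB /mulz /dcoef /=; first by rewrite mulr0 mul0r addr0.
congr (_ + _); first by rewrite mulrCA mulrA.
by case: n => [|n]; rewrite ?mul0r.
Qed.

Lemma rapid_s2 a : rapid a -> rapid (s2 a).
Proof. by move=> ra; rewrite s2E; do 2 apply: rapid_mulz; do 2 apply: rapid_dcoef. Qed.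

Lemma rapid_hB a : rapid a -> rapid (hB a).
Proof.
move=> ra; rewrite hBE; apply: rapid_mulz; apply: rapidD; first by do 2 apply: rapid_dcoef.
by apply: rapid_mulz; exact: rapid_dcoef.
Qed.

Lemma S2_psv a : rapid a -> S2 (psv a) = psv (s2 a).
Proof.
move=> ra; have r1 := rapid_dcoef ra; have r2 := rapid_dcoef r1; have r3 := rapid_mulz r2.
by rewrite /S2 !opA_psv// !opAstar_psv// s2E.
Qed.

Variables (mu lam lam' : R).

Lemma hmlE a : hml mu lam a = (fun n => mu%:C * mulz (dcoef a) n + (0 +i* lam) * hB a n).
Proof.
apply/funext => n; rewrite /hml; congr (_ + _); rewrite rmorphM/= natC -mulrA; congr (_ * _).
by case: n => [|n] /=; rewrite ?mul0r.
Qed.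

Lemma rapid_hml a : rapid a -> rapid (hml mu lam a).
Proof.
move=> ra; rewrite hmlE; apply: rapidD; apply: rapidZ; last exact: rapid_hB.
by apply: rapid_mulz; exact: rapid_dcoef.
Qed.

Lemma H_ml_psv a : rapid a -> H_ml mu lam (psv a) = psv (hml mu lam a).
Proof.
move=> ra; have r1 := rapid_dcoef ra; have r2 := rapid_dcoef r1; have r3 := rapid_mulz r1.
apply/funext => z; rewrite hmlE psvD; [|by apply: rapidZ|by apply: rapidZ; exact: rapid_hB].
rewrite !psvZ//; last exact: rapid_hB.
rewrite /H_ml !opA_psv// !opAstar_psv// hBE; congr (_ + _ * _).
have -> : (fun y => psv (dcoef (dcoef a)) y + psv (mulz (dcoef a)) y) = psv (fun n => dcoef (dcoef a) n + mulz (dcoef a) n).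
  by apply/funext => y; rewrite psvD.
by rewrite opAstar_psv//; exact: rapidD.
Qed.

Lemma hfullE a : hfull mu lam lam' a = (fun n => lam'%:C * s2 a n + hml mu lam a n).
Proof. by []. Qed.

Lemma H_full_psv a : rapid a -> H_full lam' mu lam (psv a) = psv (hfull mu lam lam' a).
Proof.
move=> ra; apply/funext => z; rewrite hfullE psvD; [|by apply: rapidZ; exact: rapid_s2|exact: rapid_hml].
by rewrite (psvZ _ _ (rapid_s2 ra)) /H_full (S2_psv ra) (H_ml_psv ra).
Qed.

Lemma cRe_Mreal (r : R) (z : C) : complex.Re (r%:C * z) = r * complex.Re z.
Proof. by case: z => x y /=; rewrite mul0r subr0. Qed.

Lemma cIm_Mreal (r : R) (z : C) : complex.Im (r%:C * z) = r * complex.Im z.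
Proof. by case: z => x y /=; rewrite mul0r addr0. Qed.

Lemma cRe_realM (r : R) (z : C) : complex.Re (z * r%:C) = complex.Re z * r.
Proof. by rewrite mulrC cRe_Mreal mulrC. Qed.

Lemma cRe_Ni (z : C) : complex.Re (- 'i * z) = complex.Im z.
Proof. by case: z => x y /=; ring. Qed.

Lemma Re_bdot phi psi : complex.Re (bdot phi psi) = pi^-1 * Rintegral mu2 setT
  (fun w => complex.Re (phi (Defs.point w) * conjc (psi (Defs.point w)) * (gauss_weight w)%:C)).
Proof. by rewrite /bdot cRe_Mreal. Qed.

Lemma Im_bdot phi psi : complex.Im (bdot phi psi) = pi^-1 * Rintegral mu2 setT
  (fun w => complex.Im (phi (Defs.point w) * conjc (psi (Defs.point w)) * (gauss_weight w)%:C)).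
Proof. by rewrite /bdot cIm_Mreal. Qed.

(** Partial sums of the real part of the inner product; the imaginary part is reached through
    [- 'i * a], since the imaginary part of [z] is the real part of [- 'i * z]. *)
Definition ipart a b N : R := \sum_(0 <= n < N) n`!%:R * complex.Re (a n * conjc (b n)).

Lemma nm_polar (x y : C) : complex.Re (x * conjc y) = 4^-1 * (nm (x + y) ^+ 2 - nm (x + (-1) * y) ^+ 2).
Proof. by rewrite !normc_sqr !ReImE /=; field. Qed.

Lemma ipart_cvg a b : ffin a -> ffin b -> ipart a b @ \oo -->
  4^-1 * (fn (fun n => a n + b n) - fn (fun n => a n + (-1) * b n)).
Proof.
move=> fa fb.
have -> : ipart a b = (fun N => 4^-1 * (ps (fun n => a n + b n) N - ps (fun n => a n + (-1) * b n) N)).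
  apply/funext => N; rewrite /ipart /ps -sumrB mulr_sumr; apply: eq_bigr => n _.
  by rewrite nm_polar /us; ring.
apply: cvgMl_tmp; apply: cvgB; apply: ffin_cvg; apply: ffinD => //; exact: ffinZ.
Qed.

Lemma integrable_dens a : ffin a -> mu2.-integrable setT (fun w => (dens (psv a) w)%:E).
Proof.
move=> fa; apply/integrableP; split; first exact: measurable_Edens (cmeas_psv (ffin_rapid fa)).
under eq_integral do rewrite gee0_abs ?lee_fin ?dens_ge0//.
by rewrite integral_dens_psv// ltry.
Qed.

(** Polarization reduces inner products to norms, so Parseval's identity for norms suffices. *)
Lemma Rintegral_polar a b : ffin a -> ffin b ->
  Rintegral mu2 setT (fun w => complex.Re (psv a (Defs.point w) * conjc (psv b (Defs.point w)) * (gauss_weight w)%:C)) =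
  pi * (4^-1 * (fn (fun n => a n + b n) - fn (fun n => a n + (-1) * b n))).
Proof.
move=> fa fb; have fc := ffinD fa fb; have fd := ffinD fa (ffinZ (-1) fb).
set c := (fun n => a n + b n) in fc *; set d := (fun n => a n + -1 * b n) in fd *.
have -> : (fun w => complex.Re (psv a (Defs.point w) * conjc (psv b (Defs.point w)) * (gauss_weight w)%:C)) =
   (fun w => 4^-1 * (dens (psv c) w - dens (psv d) w)).
  have ra := ffin_rapid fa; have rb := ffin_rapid fb.
  apply/funext => w; rewrite /dens /c /d (psvD _ ra rb) (psvD _ ra (ffin_rapid (ffinZ (-1) fb))).
  by rewrite (psvZ _ _ rb) cRe_realM nm_polar; ring.
have ic := integrable_dens fc; have id := integrable_dens fd.
rewrite RintegralZl//; last exact: (integrableB measurableT ic id).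
rewrite RintegralB// /Rintegral !integral_dens_psv//=; ring.
Qed.

Lemma bdot_psv a b : ffin a -> ffin b ->
  ipart a b @ \oo --> complex.Re (bdot (psv a) (psv b)) /\
  ipart (fun n => - 'i * a n) b @ \oo --> complex.Im (bdot (psv a) (psv b)).
Proof.
move=> fa fb; have fia := ffinZ (- 'i) fa.
have p0 : pi != 0 :> R by rewrite gt_eqF// pi_gt0.
have -> : complex.Re (bdot (psv a) (psv b)) = 4^-1 * (fn (fun n => a n + b n) - fn (fun n => a n + (-1) * b n)).
  by rewrite Re_bdot Rintegral_polar// mulKf.
have -> : complex.Im (bdot (psv a) (psv b)) = 4^-1 * (fn (fun n => - 'i * a n + b n) - fn (fun n => - 'i * a n + (-1) * b n)).
  rewrite Im_bdot -[RHS](mulKf p0) -(Rintegral_polar fia fb); congr (_ * Rintegral _ _ _).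
  by apply/funext => w; rewrite (psvZ _ _ (ffin_rapid fa)) -!mulrA cRe_Ni.
by split; apply: ipart_cvg.
Qed.

Lemma ipart_s2 a N : ipart (s2 a) a N = Gs a N.
Proof.
apply: eq_bigr => n _; rewrite /s2 /us -mulrA -normc_sqrE -!natC -!rmorphM /=; ring.
Qed.

Lemma ipart_is2 a N : ipart (fun n => - 'i * s2 a n) a N = 0.
Proof.
apply: big1 => n _; rewrite /s2 -!mulrA -normc_sqrE -!natC -!rmorphM.
by rewrite cReM/= ; ring.
Qed.

Lemma ipart_le (c : C) a b N : nm c = 1 ->
  `|ipart (fun n => c * a n) b N| <= \sum_(0 <= n < N) n`!%:R * (nm (a n) * nm (b n)).
Proof.
move=> c1; apply: le_trans (ler_norm_sum _ _ _) _; apply: ler_sum => n _.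
rewrite normrM ger0_norm// ler_wpM2l//; apply: le_trans (normc_ge_absRe _) _.
rewrite !Normc.normcM c1 mul1r (_ : nm (conjc (b n)) = nm (b n))//.
by case: (b n) => x y /=; rewrite sqrrN.
Qed.

Lemma nmNi : nm (- 'i : C) = 1.
Proof. by rewrite normcN /= expr0n expr1n add0r sqrtr1. Qed.

Lemma Gs_cvg a : ffin a -> ffin (s2 a) -> Gs a @ \oo --> complex.Re (bdot (psv (s2 a)) (psv a)).
Proof.
move=> fa fs; have [h _] := bdot_psv fs fa.
by have -> : Gs a = ipart (s2 a) a by apply/funext => N; rewrite ipart_s2.
Qed.

Lemma bdot_s2_real a : ffin a -> ffin (s2 a) -> complex.Im (bdot (psv (s2 a)) (psv a)) = 0.
Proof.
move=> fa fs; have [_ h] := bdot_psv fs fa; apply: (cvg_unique _ h) => //.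
have -> : ipart (fun n => - 'i * s2 a n) a = (fun=> 0) by apply/funext => N; rewrite ipart_is2.
exact: cvg_cst.
Qed.

(** The first-order term is controlled through [n <= n (n - 1) + 1]. *)
Lemma ffin_hml a : ffin a -> ffin (s2 a) -> ffin (hml mu lam a).
Proof.
move=> fa fs; have fB := ffin_hB_s2 fa fs.
have H n : nm ((n%:R : C) * a n) ^+ 2 <= 1 * nm (s2 a n + a n) ^+ 2.
  rewrite mul1r /s2 (_ : _ + a n = (n%:R * n.-1%:R + 1) * a n); last by ring.
  rewrite !Normc.normcM !exprMn ler_wpM2r ?sqr_ge0//.
  rewrite -natrM natr1 !normc_nat lerXn2r ?nnegrE// ler_nat.
  by case: n => [|[|n]]//=; rewrite mulnS leqW// leq_addr.
have [fn1 _] := us_le_ffin H (ffinD fs fa).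
have -> : hml mu lam a = (fun n => mu%:C * (n%:R * a n) + (0 +i* lam) * hB a n).
  by apply/funext => n; rewrite /hml rmorphM/= natC mulrA.
by apply: ffinD; exact: ffinZ.
Qed.

(** Passage to the limit in [form_bound], separately for real and imaginary parts; both partial sums
    are bounded by the same sum of moduli. *)
Lemma hml_form_bound (eps : R) : 0 < eps -> exists2 K, 0 < K & forall a,
  ffin a -> ffin (s2 a) -> 
  let G := complex.Re (bdot (psv (s2 a)) (psv a)) in
  `|complex.Re (bdot (psv (hml mu lam a)) (psv a))| <= eps * G + K * fn a /\
  `|complex.Im (bdot (psv (hml mu lam a)) (psv a))| <= eps * G + K * fn a.
Proof.
move=> e0; have [K K0 HK] := form_bound mu lam e0; exists K => // a fa fs G.
have fh := ffin_hml fa fs; have [h1 h2] := bdot_psv fh fa.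
have cG := Gs_cvg fa fs.
have GG N : Gs a N <= G.
  apply: (ler_cvg_to (cvg_cst (Gs a N)) cG).
  by exists N => // M /= NM; exact: Gs_nd.
have ub N : eps * Gs a N.+1 + K * ps a N.+1 <= eps * G + K * fn a.
  by apply: lerD; [rewrite ler_wpM2l ?(ltW e0)|rewrite ler_wpM2l ?(ltW K0)// ps_le_fn].
split.
- apply: (ler_cvg_to (cvg_norm h1) (cvg_cst _)); apply: nearW => N.
  apply: le_trans (ub N); apply: le_trans (HK a N).
  have := @ipart_le 1 (hml mu lam a) a N (Normc.normc1 R).
  by have -> : (fun n => 1 * hml mu lam a n) = hml mu lam a by apply/funext => n; rewrite mul1r.
- apply: (ler_cvg_to (cvg_norm h2) (cvg_cst _)); apply: nearW => N.
  apply: le_trans (ub N); apply: le_trans (HK a N).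
  exact: ipart_le nmNi.
Qed.

End Bargmann.

(** * The closure of the operator on polynomials *)

Section MinimalOperator.
Context {R : realType}.
Local Notation C := R[i].
Local Notation nm := Normc.normc.
Implicit Types (a b x : nat -> C) (phi psi : C -> C).

Lemma cvgc_unique (u : nat -> C) (x y : C) :
  (u : nat -> C^o) @ \oo --> (x : C^o) -> (u : nat -> C^o) @ \oo --> (y : C^o) -> x = y.
Proof. by move=> c1 c2; exact: (cvg_unique _ c1 c2). Qed.

Lemma ffinB a b : ffin a -> ffin b -> ffin (fun n => a n - b n).
Proof. by move=> fa fb; under eq_fun do rewrite -mulN1r; apply: ffinD => //; exact: ffinZ. Qed.

Lemma psvB a b z : rapid a -> rapid b -> psv (fun n => a n - b n) z = psv a z - psv b z.
Proof.
move=> ra rb; under eq_fun do rewrite -mulN1r.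
by rewrite (psvD _ ra (rapidZ _ rb)) (psvZ _ _ rb) mulN1r.
Qed.

Lemma bnorm_psvB a b : ffin a -> ffin b ->
  bnorm (fun z => psv a z - psv b z) = Num.sqrt (fn (fun n => a n - b n)).
Proof.
move=> fa fb; rewrite -(bnorm_psv (ffinB fa fb)); congr bnorm; apply/funext => z.
by rewrite psvB//; exact: ffin_rapid.
Qed.

Lemma bcvg_coord (A : nat -> nat -> C) a : (forall k, ffin (A k)) -> ffin a ->
  bcvg (fun k => psv (A k)) (psv a) ->
  forall n, (fun k => A k n : C^o) @ \oo --> (a n : C^o).
Proof.
move=> fA fa; rewrite /bcvg.
have -> : (fun k => bnorm (fun z => psv (A k) z - psv a z)) =
    (fun k => Num.sqrt (fn (fun n => A k n - a n))).
  by apply/funext => k; rewrite bnorm_psvB.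
move=> h n; apply/cvgc_normP.
apply: (@squeeze_cvgr _ _ _ _ (fun=> 0) (fun k => Num.sqrt (fn (fun n => A k n - a n)))) => //; last exact: cvg_cst.
apply: nearW => k; rewrite normc_ge0/= -(@ler_pXn2r _ 2) ?nnegrE ?normc_ge0 ?sqrtr_ge0//.
have f := ffinB (fA k) fa.
by rewrite sqr_sqrtr ?fn_ge0//; exact: (nm_le_fn n f).
Qed.

Lemma bcvg_bounded (A : nat -> nat -> C) a : (forall k, ffin (A k)) -> ffin a ->
  bcvg (fun k => psv (A k)) (psv a) -> \forall k \near \oo, fn (A k) <= 2 + 2 * fn a.
Proof.
move=> fA fa h; have /cvgrPdist_lt/(_ 1 ltr01) := h; apply: filterS => k.
have f := ffinB (fA k) fa.
rewrite sub0r normrN bnorm_psvB// ger0_norm ?sqrtr_ge0// => /ltW h1.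
have h2 : fn (fun n => A k n - a n) <= 1.
  by rewrite -[leLHS](sqr_sqrtr (fn_ge0 f)) exprn_ile1 ?sqrtr_ge0.
have E : A k = (fun n => (A k n - a n) + a n) by apply/funext => n; rewrite subrK.
by have := fnD f fa; rewrite -E; lra.
Qed.

Lemma bcvg_fn0 (A : nat -> nat -> C) a : (forall k, ffin (A k)) -> ffin a ->
  fn (fun n => A k n - a n) @[k --> \oo] --> 0 -> bcvg (fun k => psv (A k)) (psv a).
Proof.
move=> fA fa h; rewrite /bcvg.
have -> : (fun k => bnorm (fun z => psv (A k) z - psv a z)) =
    Num.sqrt \o (fun k => fn (fun n => A k n - a n)).
  by apply/funext => k; rewrite bnorm_psvB.
have := continuous_cvg _ (@sqrt_continuous R 0) h; rewrite sqrtr0; exact.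
Qed.

Variables mu lam lam' be : R.
Hypothesis dom : dominant mu lam lam' be.
Local Notation D := (opD mu lam' be).
Local Notation T := (opT mu lam lam' be).
Local Notation H := (hfull mu lam lam').

Lemma hfull_opT a : H a = (fun n => T a n + (- be%:C) * a n).
Proof. by apply/funext => n; rewrite /opT mulNr addrK. Qed.

Lemma ffin_hfull a : ffin (D a) -> ffin (H a) /\ fn (H a) <= (6 + 2 * be ^+ 2) * fn (D a).
Proof.
move=> fD; have [fa ha] := ffin_opD dom fD; have [fT hT] := ffin_opT dom fD.
rewrite hfull_opT; have fb := ffinZ (- be%:C) fa; split; first exact: ffinD.
have h := fnD fT fb; have h2 := fnZ (- be%:C) fa.
rewrite normcN normc_real real_normK ?num_real// in h2.
have h3 := ler_wpM2l (sqr_ge0 be) ha; move: h h2 h3 hT.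
by move: (fn _) (fn _) (fn _) (fn _) (fn _) => p q r s t; lra.
Qed.

Lemma ffin_opD_fin a K : (forall n, (K <= n)%N -> a n = 0) -> ffin (D a).
Proof. by move=> a0; apply: (@ffin_fin _ _ K) => n Kn; rewrite /opD a0// mulr0. Qed.

(** Each row of the matrix has at most three entries, so it commutes with coordinatewise limits;
    this is what makes the operator closable. *)
Lemma hfull_cvg (A : nat -> nat -> C) a :
  (forall n, (fun k => A k n : C^o) @ \oo --> (a n : C^o)) ->
  forall n, (fun k => H (A k) n : C^o) @ \oo --> (H a n : C^o).
Proof.
move=> h n; rewrite /hfull /s2 /hml /hB; apply: cvgcD.
  by do 2 apply: cvgcZ; exact: h.
apply: cvgcD; first by apply: cvgcZ; exact: h.
apply: cvgcZ; apply: cvgcD; first by apply: cvgcZ; exact: h.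
by case: n => [|n]; [exact: cvg_cst|apply: cvgcZ; exact: h].
Qed.

(** Norm convergence implies convergence of coefficients, which identifies the limit of the images
    as [H a]. The a priori estimate bounds the diagonal part of the approximating polynomials, and
    semicontinuity passes the bound to [a]. *)
Lemma min_graph_psv phi psi : min_graph (H_full lam' mu lam) phi psi ->
  exists a, [/\ ffin (D a), phi = psv a & psi = psv (H a)].
Proof.
move=> [/bargmannP[a fa ->] /bargmannP[b fb ->] [p [hp hq]]].
pose A n k := (p n)`_k.
have A0 n k : (size (p n) <= k)%N -> A n k = 0 by exact: nth_default.
have fDA n : ffin (D (A n)) by apply: ffin_opD_fin; exact: A0.
have fA n : ffin (A n) by have [] := ffin_opD dom (fDA n).
have fHA n : ffin (H (A n)) by have [] := ffin_hfull (fDA n).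
have pA n : horner (p n) = psv (A n) by apply/funext => z; rewrite psv_poly.
have E1 : (fun n => horner (p n)) = (fun n => psv (A n)) by apply/funext.
have E2 : (fun n => H_full lam' mu lam (horner (p n))) = (fun n => psv (H (A n))).
  by apply/funext => n; rewrite pA H_full_psv//; exact: ffin_rapid.
rewrite E1 in hp; rewrite E2 in hq.
have cA := bcvg_coord fA fa hp; have cHA := bcvg_coord fHA fb hq.
have bE : b = H a.
  apply/funext => n; exact: cvgc_unique (cHA n) (@hfull_cvg A a cA n).
exists a; rewrite -bE; split => //.
have cDA n : (fun k => D (A k) n : C^o) @ \oo --> (D a n : C^o) by apply: cvgcZ; exact: cA.
(* [T = H + be], each squared norm along the sequence is eventually at most 2 plus twice that of its
   limit, and the outer 4 is that of [apriori]. *)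
pose M := 4 * (2 * (2 + 2 * fn b) + 2 * (be ^+ 2 * (2 + 2 * fn a))).
suff [] : ffin (D a) /\ fn (D a) <= M by [].
apply: (fn_lim_le cDA) => N; near=> k.
apply: le_trans (ps_le_fn N (fDA k)) _.
apply: le_trans (apriori dom (fDA k)) _; rewrite ler_wpM2l//.
have b1 : fn (H (A k)) <= 2 + 2 * fn b by near: k; exact: bcvg_bounded hq.
have b2 : fn (A k) <= 2 + 2 * fn a by near: k; exact: bcvg_bounded hp.
apply: le_trans (fnD (fHA k) (ffinZ be%:C (fA k))) _.
apply: lerD; rewrite ler_wpM2l//.
apply: le_trans (fnZ _ (fA k)) _; rewrite normc_real real_normK ?num_real//.
by rewrite ler_wpM2l ?sqr_ge0.
Unshelve. all: by end_near. Qed.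

(** Taylor polynomials approximate in the graph norm: the diagonal part commutes with truncation,
    and it controls [H]. *)
Lemma psv_min_graph a : ffin (D a) -> min_graph (H_full lam' mu lam) (psv a) (psv (H a)).
Proof.
move=> fD; have [fa _] := ffin_opD dom fD; have [fH _] := ffin_hfull fD.
split; [exact: bargmann_psv|exact: bargmann_psv|].
exists (fun N => \poly_(i < N) a i).
have pE N : horner (\poly_(i < N) a i) = psv (trunc a N).
  apply/funext => z; rewrite -psv_poly; congr psv; apply/funext => n.
  by rewrite coef_poly.
have t0 N n : (N <= n)%N -> trunc a N n = 0 by rewrite /trunc ltnNge => ->.
have fDt N : ffin (D (trunc a N)) by apply: ffin_opD_fin (t0 N).
have ft N : ffin (trunc a N) by have [] := ffin_opD dom (fDt N).
have fHt N : ffin (H (trunc a N)) by have [] := ffin_hfull (fDt N).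
have E1 : (fun N => horner (\poly_(i < N) a i)) = (fun N => psv (trunc a N)) by apply/funext.
have E2 : (fun N => H_full lam' mu lam (horner (\poly_(i < N) a i))) = (fun N => psv (H (trunc a N))).
  by apply/funext => N; rewrite pE H_full_psv//; exact: ffin_rapid.
rewrite E1 E2; split; apply: bcvg_fn0 => //; first exact: fn_tail.
pose x N n := trunc a N n - a n.
have xD N : D (x N) = (fun n => trunc (D a) N n - D a n).
  by apply/funext => n; rewrite /x /opD /trunc; case: ifP; rewrite mulrBr// mulr0.
have fDx N : ffin (D (x N)).
  rewrite (_ : D (x N) = (fun n => D (trunc a N) n - D a n)); first exact: ffinB.
  by apply/funext => n; rewrite /x /opD mulrBr.
have xH N : (fun n => H (trunc a N) n - H a n) = H (x N).
  apply/funext => n; rewrite /hfull /s2 /hml /hB /x; case: n => [|n]; ring.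
apply: (@squeeze_cvgr _ _ _ _ (fun=> 0) (fun N => (6 + 2 * be ^+ 2) * fn (D (x N)))); last 2 first.
- exact: cvg_cst.
- rewrite -(mulr0 (6 + 2 * be ^+ 2)); apply: cvgMl_tmp.
  by under eq_fun do rewrite xD; exact: fn_tail.
apply: nearW => N; rewrite xH; have [h1 h2] := ffin_hfull (fDx N).
by rewrite fn_ge0.
Qed.

Lemma op_min_psv a : ffin (D a) -> op_min (H_full lam' mu lam) (psv a) = psv (H a).
Proof.
move=> fD; apply: xget_unique; first exact: psv_min_graph.
move=> psi /min_graph_psv[b [fDb ab ->]].
have [fa _] := ffin_opD dom fD; have [fb _] := ffin_opD dom fDb.
by have -> : a = b by apply: psv_inj; [exact: ffin_rapid|exact: ffin_rapid|move=> z; rewrite ab].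
Qed.

Lemma D_minP phi : D_min (H_full lam' mu lam) phi <-> exists2 a, ffin (D a) & phi = psv a.
Proof.
split=> [[psi /min_graph_psv[a [fD -> _]]]|[a fD ->]]; first by exists a.
by exists (psv (H a)); exact: psv_min_graph.
Qed.

Lemma min_invertible : invertible (D_min (H_full lam' mu lam))
  (fun phi z => op_min (H_full lam' mu lam) phi z + be%:C * phi z).
Proof.
have TE a : ffin (D a) ->
    (fun z => op_min (H_full lam' mu lam) (psv a) z + be%:C * psv a z) = psv (T a).
  move=> fD; have [fa _] := ffin_opD dom fD; have [fH _] := ffin_hfull fD.
  apply/funext => z; rewrite op_min_psv// -(psvZ _ _ (ffin_rapid fa)) -psvD//; apply: ffin_rapid => //.
  exact: ffinZ.
split; last first.
  (* Square root of the constant in [fn a <= fn (D a) <= 4 * fn (T a)]. *)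
  exists 2 => phi /D_minP[a fD ->].
  have [fa ha] := ffin_opD dom fD; have [fT _] := ffin_opT dom fD.
  rewrite TE// !bnorm_psv// -(@ler_pXn2r _ 2) ?nnegrE ?mulr_ge0 ?sqrtr_ge0//.
  rewrite exprMn !sqr_sqrtr ?fn_ge0//; apply: le_trans ha (le_trans (apriori dom fD) _).
  by rewrite ler_wpM2r ?fn_ge0// -natrX.
split.
- move=> phi /D_minP[a fD ->].
  by rewrite TE//; apply: bargmann_psv; have [] := ffin_opT dom fD.
- move=> phi psi /set_mem/D_minP[a fDa ->] /set_mem/D_minP[b fDb ->].
  rewrite !TE// => Tab.
  have [fTa _] := ffin_opT dom fDa; have [fTb _] := ffin_opT dom fDb.
  have {}Tab : T a = T b.
    by apply: psv_inj; [exact: ffin_rapid|exact: ffin_rapid|move=> z; rewrite Tab].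
  pose x n := a n + (-1) * b n.
  have Tx n : T x n = 0 by rewrite /x opTD opTZ Tab mulN1r subrr.
  have fDx : ffin (D x).
    rewrite (_ : D x = (fun n => D a n - D b n)); first exact: ffinB.
    by apply/funext => n; rewrite /x /opD mulN1r mulrBr.
  have [fx hx] := ffin_opD dom fDx.
  have T0 : fn (T x) <= 0 by apply: fn_le => N; rewrite /ps big1// => n _; rewrite /us Tx Normc.normc0 expr0n mulr0.
  have x0 : fn x <= 0 by have := apriori dom fDx; lra.
  congr psv; apply/funext => n; have := ffin_eq0 fx x0 n.
  by rewrite /x mulN1r => /subr0_eq.
- move=> psi /bargmannP[b fb ->]; have [a fD Tab] := solve dom fb.
  by exists (psv a); [apply/D_minP; exists a|rewrite TE// Tab].
Qed.

Hypothesis lam'0 : lam' != 0.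

Lemma Re_bdot_op_min a : ffin (D a) ->
  [/\ ffin a, ffin (s2 a), 0 <= complex.Re (bdot (psv (s2 a)) (psv a)) &
  complex.Re (bdot (op_min (H_full lam' mu lam) (psv a)) (psv a)) =
  lam' * complex.Re (bdot (psv (s2 a)) (psv a)) + complex.Re (bdot (psv (hml mu lam a)) (psv a))].
Proof.
move=> fD; have [fa _] := ffin_opD dom fD; have fs := ffin_opD_s2 dom lam'0 fD.
have [fH _] := ffin_hfull fD; have fh := ffin_hml mu lam fa fs.
have cG := Gs_cvg fa fs; split => //.
  apply: (ler_cvg_to (cvg_cst 0) cG); apply: nearW => N.
  by apply: sumr_ge0 => n _; rewrite mulr_ge0 ?us_ge0// mulr_ge0.
rewrite op_min_psv//; have [h1 _] := bdot_psv fH fa; have [h2 _] := bdot_psv fh fa.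
apply: (cvg_unique _ h1) => //.
have -> : ipart (H a) a = (fun N => lam' * Gs a N + ipart (hml mu lam a) a N).
  apply/funext => N; rewrite -ipart_s2 /ipart mulr_sumr -big_split/=; apply: eq_bigr => n _.
  by rewrite /hfull mulrDl -mulrA cReD cRe_Mreal; ring.
apply: cvgD; last exact: h2.
by apply: cvgMl_tmp; exact: cG.
Qed.

End MinimalOperator.

(** That [S2 phi] lies in the space is a statement about some sequence [b] of finite norm;
    uniqueness of coefficients identifies [b] with [s2 a]. *)
Lemma D_S2P (R : realType) (phi : R[i] -> R[i]) : D_S2 phi ->
  exists a, [/\ ffin a, ffin (s2 a) & phi = psv a].
Proof.
move=> [/bargmannP[a fa ->] /bargmannP[b fb ab]]; exists a; split => //.
have ra := ffin_rapid fa; rewrite S2_psv// in ab.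
suff -> : s2 a = b by [].
by apply: psv_inj; [exact: rapid_s2|exact: ffin_rapid|move=> z; rewrite ab].
Qed.

Theorem proposition3p39 (R : realType) (mu lambda lambda' : R) :
  [/\ (forall eps : R, 0 < eps ->
        exists Ceps : R, 0 < Ceps /\
          forall phi : R[i] -> R[i], D_S2 phi ->
            `|bdot (H_ml mu lambda phi) phi| <=
              eps%:C * bdot (S2 phi) phi + (Ceps * bnorm phi ^+ 2)%:C),
      (0 < lambda' ->
        exists C : R, 0 < C /\
          forall phi : R[i] -> R[i], D_min (H_full lambda' mu lambda) phi ->
            - C * bnorm phi ^+ 2 <=
              complex.Re (bdot (op_min (H_full lambda' mu lambda) phi) phi)),
      (lambda' < 0 ->
        exists C : R, 0 < C /\
          forall phi : R[i] -> R[i], D_min (H_full lambda' mu lambda) phi ->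
            complex.Re (bdot (op_min (H_full lambda' mu lambda) phi) phi) <=
              C * bnorm phi ^+ 2) &
      (lambda' != 0 ->
        exists beta0 : R,
          invertible (D_min (H_full lambda' mu lambda))
            (fun phi z => op_min (H_full lambda' mu lambda) phi z +
                          beta0%:C * phi z))].
Proof.
split.
(* Half of [eps] for each of the real and imaginary parts, whence also the constant [2 * K]. *)
- move=> eps e0; have e2 : 0 < eps / 2 by rewrite divr_gt0.
  have [K K0 HK] := hml_form_bound mu lambda e2.
  exists (2 * K); split; first by rewrite mulr_gt0.
  move=> phi /D_S2P[a [fa fs ->]]; have ra := ffin_rapid fa.
  rewrite S2_psv// H_ml_psv// bnorm_psv_sqr//.
  have [h1 h2] := HK a fa fs; have h3 := bdot_s2_real fa fs.
  have h4 := normc_le_ReIm (bdot (psv (hml mu lambda a)) (psv a)).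
  (* The order on [R[i]] also asks for equal imaginary parts, which holds because the form of [S2]
     is real by [h3]. *)
  rewrite normcE' lecE cImD cReD cIm_Mreal cRe_Mreal h3 mulr0 add0r eqxx andTb.
  by apply: (le_trans h4); rewrite -[leRHS]/(eps * _ + 2 * K * fn a); lra.
- move=> l0; have ln : lambda' != 0 by rewrite gt_eqF.
  have [be dom] := exists_dominant mu lambda ln.
  (* With [eps] equal to [lambda'], the [S2] terms cancel exactly. *)
  have [K K0 HK] := hml_form_bound mu lambda l0.
  exists K; split => // phi /(D_minP dom)[a fD ->].
  have [fa fs G0 ->] := Re_bdot_op_min dom ln fD.
  have [h1 _] := HK a fa fs; rewrite bnorm_psv_sqr//.
  move: h1; rewrite ler_norml => /andP[h1 _].
  by rewrite -lerBlDl; apply: le_trans h1; rewrite mulNr -opprD addrC.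
- move=> l0; have ln : lambda' != 0 by rewrite lt_eqF.
  have [be dom] := exists_dominant mu lambda ln.
  have l1 : 0 < - lambda' by rewrite oppr_gt0.
  (* The same cancellation with [eps] equal to [- lambda']. *)
  have [K K0 HK] := hml_form_bound mu lambda l1.
  exists K; split => // phi /(D_minP dom)[a fD ->].
  have [fa fs G0 ->] := Re_bdot_op_min dom ln fD.
  have [h1 _] := HK a fa fs; rewrite bnorm_psv_sqr//.
  move: h1; rewrite ler_norml => /andP[_ h2].
  by rewrite -lerBrDl; apply: le_trans h2 _; rewrite mulNr addrC.
- move=> ln; have [be dom] := exists_dominant mu lambda ln.
  by exists be; exact: min_invertible.
Qed.
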